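(* Let $c\ge 1$ and let $M$ be the (nonzero) module of a minimal higher matrix factorization with respect to a regular sequence $f_1,\dots,f_c$ in a regular local ring $S$ with residue field $k$. Then the regularity of $\operatorname{Tor}^S(M,k)$ as an $E$-module is $1$.
   Context: Setting. $S$ is a regular local ring with maximal ideal $\mathfrak m$ and residue field $k$; all modules are finitely generated. $f_1,\dots,f_c\in\mathfrak m$ is a regular sequence, $I=(f_1,\dots,f_c)$, $R=S/I$. A map of free modules is minimal if its image lies in $\mathfrak m$ times the target. Higher matrix factorizations (Eisenbud–Peeva). A higher matrix factorization $(d,h)$ with respect to $f_1,\dots,f_c$ consists of: finitely generated free $S$-modules $A_0,A_1$ with filtrations $0=A_s(0)\subseteq A_s(1)\subseteq\dots\subseteq A_s(c)=A_s$ ($s=0,1$) such that each $A_s(p-1)$ is a free direct summand of $A_s(p)$; and maps $\bigoplus_{q=1}^cA_0(q)\xrightarrow{h}A_1\xrightarrow{d}A_0$ preserving filtrations (the left module being filtered by $\bigoplus_{q\le p}A_0(q)$) such that the induced maps $A_0(p)\xrightarrow{h_p}A_1(p)\xrightarrow{d_p}A_0(p)$ satisfy, for all $p$: (a) $d_ph_p\equiv f_p\,\mathrm{Id}_{A_0(p)}$ mod $(f_1,\dots,f_{p-1})A_0(p)$; (b) $\pi_ph_pd_p\equiv f_p\pi_p$ mod $(f_1,\dots,f_{p-1})B_1(p)$, where $\pi_p:A_1(p)\to B_1(p):=A_1(p)/A_1(p-1)$ is the projection. It is minimal if $d$ and $h$ are minimal. Its module is $M=\operatorname{coker}(R\otimes_S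 d)$. Exterior algebra. $E=\bigwedge_k(I/\mathfrak mI)=k\langle e_1,\dots,e_c\rangle$ with $e_i$ the class of $f_i$, of degree 1. If $(\mathbf F,\partial)$ is an $S$-free resolution of $M$ and $\sigma_i$ is a homotopy for $f_i$ on $\mathbf F$ ($\partial\sigma_i+\sigma_i\partial=f_i$), then $e_i$ acts on $\operatorname{Tor}^S(M,k)=H(\mathbf F\otimes k)$ by the map induced by $\sigma_i\otimes 1$; this gives a well-defined graded $E$-module structure independent of choices. Regularity. For a finite-dimensional $\mathbb Z$-graded vector space $V$, $\max V=\max\{j\mid V_j\ne0\}$. For a graded $E$-module $L$, $\operatorname{reg}_E L=\sup_i\{\max\operatorname{Tor}^E_i(L,k)-i\}$. *)

(* Defs.v *)
From HB Require Import structures.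
From mathcomp Require Import all_boot all_order all_algebra.
From mathcomp Require Import boolp classical_sets.

Set Implicit Arguments.
Unset Strict Implicit.
Unset Printing Implicit Defensive.

Import Order.TTheory GRing.Theory Num.Theory.
Local Open Scope ring_scope.

Section Submodules.
Variables (K : nzRingType) (V : lmodType K).
Implicit Types N P C : set V.

Definition submodule N : Prop :=
  N 0 /\ forall (a : K) x y, N x -> N y -> N (a *: x + y).

Definition lin_span n (g : 'I_n -> V) : set V :=
  fun x => exists a : 'I_n -> K, x = \sum_i a i *: g i.

(* J N, for a set J of scalars: finite sums of products. *)
Definition smul_set (J : set K) N : set V :=
  fun x => exists n (a : 'I_n -> K) (v : 'I_n -> V),
    (forall i, J (a i) /\ N (v i)) /\ x = \sum_i a i *: v i.

Definition sum_set N P : set V :=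
  fun x => exists y z, N y /\ P z /\ x = y + z.

Definition fg_free N : Prop :=
  exists n (b : 'I_n -> V), (forall i, N (b i)) /\
    forall x, N x -> exists! a : 'rV[K]_n, x = \sum_i a 0 i *: b i.

Definition direct_summand N P : Prop :=
  exists C, submodule C /\ P = sum_set N C /\
    forall x, N x -> C x -> x = 0.

End Submodules.

Section Rings.
Variable S : comNzRingType.
Implicit Types J m : set S.

Definition ideal J : Prop := submodule (J : set S^o).

Definition ideal_gen n (g : 'I_n -> S) : set S := lin_span (g : 'I_n -> S^o).

Definition maximal_ideal m : Prop :=
  [/\ ideal m, ~ m 1 &
      forall J, ideal J -> ~ J 1 -> (forall x, m x -> J x) -> J = m].

Definition prime_ideal J : Prop :=
  [/\ ideal J, ~ J 1 & forall x y, J (x * y) -> J x \/ J y].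

Definition noetherian : Prop :=
  forall J, ideal J -> exists n (g : 'I_n -> S), J = ideal_gen g.

Definition prime_chain (n : nat) : Prop :=
  exists P : nat -> set S,
    (forall i, (i <= n)%N -> prime_ideal (P i)) /\
    (forall i, (i < n)%N -> (forall x, P i x -> P i.+1 x) /\ P i <> P i.+1).

Definition krull_dim (n : nat) : Prop :=
  prime_chain n /\ forall n', prime_chain n' -> (n' <= n)%N.

Definition local_ring m : Prop :=
  maximal_ideal m /\ forall m', maximal_ideal m' -> m' = m.

Definition regular_local_ring m : Prop :=
  [/\ noetherian, local_ring m &
      exists n, krull_dim n /\ exists g : 'I_n -> S, m = ideal_gen g].

(* kappa presents k as S / m. *)
Definition residue_map m (k : fieldType) (kappa : {rmorphism S -> k}) : Prop :=
  (forall y, exists x, kappa x = y) /\ (forall x, kappa x = 0 <-> m x).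

(* The ideal (f_0, .., f_{p-1}). *)
Definition ideal_below c (f : 'I_c -> S) (p : nat) : set S :=
  ideal_gen (fun i : 'I_c => if (i < p)%N then f i else 0).

Definition regular_sequence c (f : 'I_c -> S) : Prop :=
  (forall (p : 'I_c) x, ideal_below f p (f p * x) -> ideal_below f p x) /\
  ~ ideal_below f c 1.

End Rings.

Section HMF.
Variables (S : comNzRingType) (c : nat) (f : 'I_c -> S).

Definition free_filtration (A : lmodType S) (Fil : nat -> set A) : Prop :=
  [/\ forall p, (p <= c)%N -> submodule (Fil p),
      Fil 0%N = [set 0]%classic,
      Fil c = setT,
      fg_free (Fil c) &
      forall p, (p < c)%N ->
        fg_free (Fil p) /\ direct_summand (Fil p) (Fil p.+1)].

(* The members of the filtrations that occur in the p-th conditions, which are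
   A_s(p) for p = 1..c, are Fil_s p.+1 for p : 'I_c.  A map h from the direct
   sum of the A_0(q) is the family of its restrictions hmf_h q; hmf_h q is
   meaningful (and required to be linear) only on A_0(q). *)
Record hmf : Type := Hmf {
  hmf_A0 : lmodType S;
  hmf_A1 : lmodType S;
  hmf_Fil0 : nat -> set hmf_A0;
  hmf_Fil1 : nat -> set hmf_A1;
  hmf_d : {linear hmf_A1 -> hmf_A0};
  hmf_h : 'I_c -> hmf_A0 -> hmf_A1;
  _ : free_filtration hmf_Fil0;
  _ : free_filtration hmf_Fil1;
  _ : forall (q : 'I_c) (a : S) x y, hmf_Fil0 q.+1 x -> hmf_Fil0 q.+1 y ->
        hmf_h q (a *: x + y) = a *: hmf_h q x + hmf_h q y;
  _ : forall p y, (p <= c)%N -> hmf_Fil1 p y -> hmf_Fil0 p (hmf_d y);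
  _ : forall p q : 'I_c, (q <= p)%N -> forall x,
        hmf_Fil0 q.+1 x -> hmf_Fil1 p.+1 (hmf_h q x);
  _ : forall (p : 'I_c) x, hmf_Fil0 p.+1 x ->
        smul_set (ideal_below f p) (hmf_Fil0 p.+1)
          (hmf_d (hmf_h p x) - f p *: x);
  (* a congruence in B_1(p) = A_1(p) / A_1(p-1), lifted to A_1(p) *)
  _ : forall (p : 'I_c) y, hmf_Fil1 p.+1 y ->
        sum_set (smul_set (ideal_below f p) (hmf_Fil1 p.+1)) (hmf_Fil1 p)
          (hmf_h p (hmf_d y) - f p *: y)
}.

End HMF.

Arguments hmf_Fil0 {S c f} h p _.
Arguments hmf_Fil1 {S c f} h p _.
Arguments hmf_h {S c f} h q _.

Section HMFModule.
Variables (S : comNzRingType) (c : nat) (f : 'I_c -> S).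

Definition hmf_minimal (m : set S) (H : hmf f) : Prop :=
  (forall y, smul_set m setT (hmf_d H y)) /\
  (forall (q : 'I_c) x, hmf_Fil0 H q.+1 x -> smul_set m setT (hmf_h H q x)).

(* pi presents M as coker (R (x) d) = A_0 / (d A_1 + I A_0), where
   R (x) A_s = A_s / I A_s. *)
Definition hmf_module (H : hmf f) (M : lmodType S)
    (pi : {linear hmf_A0 H -> M}) : Prop :=
  (forall z, exists x, pi x = z) /\
  (forall x, pi x = 0 <->
     sum_set (fun z => exists y, z = hmf_d H y)
             (smul_set (ideal_below f c) setT) x).

End HMFModule.

(* The module in degree n is 'rV_(r n), and the differential from degree n.+1
   to degree n is x |-> x *m D n, which is left linear even over a
   noncommutative ring. *)
Section Complexes.
Variables (K : nzRingType) (r : nat -> nat) (D : forall n, 'M[K]_(r n.+1, r n)).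

Definition cycles (n : nat) : set 'rV[K]_(r n) :=
  match n return set 'rV[K]_(r n) with
  | 0 => setT
  | n'.+1 => fun x => x *m D n' = 0
  end.

Definition boundaries (n : nat) : set 'rV[K]_(r n) :=
  fun x => exists y, x = y *m D n.

Definition free_resolution (M : lmodType K)
    (eps : {linear 'rV[K]_(r 0%N) -> M}) : Prop :=
  [/\ forall z, exists x, eps x = z,
      forall x, eps x = 0 <-> boundaries x &
      forall n, cycles (n := n.+1) = boundaries (n := n.+1)].

End Complexes.

(* With rows, the composite "first s, then D" is s *m D. *)
Definition homotopy_for (S : comNzRingType) (r : nat -> nat)
    (D : forall n, 'M[S]_(r n.+1, r n)) (a : S)
    (s : forall n, 'M[S]_(r n, r n.+1)) : Prop :=
  s 0%N *m D 0%N = a%:M /\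
  forall n, s n.+1 *m D n.+1 + D n *m s n = a%:M.

(* The exterior algebra k<e_0, .., e_{c-1}>. An element is the family of its
   coordinates on the basis of the e_A = e_{i_1} .. e_{i_s}, for
   A = {i_1 < .. < i_s}. *)
Definition ext (k : fieldType) (c : nat) : Type := {ffun {set 'I_c} -> k^o}.

HB.instance Definition _ (k : fieldType) (c : nat) :=
  GRing.Lmodule.copy (ext k c) {ffun {set 'I_c} -> k^o}.

Section ExtRing.
Variables (k : fieldType) (c : nat).
Implicit Types (A B C : {set 'I_c}) (x y z : ext k c).

Definition ext_coef x A : k := (x : {ffun {set 'I_c} -> k^o}) A.

Definition ext_inv A B : nat := \sum_(i in A) \sum_(j in B) (j < i)%N.

(* e_A e_B = ext_sign A B *: e_(A :|: B) *)
Definition ext_sign A B : k :=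
  if [disjoint A & B] then (-1) ^+ ext_inv A B else 0.

Definition ext_one : ext k c := [ffun A => (A == finset.set0)%:R].

Definition ext_mul x y : ext k c :=
  [ffun C => \sum_A \sum_(B | A :|: B == C)
               ext_sign A B * ext_coef x A * ext_coef y B].

Lemma ext_sign_cocycle A B C :
  ext_sign A B * ext_sign (A :|: B) C = ext_sign A (B :|: C) * ext_sign B C.
Proof.
have dU (X Y Z : {set 'I_c}) :
    [disjoint X :|: Y & Z] = [disjoint X & Z] && [disjoint Y & Z].
  by rewrite -!finset.setI_eq0 finset.setIUl finset.setU_eq0.
have dUr (X Y Z : {set 'I_c}) :
    [disjoint X & Y :|: Z] = [disjoint X & Y] && [disjoint X & Z].
  by rewrite -!finset.setI_eq0 finset.setIUr finset.setU_eq0.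
rewrite /ext_sign dU dUr.
have [dAB|] := boolP [disjoint A & B]; last by rewrite !mul0r.
have [dAC|] := boolP [disjoint A & C]; last by rewrite mulr0 mul0r.
have [dBC|] := boolP [disjoint B & C]; last by rewrite !mulr0.
rewrite /= -!exprD; congr (_ ^+ _).
rewrite /ext_inv.
have -> : (\sum_(i in A :|: B) \sum_(j in C) (j < i) =
    \sum_(i in A) \sum_(j in C) (j < i) +
    \sum_(i in B) \sum_(j in C) (j < i))%N
  by rewrite -bigU //; apply: eq_bigl => i; rewrite !inE.
have -> : (\sum_(i in A) \sum_(j in B :|: C) (j < i) =
    \sum_(i in A) \sum_(j in B) (j < i) +
    \sum_(i in A) \sum_(j in C) (j < i))%N.
  rewrite -big_split /=; apply: eq_bigr => i _.
  by rewrite -bigU //; apply: eq_bigl => j; rewrite !inE.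
by rewrite addnA.
Qed.

Lemma ext_mulA : associative ext_mul.
Proof.
move=> x y z; apply/ffunP => C; rewrite !ffunE.
pose t A B P := ext_sign A B * ext_sign (A :|: B) P *
  (ext_coef x A * ext_coef y B * ext_coef z P).
transitivity (\sum_A \sum_B \sum_(P | A :|: B :|: P == C) t A B P).
  apply: eq_bigr => A _.
  transitivity (\sum_(Q | A :|: Q == C) \sum_B
                 \sum_(P | B :|: P == Q) t A B P).
    apply: eq_bigr => Q _; rewrite {2}/ext_coef ffunE mulr_sumr.
    apply: eq_bigr => B _; rewrite mulr_sumr.
    apply: eq_bigr => P /eqP <-; rewrite /t ext_sign_cocycle.
    by rewrite -!mulrA; congr (_ * _); rewrite mulrCA.
  rewrite exchange_big /=; apply: eq_bigr => B _.
  rewrite (exchange_big_dep predT) //= [RHS]big_mkcond /=.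
  apply: eq_bigr => P _.
  rewrite (eq_bigl (fun Q => (Q == B :|: P) && (A :|: Q == C))); last first.
    by move=> Q; rewrite andbC eq_sym.
  by rewrite big_mkcondr big_pred1_eq finset.setUA.
symmetry.
transitivity (\sum_Q \sum_A \sum_(B | A :|: B == Q)
               \sum_(P | Q :|: P == C) t A B P).
  apply: eq_bigr => Q _.
  under eq_bigr => P _ do
    rewrite /ext_coef ffunE mulr_sumr mulr_suml.
  rewrite exchange_big /=; apply: eq_bigr => A _.
  under eq_bigr => P _ do rewrite mulr_sumr mulr_suml.
  rewrite exchange_big /=; apply: eq_bigr => B /eqP <-.
  apply: eq_bigr => P _; rewrite /t.
  by rewrite !mulrA [ext_sign A B * _]mulrC.
rewrite exchange_big /=; apply: eq_bigr => A _.
rewrite (exchange_big_dep predT) //=; apply: eq_bigr => B _.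
rewrite (eq_bigl (pred1 (A :|: B))); last by move=> Q /=; rewrite eq_sym.
by rewrite big_pred1_eq.
Qed.

Lemma ext_sign0s A : ext_sign finset.set0 A = 1.
Proof. by rewrite /ext_sign -finset.setI_eq0 finset.set0I eqxx /ext_inv big_set0. Qed.

Lemma ext_signs0 A : ext_sign A finset.set0 = 1.
Proof.
rewrite /ext_sign -finset.setI_eq0 finset.setI0 eqxx /ext_inv.
by rewrite big1 // => i _; rewrite big_set0.
Qed.

Lemma ext_mul1x : left_id ext_one ext_mul.
Proof.
move=> x; apply/ffunP => C; rewrite ffunE (bigD1 finset.set0) //= [X in _ + X]big1.
  rewrite addr0 (eq_bigl (pred1 C)); last by move=> B /=; rewrite finset.set0U.
  by rewrite big_pred1_eq ext_sign0s /ext_coef ffunE eqxx !mul1r.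
move=> A /negbTE nA; apply: big1 => B _.
by rewrite /ext_coef ffunE nA mulr0 mul0r.
Qed.

Lemma ext_mulx1 : right_id ext_one ext_mul.
Proof.
move=> x; apply/ffunP => C; rewrite ffunE (exchange_big_dep predT) //=.
rewrite (bigD1 finset.set0) //= [X in _ + X]big1.
  rewrite addr0 (eq_bigl (pred1 C)); last by move=> B /=; rewrite finset.setU0.
  by rewrite big_pred1_eq ext_signs0 /ext_coef ffunE eqxx mulr1 mul1r.
move=> A /negbTE nA; apply: big1 => B _.
by rewrite /ext_coef ffunE nA mulr0.
Qed.

Lemma ext_mulDl : left_distributive ext_mul +%R.
Proof.
move=> x y z; apply/ffunP => C; rewrite !ffunE -big_split /=.
apply: eq_bigr => A _; rewrite -big_split; apply: eq_bigr => B _.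
by rewrite /ext_coef ffunE mulrDr mulrDl.
Qed.

Lemma ext_mulDr : right_distributive ext_mul +%R.
Proof.
move=> x y z; apply/ffunP => C; rewrite !ffunE -big_split /=.
apply: eq_bigr => A _; rewrite -big_split; apply: eq_bigr => B _.
by rewrite /ext_coef ffunE mulrDr.
Qed.

Lemma ext_one_neq0 : ext_one != 0.
Proof.
apply/eqP => /ffunP /(_ finset.set0); rewrite !ffunE eqxx => /eqP.
by rewrite oner_eq0.
Qed.

HB.instance Definition _ := GRing.Zmodule_isNzRing.Build (ext k c)
  ext_mulA ext_mul1x ext_mulx1 ext_mulDl ext_mulDr ext_one_neq0.

Lemma ext_coefZ (a : k) x A : ext_coef (a *: x) A = a * ext_coef x A.
Proof. by rewrite /ext_coef ffunE. Qed.

Lemma ext_coefM x y C :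
  ext_coef (x * y) C = \sum_A \sum_(B | A :|: B == C)
                         ext_sign A B * ext_coef x A * ext_coef y B.
Proof. by rewrite {1}/ext_coef ffunE. Qed.

Lemma ext_scalerAl (a : k) x y : a *: (x * y) = (a *: x) * y.
Proof.
apply/ffunP => C; rewrite -!/(ext_coef _ C) ext_coefZ !ext_coefM mulr_sumr.
apply: eq_bigr => A _; rewrite mulr_sumr; apply: eq_bigr => B _.
by rewrite ext_coefZ !mulrA [a * _]mulrC.
Qed.

HB.instance Definition _ :=
  GRing.Lmodule_isLalgebra.Build k (ext k c) ext_scalerAl.

Lemma ext_scalerAr (a : k) x y : a *: (x * y) = x * (a *: y).
Proof.
apply/ffunP => C; rewrite -!/(ext_coef _ C) ext_coefZ !ext_coefM mulr_sumr.
apply: eq_bigr => A _; rewrite mulr_sumr; apply: eq_bigr => B _.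
by rewrite ext_coefZ mulrCA.
Qed.

HB.instance Definition _ :=
  GRing.Lalgebra_isAlgebra.Build k (ext k c) ext_scalerAr.

Definition ext_gen (i : 'I_c) : ext k c := [ffun A => (A == [set i])%:R].

Definition ext_aug x : k := ext_coef x finset.set0.

Definition ext_homog (d : int) x : Prop :=
  forall A, ext_coef x A != 0 -> #|A|%:Z = d.

End ExtRing.

Section GradedModules.
Variables (k : fieldType) (c : nat) (L : lmodType (ext k c)).

(* The last two conditions say that L is the direct sum of the gr j. *)
Definition grading (gr : int -> set L) : Prop :=
  [/\ forall j, gr j 0 /\ forall x y, gr j x -> gr j y -> gr j (x + y),
      forall d j a x, ext_homog d a -> gr j x -> gr (d + j) (a *: x),
      forall x, exists (s : seq int) (y : int -> L),
        (forall j, gr j (y j)) /\ x = \sum_(j <- s) y j &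
      forall (s : seq int) (y : int -> L), uniq s ->
        (forall j, gr j (y j)) -> \sum_(j <- s) y j = 0 ->
        forall j, j \in s -> y j = 0].

(* The s-th basis vector of the i-th free module has degree deg i s. *)
Definition graded_free_resolution (gr : int -> set L) (r : nat -> nat)
    (deg : forall i, 'I_(r i) -> int)
    (D : forall i, 'M[ext k c]_(r i.+1, r i))
    (eps : {linear 'rV[ext k c]_(r 0%N) -> L}) : Prop :=
  [/\ free_resolution D eps,
      forall i s t, ext_homog (deg i.+1 s - deg i t) (D i s t) &
      forall s, gr (deg 0%N s) (eps (delta_mx 0 s))].

(* Tor^E_i(L, k)_j <> 0. Tensoring a complex of free modules with k applies
   the augmentation E -> k to the entries of the differentials. *)
Definition TorE_neq0 (gr : int -> set L) (i : nat) (j : int) : Prop :=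
  exists r deg D eps, graded_free_resolution gr (r := r) deg D eps /\
    let Dk n := map_mx (@ext_aug k c) (D n) in
    exists v : 'rV[k]_(r i),
      [/\ forall s, v 0 s != 0 -> deg i s = j,
          cycles Dk v & ~ boundaries Dk v].

Definition max_TorE (gr : int -> set L) (i : nat) (z : int) : Prop :=
  TorE_neq0 gr i z /\ forall j, TorE_neq0 gr i j -> j <= z.

(* Since sup_i (max_j - i) is a supremum of integers, it is rho exactly when
   rho bounds all the j - i and is attained. *)
Definition is_regularity (gr : int -> set L) (rho : int) : Prop :=
  (forall i j, TorE_neq0 gr i j -> j - i%:Z <= rho) /\
  (exists i z, max_TorE gr i z /\ z - i%:Z = rho).

End GradedModules.

(* The graded E-module Tor^S(M, k), up to isomorphism: the module (L, gr) is
   identified, through maps p n that matter only on cycles, with the homology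
   of F (x) k for a free resolution F of M, the generator e_i acting as
   sigma i (x) 1 for homotopies sigma i for f i on F. *)
Definition is_TorS (S : comNzRingType) (k : fieldType)
    (kappa : {rmorphism S -> k}) (c : nat) (f : 'I_c -> S) (M : lmodType S)
    (L : lmodType (ext k c)) (gr : int -> set L) : Prop :=
  grading gr /\
  exists (r : nat -> nat) (D : forall n, 'M[S]_(r n.+1, r n))
    (eps : {linear 'rV[S]_(r 0%N) -> M})
    (sigma : 'I_c -> forall n, 'M[S]_(r n, r n.+1))
    (p : forall n, 'rV[k]_(r n) -> L),
    let Dk n := map_mx kappa (D n) in
    [/\ free_resolution D eps,
        forall i, homotopy_for D (f i) (sigma i),
        (forall n a x y, cycles Dk (n := n) x -> cycles Dk y ->
           p n (a *: x + y) = a%:A *: p n x + p n y) /\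
        (forall n x, cycles Dk (n := n) x ->
           p n x = 0 <-> boundaries Dk x),
        (forall n z, gr n%:Z z <-> exists x, cycles Dk (n := n) x /\ p n x = z)
        /\ (forall j z, j < 0 -> gr j z -> z = 0) &
        forall i n x, cycles Dk (n := n) x ->
          p n.+1 (x *m map_mx kappa (sigma i n)) = ext_gen k i *: p n x].

(* Main.v *)
(** Write [reg_q T] for the regularity of a graded module [T] over the exterior
algebra [E_q] on [e_1, .., e_q], and [R_q = S / (f_1, .., f_q)].

Regularity is read off the Cartan complex, which in homological degree [i] is
[T] tensored with the [i]-th divided power of [k^q]: [reg_q T <= rho] as soon
as that complex is exact at [T_n] for all [n > rho].  Filtering by the exponent
of the last variable shows that exactness at [T_n] passes from [E_(q-1)] to
[E_q], whatever the action of [e_q].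

The module [M(p)] of the truncation [A(p)] fits in an exact sequence
[0 -> R_(p-1) ⊗ B_1(p) -> M(p-1) ⊕ R_(p-1) ⊗ B_0(p) -> M(p) -> 0],
where injectivity comes from condition (b) and the regularity of [f_p] on
[R_(p-1)].  Its first map is minimal, so lifting it to a minimal map of
resolutions (Koszul complexes for the free [R_(p-1)]-modules) and taking the
mapping cone gives a minimal [S]-free resolution of [M(p)], and
[Tor^S(M(p), k)] is, over [E_(p-1)], an extension of free modules generated in
degrees 0 and 1 by [Tor^S(M(p-1), k)].  By induction [reg_(p-1) <= 1], hence
[reg_p <= 1].  Condition (a) makes [M(p)] an [R_p]-module, which provides the
operator [e_p].

For equality, if [Tor_1 = E_1 Tor_0], then Nakayama's lemma gives
[d A_1 ⊆ I A_0]; by condition (a) and minimality of [h] this puts [f_c] in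
[(f_1, .., f_(c-1)) + m I], so in [(f_1, .., f_(c-1))], which is absurd. *)

Require Import Defs.
From HB Require Import structures.
From mathcomp Require Import all_boot all_order all_algebra.
From mathcomp Require Import boolp classical_sets.

Set Implicit Arguments.
Unset Strict Implicit.
Unset Printing Implicit Defensive.

Import Order.TTheory GRing.Theory Num.Theory.
Local Open Scope ring_scope.

(** * Free resolutions *)

(** The i-th divided power on [T_n] contributes to [Tor_i] in internal degree n + i; hence a bound
    on j - i becomes a condition on n alone. Iterating yields a graded free resolution whose i-th
    term is generated in degrees at most rho + i, and any other resolution is compared with it.

    The operators come from homotopies that satisfy no identities over S. Over k they square to zero
    and anticommute because the complex is minimal, so every complex of the induction has to be kept
    minimal, and the given Tor, computed from an arbitrary resolution, has to be moved to the
    minimal one.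

    The obstacle is e_p. Since f_p need not annihilate M(p-1), its homotopy exists on the whole cone
    only and need not respect the extension. This is why a step that adds an operator with an
    unknown action is indispensable. *)

Lemma dependent_choice_seq (T : nat -> Type) (P : forall n, T n -> Prop)
    (R : forall n, T n -> T n.+1 -> Prop) (x0 : T 0%N) :
  P 0%N x0 ->
  (forall n x, P n x -> exists y, P n.+1 y /\ R n x y) ->
  exists s : forall n, T n,
    [/\ s 0%N = x0, forall n, P n (s n) & forall n, R n (s n) (s n.+1)].
Proof.
move=> Px0 step.
pose next n (x : {x | P n x}) : {y | P n.+1 y /\ R n (sval x) y} :=
  cid (step n (sval x) (svalP x)).
pose s := nat_rect (fun n => {x | P n x}) (exist _ x0 Px0)
  (fun n x => exist _ (sval (next n x)) (svalP (next n x)).1).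
exists (fun n => sval (s n)); split => // n; first exact: svalP.
exact: (svalP (next n (s n))).2.
Qed.

Section LinearCombination.
Variables (K : nzRingType) (V : lmodType K) (n : nat) (b : 'I_n -> V).

Definition lincomb (x : 'rV[K]_n) : V := \sum_j x 0 j *: b j.

Lemma lincomb_is_linear : linear lincomb.
Proof.
move=> a x y; rewrite /lincomb scaler_sumr -big_split /=.
by apply: eq_bigr => j _; rewrite !mxE scalerDl scalerA.
Qed.

HB.instance Definition _ :=
  GRing.isLinear.Build K 'rV[K]_n V *:%R lincomb lincomb_is_linear.

Lemma lincomb_delta j : lincomb (delta_mx 0 j) = b j.
Proof.
rewrite /lincomb (bigD1 j) //= mxE !eqxx scale1r big1 ?addr0 // => i ij.
by rewrite mxE eqxx (negbTE ij) scale0r.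
Qed.

End LinearCombination.

Section RowLifting.
Variable K : nzRingType.

Lemma lincombE (V : lmodType K) n (u : {linear 'rV[K]_n -> V}) x :
  u x = lincomb (fun j => u (delta_mx 0 j)) x.
Proof.
rewrite {1}[x]row_sum_delta linear_sum /=; apply: eq_bigr => j _.
by rewrite linearZ.
Qed.

Lemma lift_mx p n q (A : 'M[K]_(p, n)) (D : 'M[K]_(q, n)) :
  (forall i, exists y, row i A = y *m D) -> exists B, A = B *m D.
Proof.
move=> /choice [y yP]; exists (\matrix_i y i); apply/row_matrixP => i.
by rewrite row_mul rowK.
Qed.

Lemma lift_linear (V : lmodType K) p n (u : {linear 'rV[K]_p -> V})
    (v : {linear 'rV[K]_n -> V}) :
  (forall z, exists x, v x = z) ->
  exists A : 'M[K]_(p, n), forall x, v (x *m A) = u x.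
Proof.
move=> v_surj.
have /choice [y yP] j : exists y, v y = u (delta_mx 0 j) by exact: v_surj.
exists (\matrix_i y i) => x; rewrite (lincombE u) mulmx_sum_row linear_sum.
by apply: eq_bigr => j _; rewrite linearZ /= rowK yP.
Qed.

End RowLifting.

Section Acyclic.
Variable K : nzRingType.

Definition acyclic (r : nat -> nat) (D : forall n, 'M[K]_(r n.+1, r n)) : Prop :=
  (forall n, D n.+1 *m D n = 0) /\
  (forall n (x : 'rV_(r n.+1)), x *m D n = 0 -> exists y, x = y *m D n.+1).

Lemma free_resolution_acyclic r (D : forall n, 'M[K]_(r n.+1, r n))
    (M : lmodType K) (eps : {linear 'rV[K]_(r 0%N) -> M}) :
  free_resolution D eps -> acyclic D.
Proof.
case=> _ _ ex; split=> n.
  apply/row_matrixP => i; rewrite row_mul row0.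
  have : boundaries D (row i (D n.+1)) by exists (delta_mx 0 i); rewrite rowE.
  by rewrite -ex.
move=> x x0; have : cycles D (n := n.+1) x by [].
by rewrite ex.
Qed.

Lemma acyclic_free_resolution r (D : forall n, 'M[K]_(r n.+1, r n))
    (M : lmodType K) (eps : {linear 'rV[K]_(r 0%N) -> M}) :
  acyclic D -> (forall z, exists x, eps x = z) ->
  (forall x, eps x = 0 <-> boundaries D x) -> free_resolution D eps.
Proof.
case=> dd ex es ek; split => // n; apply/seteqP; split => x /=; first exact: ex.
by case=> y ->; rewrite -mulmxA dd mulmx0.
Qed.

Lemma acyclicN r (D : forall n, 'M[K]_(r n.+1, r n)) :
  acyclic D -> acyclic (fun n => - D n).
Proof.
case=> dd ex; split=> n; first by rewrite mulmxN mulNmx dd !oppr0.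
move=> x; rewrite mulmxN => /eqP; rewrite oppr_eq0 => /eqP /ex [y ->].
by exists (- y); rewrite mulNmx mulmxN opprK.
Qed.

Lemma acyclic_shift r (D : forall n, 'M[K]_(r n.+1, r n)) :
  acyclic D -> acyclic (r := fun n => r n.+1) (fun n => D n.+1).
Proof. by case=> dd ex; split=> n; [apply: dd | apply: ex]. Qed.

Lemma acyclic_lift r (D : forall n, 'M[K]_(r n.+1, r n)) p n
    (A : 'M[K]_(p, r n.+1)) :
  acyclic D -> A *m D n = 0 -> exists B, A = B *m D n.+1.
Proof.
case=> _ ex AD; apply: lift_mx => i; apply: ex.
by rewrite -row_mul AD row0.
Qed.

Lemma chain_map_lift r (D : forall n, 'M[K]_(r n.+1, r n))
    r' (D' : forall n, 'M[K]_(r' n.+1, r' n)) (a0 : 'M[K]_(r 0%N, r' 0%N)) :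
  acyclic D -> acyclic D' -> (exists B, D 0%N *m a0 = B *m D' 0%N) ->
  exists a : forall n, 'M[K]_(r n, r' n),
    a 0%N = a0 /\ forall n, a n.+1 *m D' n = D n *m a n.
Proof.
move=> aD aD' base.
case: (@dependent_choice_seq (fun n => 'M[K]_(r n, r' n))
  (fun n a => exists B, D n *m a = B *m D' n)
  (fun n a b => b *m D' n = D n *m a) a0) => //.
  move=> n a [B aB]; exists B; split => //.
  by apply: acyclic_lift => //; rewrite -mulmxA -aB mulmxA aD.1 mul0mx.
by move=> a [a0E _ aP]; exists a.
Qed.

Lemma null_homotopy r (D : forall n, 'M[K]_(r n.+1, r n))
    r' (D' : forall n, 'M[K]_(r' n.+1, r' n))
    (u : forall n, 'M[K]_(r n, r' n)) :
  (forall n, D n.+1 *m D n = 0) -> acyclic D' ->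
  (forall n, u n.+1 *m D' n = D n *m u n) ->
  (exists B, u 0%N = B *m D' 0%N) ->
  exists t : forall n, 'M[K]_(r n, r' n.+1),
    u 0%N = t 0%N *m D' 0%N /\
    forall n, u n.+1 = t n.+1 *m D' n.+1 + D n *m t n.
Proof.
move=> dd aD' uD [t0 t0E].
case: (@dependent_choice_seq (fun n => 'M[K]_(r n, r' n.+1))
  (fun n t => D n *m (u n - t *m D' n) = 0)
  (fun n t t' => u n.+1 = t' *m D' n.+1 + D n *m t) t0).
- by rewrite t0E subrr mulmx0.
- move=> n t tP.
  have [|t' t'E] := @acyclic_lift _ D' _ n (u n.+1 - D n *m t) aD'.
    by rewrite mulmxBl uD -mulmxA -mulmxBr.
  exists t'; rewrite -t'E subrK; split => //.
  by rewrite opprB addrC subrK mulmxA dd mul0mx.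
- by move=> t [t00 _ tP]; exists t; rewrite t00.
Qed.

Section Resolutions.
Variables (M : lmodType K).
Variables (r : nat -> nat) (D : forall n, 'M[K]_(r n.+1, r n)).
Variable (eps : {linear 'rV[K]_(r 0%N) -> M}).
Hypothesis resD : free_resolution D eps.

Lemma resolution_lift0 p (A : 'M[K]_(p, r 0%N)) :
  (forall x, eps (x *m A) = 0) -> exists B, A = B *m D 0%N.
Proof.
move=> A0; apply: lift_mx => i; case: resD => _ epsK _.
by case: (epsK (row i A)) => + _; apply; rewrite rowE.
Qed.

Variables (r' : nat -> nat) (D' : forall n, 'M[K]_(r' n.+1, r' n)).
Variable (eps' : {linear 'rV[K]_(r' 0%N) -> M}).
Hypothesis resD' : free_resolution D' eps'.

Lemma resolution_map : exists a : forall n, 'M[K]_(r' n, r n),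
  (forall n, a n.+1 *m D n = D' n *m a n) /\ forall x, eps (x *m a 0%N) = eps' x.
Proof.
have acD := free_resolution_acyclic resD; have acD' := free_resolution_acyclic resD'.
have [a0 a0E] := lift_linear eps' (let: And3 s _ _ := resD in s).
have [|a [a00 aD]] := chain_map_lift (a0 := a0) acD' acD.
  apply: resolution_lift0 => x; rewrite mulmxA a0E.
  by case: resD' => _ eps'K _; apply/eps'K; exists x.
by exists a; split => // x; rewrite a00.
Qed.

Lemma resolution_homotopy (a : forall n, 'M[K]_(r' n, r n))
    (b : forall n, 'M[K]_(r n, r' n)) :
  (forall n, a n.+1 *m D n = D' n *m a n) -> (forall x, eps (x *m a 0%N) = eps' x) ->
  (forall n, b n.+1 *m D' n = D n *m b n) -> (forall x, eps' (x *m b 0%N) = eps x) ->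
  exists t : forall n, 'M[K]_(r n, r n.+1),
    1%:M - b 0%N *m a 0%N = t 0%N *m D 0%N /\
    forall n, 1%:M - b n.+1 *m a n.+1 = t n.+1 *m D n.+1 + D n *m t n.
Proof.
move=> aD aE bD bE; have acD := free_resolution_acyclic resD.
apply: (null_homotopy (u := fun n => 1%:M - b n *m a n) acD.1 acD).
  by move=> n; rewrite mulmxBl mulmxBr mul1mx mulmx1 -mulmxA aD mulmxA bD mulmxA.
apply: resolution_lift0 => x.
by rewrite mulmxBr mulmx1 linearB /= mulmxA aE bE subrr.
Qed.

End Resolutions.
End Acyclic.

(** * Cartan complexes *)

Section CartanDifferential.
Variables (A B : zmodType) (e : nat -> {additive A -> B}).
Implicit Types (phi psi : seq nat -> A) (al be : seq nat).

(* A Cartan chain with coefficients in A assigns an element of A to every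
   exponent vector; exponents of e_0, .., e_(q-1) are listed from the last to
   the first, and values at lists of another length are junk. *)
Fixpoint cartan_d (q : nat) phi al : B :=
  if q is q'.+1 then
    if al is j :: al' then
      cartan_d q' (fun be => phi (j :: be)) al' + e q' (phi (j.+1 :: al'))
    else 0
  else 0.

Lemma eq_cartan_d q phi psi al :
  size al = q -> (forall be, size be = q -> phi be = psi be) ->
  cartan_d q phi al = cartan_d q psi al.
Proof.
elim: q phi psi al => [|q IH] phi psi [|j al] //= [sal] eq_phi.
rewrite eq_phi /= ?sal //; congr (_ + _); apply: IH => // be sbe.
by rewrite eq_phi //= sbe.
Qed.

Lemma cartan_dB q phi psi al :
  cartan_d q (fun be => phi be - psi be) al = cartan_d q phi al - cartan_d q psi al.
Proof.
elim: q phi psi al => [|q IH] phi psi [|j al] //=; rewrite ?subr0 // IH raddfB.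
by rewrite opprD addrACA.
Qed.

Lemma cartan_d0 q phi al :
  size al = q -> (forall be, size be = q -> phi be = 0) -> cartan_d q phi al = 0.
Proof.
elim: q phi al => [|q IH] phi [|j al] //= [sal] phi0.
by rewrite phi0 /= ?sal // raddf0 addr0 IH // => be sbe; rewrite phi0 //= sbe.
Qed.

End CartanDifferential.

Lemma cartan_d_comp (A B A' B' : zmodType) (e : nat -> {additive A -> B})
    (e' : nat -> {additive A' -> B'}) (g : A -> A') (g' : {additive B -> B'}) q
    (phi : seq nat -> A) al :
  (forall i x, (i < q)%N -> e' i (g x) = g' (e i x)) ->
  cartan_d e' q (fun be => g (phi be)) al = g' (cartan_d e q phi al).
Proof.
elim: q phi al => [|q IH] phi [|j al] eg //=; rewrite ?raddf0 //.
by rewrite raddfD /= eg // (IH (fun be => phi (j :: be))) // => i x /ltnW/eg.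
Qed.

Lemma cartan_d_anticomp (A B A' B' : zmodType) (e : nat -> {additive A -> B})
    (e' : nat -> {additive A' -> B'}) (g : A -> A') (g' : {additive B -> B'}) q
    (phi : seq nat -> A) al :
  (forall i x, (i < q)%N -> e' i (g x) = - g' (e i x)) ->
  cartan_d e' q (fun be => g (phi be)) al = - g' (cartan_d e q phi al).
Proof.
move=> eg; rewrite (@cartan_d_comp A B A' B' e e' g (-%R \o g')) //.
Qed.

Section CartanSquare.
Variables (A B C : zmodType).
Variables (e : nat -> {additive A -> B}) (e' : nat -> {additive B -> C}).
Variable (q : nat).
Hypothesis e_anticomm :
  forall i j x, (i < q)%N -> (j < q)%N -> e' i (e j x) = - e' j (e i x).
Hypothesis e_square : forall i x, (i < q)%N -> e' i (e i x) = 0.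

Lemma cartan_dd p phi al :
  (p <= q)%N -> size al = p -> cartan_d e' p (cartan_d e p phi) al = 0.
Proof.
elim: p phi al => [|p IH] phi [|j al] //= pq [sal].
have -> : cartan_d e' p
    (fun be => cartan_d e p (fun ga => phi (j :: ga)) be + e p (phi (j.+1 :: be))) al
  = cartan_d e' p (cartan_d e p (fun ga => phi (j :: ga))) al
    + cartan_d e' p (fun be => e p (phi (j.+1 :: be))) al.
  have := cartan_dB e' p (cartan_d e p (fun ga => phi (j :: ga)))
    (fun be => - e p (phi (j.+1 :: be))) al.
  rewrite (@cartan_d_comp B C B C e' e' -%R -%R) /=; first last.
    by move=> i x _; rewrite raddfN.
  rewrite opprK => <-; apply: eq_cartan_d => // be _.
  by rewrite opprK.
rewrite IH ?(ltnW pq) // add0r.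
rewrite (@cartan_d_anticomp A B B C e e' (e p) (e' p) p
  (fun be => phi (j.+1 :: be))); last first.
  by move=> i x ip; rewrite e_anticomm // (ltn_trans ip pq).
by rewrite raddfD /= e_square // addr0 addNr.
Qed.

End CartanSquare.

(** Bounded exponents make chains elements of a direct sum over divided powers. The bound is what
    starts the descending induction in [cartan_exactS]. *)
Definition fin_supp (A : zmodType) (phi : seq nat -> A) : Prop :=
  exists N : nat, forall al, has (leq N) al -> phi al = 0.

Section FinSupp.
Variables A B : zmodType.

Lemma fin_suppB (phi psi : seq nat -> A) :
  fin_supp phi -> fin_supp psi -> fin_supp (fun al => phi al - psi al).
Proof.
move=> [M phiM] [N psiN]; exists (maxn M N) => al /hasP[i ial].
rewrite geq_max => /andP[Mi Ni].
by rewrite phiM ?psiN ?subr0 //; apply/hasP; exists i.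
Qed.

Lemma fin_supp_comp (g : {additive A -> B}) (phi : seq nat -> A) :
  fin_supp phi -> fin_supp (fun al => g (phi al)).
Proof. by move=> [N phiN]; exists N => al /phiN ->; rewrite raddf0. Qed.

Lemma fin_supp_tail j (phi : seq nat -> A) :
  fin_supp phi -> fin_supp (fun al => phi (j :: al)).
Proof.
by move=> [N phiN]; exists N => al alN; rewrite phiN //= alN orbT.
Qed.

Lemma fin_supp_shift (phi : seq nat -> A) :
  fin_supp phi -> fin_supp (fun al => if al is j :: be then phi (j.+1 :: be) else 0).
Proof.
move=> [N phiN]; exists N => -[|j al] //= /orP[Nj|alN].
  by rewrite phiN //= (leq_trans Nj).
by rewrite phiN //= alN orbT.
Qed.

Lemma fin_supp_cons (psi0 : seq nat -> A) (psi : seq nat -> A) :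
  fin_supp psi0 -> fin_supp psi ->
  fin_supp (fun al => match al with
    | 0%N :: be => psi0 be | j.+1 :: be => psi (j :: be) | [::] => 0 end).
Proof.
move=> [M psi0M] [N psiN]; exists (maxn M N.+1).
have w P (s : seq nat) : (P <= maxn M N.+1)%N ->
    has (leq (maxn M N.+1)) s -> has (leq P) s.
  by move=> PM; apply: sub_has => i /=; apply: leq_trans.
case=> [|[|j] al] //=; rewrite ?geq_max ?andbF /=.
  by move=> /(w _ _ (leq_maxl _ _))/psi0M.
move=> /orP[/andP[_ Nj]|/(w _ _ (leq_trans (leqnSn N) (leq_maxr _ _)))al_N].
  by rewrite psiN //= -ltnS Nj.
by rewrite psiN //= al_N orbT.
Qed.

End FinSupp.

Section CartanExact.
Variables (A B C : zmodType).
Variables (e : nat -> {additive A -> B}) (e' : nat -> {additive B -> C}).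

(** All homological degrees are treated at once, the differential being homogeneous. [N0] and [N1]
    select graded pieces when [A] and [B] are a whole module. *)
Definition cartan_exact (q : nat) (N0 : set A) (N1 : set B) : Prop :=
  forall phi, (forall al, size al = q -> N1 (phi al)) -> fin_supp phi ->
    (forall al, size al = q -> cartan_d e' q phi al = 0) ->
    exists psi, [/\ forall al, size al = q -> N0 (psi al), fin_supp psi &
      forall al, size al = q -> cartan_d e q psi al = phi al].

(** A chain concentrated at the zero exponent vector is always a cycle, because the differential
    reads off raised exponents only. Exactness there says that [N1] is generated by [N0]. *)
Lemma cartan_exact_gen q (N0 : set A) (N1 : set B) x :
  cartan_exact q N0 N1 -> N1 0 -> N1 x ->
  exists y : nat -> A,
    (forall i, (i < q)%N -> N0 (y i)) /\ x = \sum_(i < q) e i (y i).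
Proof.
move=> ex N10 N1x.
pose phi al := if al == nseq q 0%N then x else 0.
have [|||psi [psiN _ psiE]] := ex phi.
- by move=> al _; rewrite /phi; case: ifP.
- exists 1%N => al al1; rewrite /phi ifF //; apply/negP => /eqP alE.
  by move: al1; rewrite alE has_nseq andbF.
- have phi0 al : (exists2 i, i \in al & i != 0%N) -> phi al = 0.
    move=> [i ial i0]; rewrite /phi ifF //; apply/negP => /eqP alE.
    by move: ial; rewrite alE mem_nseq (negbTE i0) andbF.
  suff phi_shift p (pre : seq nat) al : size al = p ->
      cartan_d e' p (fun be => phi (pre ++ be)) al = 0.
    by move=> al sal; exact: (phi_shift q [::]).
  elim: p pre al => [|p IH] pre [|j al] //= [sal].
  rewrite phi0 ?raddf0 ?addr0; last first.
    by exists j.+1 => //; rewrite mem_cat inE eqxx orbT.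
  rewrite -[RHS](IH (rcons pre j) al sal); apply: eq_cartan_d => // be _.
  by rewrite cat_rcons.
have := psiE (nseq q 0%N) (size_nseq _ _); rewrite /phi eqxx => <-.
suff gen p (pre : seq nat) al : size al = p -> (size pre + p = q)%N ->
    exists y : nat -> A, (forall i, (i < p)%N -> N0 (y i)) /\
      cartan_d e p (fun be => psi (pre ++ be)) al = \sum_(i < p) e i (y i).
  exact: (gen q [::] (nseq q 0%N) (size_nseq _ _)).
elim: p pre al => [|p IH] pre [|j al] //=.
  by exists (fun=> 0); split => //; rewrite big_ord0.
move=> [sal] spre; have [|y [yN yE]] := IH (rcons pre j) al sal.
  by rewrite size_rcons addSnnS.
exists (fun i => if i == p then psi (pre ++ j.+1 :: al) else y i); split.
  move=> i; rewrite ltnS leq_eqVlt; case: eqP => //= [_ _|_ /yN//].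
  by apply: psiN; rewrite size_cat /= sal.
rewrite big_ord_recr /= eqxx; congr (_ + _).
transitivity (cartan_d e p (fun be => psi (rcons pre j ++ be)) al).
  by apply: eq_cartan_d => // be _; rewrite cat_rcons.
by rewrite yE; apply: eq_bigr => i _; rewrite ltn_eqF.
Qed.

(* Descending induction on the exponent of the new operator. *)
Lemma cartan_exactS q :
  (forall i j x, (i <= q)%N -> (j <= q)%N -> e' i (e j x) = - e' j (e i x)) ->
  (forall i x, (i <= q)%N -> e' i (e i x) = 0) ->
  cartan_exact q setT setT -> cartan_exact q.+1 setT setT.
Proof.
move=> ac sq ex phi _ [N phiN] phi_cyc.
suff {phi N phiN phi_cyc} main N phi : fin_supp phi ->
    (forall j al, (N <= j)%N -> phi (j :: al) = 0) ->
    (forall al, size al = q.+1 -> cartan_d e' q.+1 phi al = 0) ->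
    exists psi, fin_supp psi /\
      forall al, size al = q.+1 -> cartan_d e q.+1 psi al = phi al.
  have [||psi [fs psiE]] := main N phi _ _ phi_cyc; first by exists N.
    by move=> j al Nj; rewrite phiN //= Nj.
  by exists psi.
elim: N phi => [|N IH] phi fs phiN cyc.
  exists (fun=> 0); split; first by exists 0%N.
  by case=> [|j al] // sal; rewrite phiN // cartan_d0.
have [|||psi [fs_psi psiE]] :=
  IH (fun al => if al is j :: be then phi (j.+1 :: be) else 0).
- exact: fin_supp_shift.
- by move=> j al Nj; rewrite phiN.
- by move=> [|j al] //= [sal]; rewrite -[RHS](cyc (j.+1 :: al)) //= sal.
(* [psi] settles all exponents of e_q from 1 on. What is left at exponent 0 is a cycle for the first
   q operators, to which the exactness known for them applies. *)
have [|||w [_ fs_w wE]] :=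
  ex (fun al => phi (0%N :: al) - e q (psi (0%N :: al))).
- by [].
- apply: fin_suppB; first exact: fin_supp_tail.
  by apply: (@fin_supp_comp A B (e q) (fun al => psi (0%N :: al)));
     apply: fin_supp_tail.
- move=> al sal; rewrite cartan_dB.
  rewrite (@cartan_d_anticomp A B B C e e' (e q) (e' q) q
    (fun be => psi (0%N :: be))); last first.
    by move=> i x iq; rewrite ac // ltnW.
  have := psiE (0%N :: al); rewrite /= sal => /(_ erefl).
  move=> /(congr1 (e' q)); rewrite raddfD /= sq // addr0 => ->.
  by rewrite opprK -[RHS](cyc (0%N :: al)) //= sal.
exists (fun al => match al with
  | 0%N :: be => w be | j.+1 :: be => psi (j :: be) | [::] => 0 end); split.
  exact: fin_supp_cons.
case=> [|[|j] al] //= [sal]; first by rewrite wE // subrK.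
by have := psiE (j :: al); rewrite /= sal => /(_ erefl).
Qed.

(* [io] and [io'] are homotopies (a contraction) for the last operator e_q. *)
Lemma cartan_exact_contract q (io : {additive B -> A}) (io' : {additive C -> B})
    (N0 N0' : set A) (N1 N1' : set B) :
  (forall i j x, (i <= q)%N -> (j <= q)%N -> e' i (e j x) = - e' j (e i x)) ->
  (forall i x, (i <= q)%N -> e' i (e i x) = 0) ->
  (forall i x, (i < q)%N -> N1' x -> e i (io x) = - io' (e' i x)) ->
  (forall x, N1' x -> io' (e' q x) + e q (io x) = x) ->
  (forall x, N1' x -> N1 (io' (e' q x))) ->
  (forall x, N1' x -> N0' (io x)) ->
  (forall x, N0 x -> N0' x) ->
  cartan_exact q N0 N1 -> cartan_exact q.+1 N0' N1'.
Proof.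
move=> ac sq eio contr N1io N0io N00 ex phi phiN fs cyc.
have phiN' j al : size al = q -> N1' (phi (j :: al)).
  by move=> sal; apply: phiN; rewrite /= sal.
have dio j al : size al = q ->
    cartan_d e q (fun be => io (phi (j :: be))) al
    = - io' (cartan_d e' q (fun be => phi (j :: be)) al).
  (* [cartan_d_anticomp] with the commutation known on the values only *)
  move=> sal.
  suff H p pre be : (p <= q)%N -> size be = p -> (size pre + p = q)%N ->
      cartan_d e p (fun be => io (phi (j :: pre ++ be))) be
      = - io' (cartan_d e' p (fun be => phi (j :: pre ++ be)) be).
    exact: (H q [::] al).
  elim: p pre be => [|p IH] pre [|i be] //=; rewrite ?raddf0 ?oppr0 //.
  move=> pq [sbe] spre; rewrite raddfD opprD; congr (_ + _).
    have := IH (rcons pre i) be (ltnW pq) sbe.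
    rewrite size_rcons addSnnS => /(_ spre) h.
    transitivity (cartan_d e p
      (fun be => io (phi (j :: rcons pre i ++ be))) be).
      by apply: eq_cartan_d => // ga _; rewrite cat_rcons.
    rewrite h; congr (- io' _).
    by apply: eq_cartan_d => // ga _; rewrite cat_rcons.
  by rewrite eio //; apply: phiN'; rewrite size_cat /= sbe.
have cyc' j al : size al = q ->
    cartan_d e' q (fun be => phi (j :: be)) al = - e' q (phi (j.+1 :: al)).
  move=> sal; apply/eqP; rewrite -addr_eq0; apply/eqP.
  by have := cyc (j :: al); rewrite /= sal => ->.
have yE al : size al = q ->
    io' (e' q (phi (0%N :: al))) = phi (0%N :: al) - e q (io (phi (0%N :: al))).
  by move=> sal; rewrite -{2}(contr _ (phiN' 0%N al sal)) addrK.
have [|||w [wN fs_w wE]] := ex (fun al => io' (e' q (phi (0%N :: al)))).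
- by move=> al sal; apply/N1io/phiN'.
- apply: (@fin_supp_comp C B io' (fun al => e' q (phi (0%N :: al)))).
  apply: (@fin_supp_comp B C (e' q) (fun al => phi (0%N :: al))).
  exact: fin_supp_tail.
- move=> al sal.
  rewrite (eq_cartan_d _ sal yE) cartan_dB.
  rewrite (@cartan_d_anticomp A B B C e e' (e q) (e' q) q
    (fun be => io (phi (0%N :: be)))); last first.
    by move=> i x iq; rewrite ac // ltnW.
  rewrite opprK dio // cyc' // !raddfN /= opprK.
  have := contr _ (phiN' 1%N al sal).
  move=> /(congr1 (e' q)); rewrite raddfD /= sq // addr0 => ->.
  by rewrite addNr.
(* Raising the exponent and contracting inverts e_q up to the term [io' (e' q _)]. The cycle
   condition cancels that term at positive exponents; at exponent 0 it is the boundary of [w]. *)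
exists (fun al => match al with
  | 0%N :: be => w be | j.+1 :: be => io (phi (j :: be)) | [::] => 0 end); split.
- by case=> [|[|j] al] //= [sal]; [apply/N00/wN | apply/N0io/phiN'].
- apply: (@fin_supp_cons A w (fun al => io (phi al))) => //.
  exact: (@fin_supp_comp B A io).
case=> [|[|j] al] //= [sal].
  by rewrite wE // contr //; apply: phiN'.
rewrite dio // cyc' // raddfN /= opprK contr //; exact: phiN'.
Qed.

End CartanExact.

Lemma fin_supp_d (A B : zmodType) (e : nat -> {additive A -> B}) q
    (phi : seq nat -> A) :
  fin_supp phi -> fin_supp (cartan_d e q phi).
Proof.
have d0 p psi al : (forall be, psi be = 0) -> cartan_d e p psi al = 0.
  elim: p psi al => [|p IH] psi [|j al] //= psi0.
  by rewrite psi0 raddf0 addr0 IH.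
move=> [N phiN]; exists N => al.
elim: q phi phiN al => [|q IH] phi phiN [|j al] //= /orP[Nj|alN].
  rewrite phiN /= ?(leq_trans Nj) // raddf0 addr0 d0 // => be.
  by rewrite phiN //= Nj.
rewrite phiN /= ?alN ?orbT // raddf0 addr0 IH // => be beN.
by rewrite phiN //= beN orbT.
Qed.

Section CartanExtension.
Variables (S0 S1 S2 A0 A1 A2 Q0 Q1 Q2 : zmodType) (q : nat).
Variables (eS : nat -> {additive S0 -> S1}) (eS' : nat -> {additive S1 -> S2}).
Variables (eA : nat -> {additive A0 -> A1}) (eA' : nat -> {additive A1 -> A2}).
Variables (eQ : nat -> {additive Q0 -> Q1}) (eQ' : nat -> {additive Q1 -> Q2}).
Variables (i0 : {additive S0 -> A0}) (i1 : {additive S1 -> A1}).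
Variables (i2 : {additive S2 -> A2}) (r1 : {additive A1 -> S1}).
Variables (p0 : {additive A0 -> Q0}) (p1 : {additive A1 -> Q1}).
Variables (p2 : {additive A2 -> Q2}) (s0 : {additive Q0 -> A0}).

(** The diagram chase for an extension of Q by S. The splittings [s0] and [r1] need not commute with
    the operators; being additive, they preserve finite support. *)
Lemma cartan_exact_extension :
  (forall i j x, (i < q)%N -> (j < q)%N -> eA' i (eA j x) = - eA' j (eA i x)) ->
  (forall i x, (i < q)%N -> eA' i (eA i x) = 0) ->
  (forall i x, (i < q)%N -> eA i (i0 x) = i1 (eS i x)) ->
  (forall i x, (i < q)%N -> eA' i (i1 x) = i2 (eS' i x)) ->
  (forall i x, (i < q)%N -> eQ i (p0 x) = p1 (eA i x)) ->
  (forall i x, (i < q)%N -> eQ' i (p1 x) = p2 (eA' i x)) ->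
  (forall x, p1 x = 0 -> i1 (r1 x) = x) -> injective i2 -> cancel s0 p0 ->
  cartan_exact eS eS' q setT setT -> cartan_exact eQ eQ' q setT setT ->
  cartan_exact eA eA' q setT setT.
Proof.
move=> ac sq ei ei' ep ep' ir i2inj sK exS exQ phi _ fs cyc.
have [||psiQ [_ fsQ psiQE]] := exQ (fun al => p1 (phi al)) (fun _ _ => I).
- exact: (@fin_supp_comp A1 Q1 p1).
- move=> al sal; rewrite (@cartan_d_comp A1 A2 Q1 Q2 eA' eQ' p1 p2) //.
  by rewrite cyc // raddf0.
pose psi al := s0 (psiQ al).
have fs_psi : fin_supp psi by exact: (@fin_supp_comp Q0 A0 s0).
pose rest al := phi al - cartan_d eA q psi al.
have restE al : size al = q -> i1 (r1 (rest al)) = rest al.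
  move=> sal; apply: ir; rewrite raddfB /=.
  rewrite -(@cartan_d_comp A0 A1 Q0 Q1 eA eQ p0 p1) //.
  rewrite (@eq_cartan_d _ _ eQ q (fun be => p0 (psi be)) psiQ) //.
    by rewrite psiQE // subrr.
  by move=> be _; rewrite /psi sK.
have [||chi [_ fs_chi chiE]] := exS (fun al => r1 (rest al)) (fun _ _ => I).
- apply: (@fin_supp_comp A1 S1 r1); apply: fin_suppB => //.
  exact: fin_supp_d.
- move=> al sal; apply: i2inj.
  rewrite -(@cartan_d_comp S1 S2 A1 A2 eS' eA' i1 i2) // raddf0.
  rewrite (eq_cartan_d _ sal restE) cartan_dB cyc // (@cartan_dd _ _ _ eA eA' q) //.
  by rewrite subrr.
exists (fun al => psi al - (- i0 (chi al))); split => //.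
  apply: fin_suppB => //.
  exact: (@fin_supp_comp S0 A0 (-%R \o i0)).
move=> al sal; rewrite cartan_dB.
rewrite (@cartan_d_comp S0 S1 A0 A1 eS eA (fun x => - i0 x) (-%R \o i1)).
  by rewrite /= opprK chiE // restE // addrC subrK.
by move=> i x iq; rewrite raddfN ei.
Qed.

End CartanExtension.

Section CartanSyzygy.
Variables (W V : zmodType) (q : nat).
Variables (eW : nat -> {additive W -> W}) (eV : nat -> {additive V -> V}).
Variable (p : {additive W -> V}).
Variables (F0 F1 F2 : set W) (N0 N1 : set V).

(** This is the connecting homomorphism: a cycle in the kernel of [p] bounds some [psi] in the free
    module, [p psi] bounds one degree lower, and a lift of that primitive corrects [psi] into the
    kernel. The shift by one degree turns rho into rho + 1. *)
Lemma cartan_exact_syzygy :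
  (forall i j x, (i < q)%N -> (j < q)%N -> eW i (eW j x) = - eW j (eW i x)) ->
  (forall i x, (i < q)%N -> eW i (eW i x) = 0) ->
  (forall i x, (i < q)%N -> eV i (p x) = p (eW i x)) ->
  F0 0 -> (forall x, F1 x -> N1 (p x)) -> (forall z, N0 z -> exists2 x, F0 x & p x = z) ->
  (forall psi al, (forall be, size be = q -> F0 (psi be)) -> size al = q ->
     F1 (cartan_d eW q psi al)) ->
  (forall x y, F1 x -> F1 y -> F1 (x - y)) ->
  cartan_exact eW eW q F1 F2 -> cartan_exact eV eV q N0 N1 ->
  cartan_exact eW eW q [set x | F1 x /\ p x = 0]%classic
    [set x | F2 x /\ p x = 0]%classic.
Proof.
move=> ac sq ep F00 FN surj dF FB exF exN phi phiK fs cyc.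
have [|//|//|psi [psiF fs_psi psiE]] := exF phi.
  by move=> al /phiK[].
have [|||chi [chiN [M chiM] chiE]] := exN (fun al => p (psi al)).
- by move=> al sal; apply/FN/psiF.
- exact: (@fin_supp_comp W V p).
- move=> al sal; rewrite (@cartan_d_comp W W V V eW eV p p) // psiE //.
  by case: (phiK al sal).
(* The lift is chosen to vanish wherever [chi] does; otherwise its support could be infinite. *)
have /choice [lif lifP] (al : seq nat) :
    exists x, (size al = q -> F0 x /\ p x = chi al) /\ (chi al = 0 -> x = 0).
  have [chi0|chi0] := pselect (chi al = 0).
    by exists 0; rewrite raddf0 chi0.
  have [sal|nsal] := pselect (size al = q); last by exists 0.
  by have [x xF xE] := surj _ (chiN al sal); exists x; split.
exists (fun al => psi al - cartan_d eW q lif al); split.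
- move=> al sal; split.
    by apply: FB; [apply: psiF | apply: dF => // be sbe; case: (lifP be).1].
  rewrite raddfB /= -(@cartan_d_comp W W V V eW eV p p) //.
  rewrite (@eq_cartan_d _ _ eV q _ chi) ?chiE ?subrr // => be sbe.
  by case: (lifP be).1.
- apply: fin_suppB => //; apply: fin_supp_d; exists M => al /chiM.
  by case: (lifP al).
move=> al sal; rewrite cartan_dB psiE // (@cartan_dd _ _ _ eW eW q) ?subr0 //.
Qed.

End CartanSyzygy.

(** Cycles with values in [N1] are pulled back along the embeddings, bounded there and pushed
    forward. Since [r1] fixes 0, the pulled back chain has finite support. *)
Lemma cartan_exact_embed (X0 X1 X2 A0 A1 A2 : zmodType) q
    (eX : nat -> {additive X0 -> X1}) (eX' : nat -> {additive X1 -> X2})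
    (eA : nat -> {additive A0 -> A1}) (eA' : nat -> {additive A1 -> A2})
    (i0 : {additive X0 -> A0}) (i1 : {additive X1 -> A1})
    (i2 : {additive X2 -> A2}) (r1 : A1 -> X1) (N0 : set A0) (N1 : set A1) :
  r1 0 = 0 ->
  (forall i x, (i < q)%N -> eA i (i0 x) = i1 (eX i x)) ->
  (forall i x, (i < q)%N -> eA' i (i1 x) = i2 (eX' i x)) ->
  (forall x, N1 x -> i1 (r1 x) = x) -> (forall x, i2 x = 0 -> x = 0) ->
  (forall x, N0 (i0 x)) ->
  cartan_exact eX eX' q setT setT -> cartan_exact eA eA' q N0 N1.
Proof.
move=> r10 ei ei' ir i2inj N0i ex phi phiN fs cyc.
have [||psi [_ fs_psi psiE]] := ex (fun al => r1 (phi al)) (fun _ _ => I).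
- by case: fs => N phi0; exists N => al /phi0 ->.
- move=> al sal; apply: i2inj.
  rewrite -(@cartan_d_comp X1 X2 A1 A2 eX' eA' i1 i2) //.
  by rewrite -(cyc al sal); apply: eq_cartan_d => // be sbe; apply/ir/phiN.
exists (fun al => i0 (psi al)); split => //.
  exact: (@fin_supp_comp X0 A0 i0).
move=> al sal; rewrite (@cartan_d_comp X0 X1 A0 A1 eX eA i0 i1) // psiE //.
exact/ir/phiN.
Qed.

(** * The exterior algebra *)

Section ExteriorOperators.
Variables (k : fieldType) (c : nat).
Implicit Types (A : {set 'I_c}) (x y : ext k c) (i j : 'I_c).

Lemma ext_eqP x y : (forall A, ext_coef x A = ext_coef y A) -> x = y.
Proof. by move=> xy; apply/ffunP => A; apply: xy. Qed.

Lemma ext_coefD x y A : ext_coef (x + y) A = ext_coef x A + ext_coef y A.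
Proof. by rewrite /ext_coef ffunE. Qed.

Lemma ext_coefN x A : ext_coef (- x) A = - ext_coef x A.
Proof. by rewrite /ext_coef ffunE. Qed.

Lemma ext_coef0 A : ext_coef (0 : ext k c) A = 0.
Proof. by rewrite /ext_coef ffunE. Qed.

(** The sign in e_i e_A, for i outside A: one factor -1 for each generator of A that e_i has to
    pass. *)
Definition gen_sign i A : k := (-1) ^+ (\sum_(j in A) (j < i)%N).

Lemma gen_signU i j A :
  j \notin A -> gen_sign i (j |: A) = (-1) ^+ (j < i)%N * gen_sign i A.
Proof. by move=> jA; rewrite /gen_sign big_setU1 //= exprD. Qed.

Lemma gen_signD i j A :
  j \in A -> gen_sign i A = (-1) ^+ (j < i)%N * gen_sign i (A :\ j).
Proof.
by move=> jA; rewrite -{1}(finset.setD1K jA) gen_signU // !inE eqxx.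
Qed.

Lemma gen_sign_sqr i A : gen_sign i A * gen_sign i A = 1.
Proof. by rewrite /gen_sign -exprMn mulrNN mulr1 expr1n. Qed.

Lemma sign_ltn i j : i != j -> (-1) ^+ (j < i)%N = - (-1) ^+ (i < j)%N :> k.
Proof.
move=> ij; case: ltngtP => //= h; rewrite ?expr1 ?expr0 ?opprK //.
by move/val_inj: h ij => ->; rewrite eqxx.
Qed.

Lemma ext_coef_genM i x A :
  ext_coef (ext_gen k i * x) A =
  if i \in A then gen_sign i (A :\ i) * ext_coef x (A :\ i) else 0.
Proof.
rewrite ext_coefM (bigD1 [set i]) //= [X in _ + X]big1 ?addr0; last first.
  move=> B nB; apply: big1 => C _.
  by rewrite {1}/ext_coef ffunE (negbTE nB) mulr0 mul0r.
have coef_i : ext_coef (ext_gen k i) [set i] = 1.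
  by rewrite /ext_coef ffunE eqxx.
case: ifP => iA; last first.
  by apply: big1 => B /eqP AE; rewrite -AE !inE eqxx in iA.
rewrite (bigD1 (A :\ i)) /=; last by rewrite finset.setD1K.
rewrite big1 ?addr0.
  rewrite coef_i // mulr1 /ext_sign ifT; last first.
    by rewrite finset.disjoints1 !inE eqxx.
  by rewrite /ext_inv big_set1.
move=> B /andP[/eqP AE BA]; rewrite /ext_sign finset.disjoints1.
case: ifP => [iB|]; last by rewrite !mul0r.
by case/eqP: BA; rewrite -AE finset.setU1K.
Qed.

(** Contraction against the dual of e_i: for i outside A it sends e_i e_A to e_A, and it kills
    e_A. *)
Definition ext_contract i x : ext k c :=
  [ffun A : {set 'I_c} => if i \in A then 0 else gen_sign i A * ext_coef x (i |: A)].

Lemma ext_coef_contract i x A :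
  ext_coef (ext_contract i x) A =
  if i \in A then 0 else gen_sign i A * ext_coef x (i |: A).
Proof. by rewrite {1}/ext_coef ffunE. Qed.

Lemma ext_contract_is_zmod_morphism i : zmod_morphism (ext_contract i).
Proof.
move=> x y; apply: ext_eqP => A.
rewrite ext_coefD ext_coefN !ext_coef_contract ext_coefD ext_coefN.
by case: ifP => _; rewrite ?subr0 // mulrBr.
Qed.

HB.instance Definition _ i := GRing.isZmodMorphism.Build (ext k c) (ext k c)
  (ext_contract i) (ext_contract_is_zmod_morphism i).

Lemma ext_genM_sqr i x : ext_gen k i * (ext_gen k i * x) = 0.
Proof.
apply: ext_eqP => A; rewrite !ext_coef_genM ext_coef0 !inE eqxx /= mulr0.
by case: ifP.
Qed.

Lemma ext_genM_anti i j x :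
  ext_gen k i * (ext_gen k j * x) = - (ext_gen k j * (ext_gen k i * x)).
Proof.
have [<-|ij] := eqVneq i j; first by rewrite ext_genM_sqr oppr0.
apply: ext_eqP => A; rewrite ext_coefN !ext_coef_genM !inE ij eq_sym ij /=.
have [iA|] := boolP (i \in A); have [jA|] := boolP (j \in A);
  rewrite ?mulr0 ?oppr0 //.
rewrite (@gen_signD i j (A :\ i)) ?inE 1?eq_sym ?ij //.
rewrite (@gen_signD j i (A :\ j)) ?inE ?ij //.
rewrite !finset.setDDl [[set j] :|: _]finset.setUC sign_ltn // !mulNr -!mulrA.
congr (- _); rewrite [RHS]mulrCA [in RHS]mulrCA; congr (_ * _).
exact: mulrCA.
Qed.

Lemma ext_contract_sqr i x : ext_contract i (ext_contract i x) = 0.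
Proof.
apply: ext_eqP => A; rewrite !ext_coef_contract ext_coef0 !inE eqxx /= mulr0.
by case: ifP.
Qed.

Lemma ext_contract_anti i j x :
  ext_contract i (ext_contract j x) = - ext_contract j (ext_contract i x).
Proof.
have [<-|ij] := eqVneq i j; first by rewrite ext_contract_sqr oppr0.
apply: ext_eqP => A; rewrite ext_coefN !ext_coef_contract !inE.
rewrite (negbTE ij) [j == i]eq_sym (negbTE ij) /=.
have [iA|iA] := boolP (i \in A); have [jA|jA] := boolP (j \in A);
  rewrite ?mulr0 ?oppr0 //.
rewrite !gen_signU // (sign_ltn ij) finset.setUCA !mulrA ?mulNr ?mulrN.
rewrite !mulNr opprK; congr (_ * _).
by rewrite -mulrA mulrC [_ * gen_sign j A]mulrC.
Qed.

Lemma ext_contract_gen i x :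
  ext_contract i (ext_gen k i * x) + ext_gen k i * ext_contract i x = x.
Proof.
apply: ext_eqP => A.
rewrite ext_coefD ext_coef_contract !ext_coef_genM ext_coef_contract !inE eqxx /=.
have [iA|iA] := boolP (i \in A).
  by rewrite add0r finset.setD1K // mulrA gen_sign_sqr mul1r.
by rewrite addr0 finset.setU1K // mulrA gen_sign_sqr mul1r.
Qed.

Lemma ext_contract_gen_anti i j x : i != j ->
  ext_contract i (ext_gen k j * x) = - (ext_gen k j * ext_contract i x).
Proof.
move=> ij; apply: ext_eqP => A.
rewrite ext_coefN ext_coef_contract !ext_coef_genM ext_coef_contract !inE.
rewrite [j == i]eq_sym (negbTE ij) /=.
have [iA|iA] := boolP (i \in A); have [jA|jA] := boolP (j \in A);
  rewrite ?mulr0 ?oppr0 //.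
have -> : (i |: A) :\ j = i |: (A :\ j).
  by apply/finset.setP => l; rewrite !inE; have [->|] := eqVneq l i; rewrite ?ij.
rewrite (gen_signD i jA) gen_signU ?inE ?negb_and ?iA ?orbT // (sign_ltn ij).
rewrite !mulNr; congr (- _); rewrite -!mulrA mulrCA [RHS]mulrCA.
congr (_ * _).
by rewrite !mulrA -exprD addnn -signr_odd odd_double expr0 mul1r.
Qed.

End ExteriorOperators.

Section ExteriorCartan.
Variables (k : fieldType) (c : nat).
Notation E := (ext k c).

(* Total in the index, as [cartan_exact] takes families of operators indexed
   by nat: junk value 0 for [i >= c]. *)
Definition egen (i : nat) : E := if insub i is Some j then ext_gen k j else 0.

Lemma egenE (i : 'I_c) : egen i = ext_gen k i.
Proof. by rewrite /egen valK. Qed.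

Lemma egen_anti (V : lmodType E) i j (x : V) :
  egen i *: (egen j *: x) = - (egen j *: (egen i *: x)).
Proof.
rewrite !scalerA -scaleNr; congr (_ *: _).
rewrite /egen; case: insubP => [i' _ _|_]; case: insubP => [j' _ _|_];
  rewrite ?mulr0 ?mul0r ?oppr0 //.
by have := ext_genM_anti i' j' (1 : E); rewrite !mulr1.
Qed.

Lemma egen_sqr (V : lmodType E) i (x : V) : egen i *: (egen i *: x) = 0.
Proof.
rewrite scalerA /egen; case: insubP => [i' _ _|_]; last by rewrite mul0r scale0r.
by have := ext_genM_sqr i' (1 : E); rewrite !mulr1 => ->; rewrite scale0r.
Qed.

Definition egen_op (V : lmodType E) (i : nat) : {additive V -> V} :=
  GRing.scale (egen i).

Definition econtract (i : nat) : {additive E -> E} :=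
  if insub i is Some j then ext_contract j else \0.

Definition ext_deg (n : nat) : set E :=
  fun x => forall A, ext_coef x A != 0 -> #|A| = n.

(* The elements of degree n not involving e_q, e_(q+1), .. *)
Definition ext_below (q n : nat) : set E :=
  fun x => ext_deg n x /\ forall i, (q <= i)%N -> econtract i x = 0.

Lemma ext_deg_gen i n x : ext_deg n x -> ext_deg n.+1 (egen i * x).
Proof.
move=> xn A; rewrite /egen; case: insubP => [j _ _|_]; last first.
  by rewrite mul0r ext_coef0 eqxx.
rewrite ext_coef_genM; case: ifP => jA; last by rewrite eqxx.
rewrite mulf_eq0 negb_or => /andP[_ /xn <-].
by rewrite [LHS](finset.cardsD1 j) jA.
Qed.

Lemma ext_deg_contract i n x : ext_deg n.+1 x -> ext_deg n (econtract i x).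
Proof.
move=> xn A; rewrite /econtract; case: insubP => [j _ _|_] /=; last first.
  by rewrite ext_coef0 eqxx.
rewrite ext_coef_contract; case: ifP => jA; first by rewrite eqxx.
rewrite mulf_eq0 negb_or => /andP[_ /xn].
by rewrite finset.cardsU1 jA => -[].
Qed.

Lemma econtract_anti i j x : econtract i (econtract j x) = - econtract j (econtract i x).
Proof.
rewrite /econtract; case: insubP => [i' _ _|_]; case: insubP => [j' _ _|_] /=;
  rewrite ?raddf0 ?oppr0 //.
exact: ext_contract_anti.
Qed.

Lemma econtract_egen_anti i j x : i != j ->
  econtract i (egen j * x) = - (egen j * econtract i x).
Proof.
move=> ij; rewrite /econtract /egen.
case: insubP => [i' _ iE|_]; case: insubP => [j' _ jE|_] /=;
  rewrite ?mulr0 ?mul0r ?raddf0 ?oppr0 //.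
by apply: ext_contract_gen_anti; apply: contraNneq ij => ij; rewrite -iE -jE ij.
Qed.

Lemma econtract_egen i x : (i < c)%N ->
  econtract i (egen i * x) + egen i * econtract i x = x.
Proof.
by move=> ic; rewrite /econtract /egen insubT /=; apply: ext_contract_gen.
Qed.

(** Induction on the number of generators inside the subalgebra on e_0, .., e_(q-1). Contraction
    against e_q is a homotopy for multiplication by e_q, and its remainder no longer involves
    e_q. *)
Lemma ext_cartan_exact n :
  cartan_exact (@egen_op E^o) (@egen_op E^o) c (ext_deg n) (ext_deg n.+1).
Proof.
suff H q : (q <= c)%N -> cartan_exact (@egen_op E^o) (@egen_op E^o) q
    (ext_below q n) (ext_below q n.+1).
  move=> phi phiN fs cyc.
  have below m x : ext_deg m x -> ext_below c m x.
    by split => // i ci; rewrite /econtract insubF // ltnNge ci.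
  have [al sal|psi [psiN fs' psiE]] := H c (leqnn c) phi _ fs cyc.
    exact/below/phiN.
  by exists psi; split => // al /psiN[].
elim: q => [|q IH] qc.
  (* With no generators left, an element killed by all contractions is a scalar, hence zero in
     positive degree. *)
  move=> phi phiN fs _; exists (fun=> 0); split; first 1 last.
  - by exists 0%N.
  - move=> al sal /=; apply/esym/ext_eqP => A; rewrite ext_coef0; apply/eqP.
    have [phi_deg phi_con] := phiN al sal.
    apply: contraT => phiA.
    have [i iA] : exists i, i \in A.
      by apply/finset.set0Pn; rewrite -finset.card_gt0 (phi_deg A).
    have := phi_con i isT; rewrite /econtract valK /=.
    move=> /(congr1 (fun x => ext_coef x (A :\ i))).
    rewrite ext_coef_contract ext_coef0 !inE eqxx /= finset.setD1K // => /eqP.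
    by rewrite mulf_eq0 (negbTE phiA) orbF /gen_sign signr_eq0.
  move=> al _; split => [A|i _]; last exact: raddf0.
  by rewrite ext_coef0 eqxx.
apply: (cartan_exact_contract (io := econtract q) (io' := econtract q)
  (N0 := ext_below q n) (N1 := ext_below q n.+1)).
- by move=> i j x _ _; exact: (@egen_anti E^o).
- by move=> i x _; exact: (@egen_sqr E^o).
- move=> i x iq _ /=; rewrite econtract_egen_anti ?opprK //.
  by rewrite gtn_eqF.
- by move=> x _; apply: econtract_egen.
- move=> x [xn x_con]; split.
    exact/ext_deg_contract/ext_deg_gen.
  move=> i; rewrite leq_eqVlt => /predU1P[<-|qi].
    rewrite /econtract; case: insubP => [i' _ _|_] //=; exact: ext_contract_sqr.
  rewrite econtract_anti econtract_egen_anti ?gtn_eqF // x_con // .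
  by rewrite mulr0 oppr0 raddf0 oppr0.
- move=> x [xn x_con]; split; first exact: ext_deg_contract.
  by move=> i qi; rewrite econtract_anti x_con // raddf0 oppr0.
- by move=> x [xn x_con]; split => // i /ltnW/x_con.
exact: IH (ltnW qc).
Qed.

End ExteriorCartan.

(** * Graded modules over the exterior algebra *)

Section HomogeneousMatrices.
Variables (k : fieldType) (c : nat).
Notation E := (ext k c).
Implicit Types (x y : E) (d : int).

Definition ext_comp d x : E :=
  [ffun A : {set 'I_c} => if #|A|%:Z == d then ext_coef x A else 0].

Lemma ext_coef_comp d x A :
  ext_coef (ext_comp d x) A = if #|A|%:Z == d then ext_coef x A else 0.
Proof. by rewrite {1}/ext_coef ffunE. Qed.

Lemma ext_coef_sum I (s : seq I) (F : I -> E) A :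
  ext_coef (\sum_(i <- s) F i) A = \sum_(i <- s) ext_coef (F i) A.
Proof.
elim: s => [|i s IH]; first by rewrite !big_nil ext_coef0.
by rewrite !big_cons ext_coefD IH.
Qed.

Lemma ext_homog_comp d x : ext_homog d (ext_comp d x).
Proof. by move=> A; rewrite ext_coef_comp; case: (eqVneq _ d) => //; rewrite eqxx. Qed.

Lemma ext_comp_sum I (s : seq I) (F : I -> E) d :
  ext_comp d (\sum_(i <- s) F i) = \sum_(i <- s) ext_comp d (F i).
Proof.
apply: ext_eqP => A; rewrite ext_coef_comp !ext_coef_sum.
under [RHS]eq_bigr do rewrite ext_coef_comp.
by case: ifP => // _; rewrite big1.
Qed.

Lemma ext_sign_card (A B : {set 'I_c}) :
  ext_sign k A B != 0 -> #|A :|: B| = (#|A| + #|B|)%N.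
Proof.
rewrite /ext_sign; case: ifP => [dAB _|]; last by rewrite eqxx.
by apply/eqP; rewrite finset.cardsU -finset.setI_eq0 in dAB *;
   rewrite (eqP dAB) finset.cards0 subn0.
Qed.

Lemma ext_comp_mulr d d' x y : ext_homog d y ->
  ext_comp (d' + d) (x * y) = ext_comp d' x * y.
Proof.
move=> yd; apply: ext_eqP => C; rewrite ext_coef_comp !ext_coefM.
rewrite -[LHS]/(if _ then _ else 0) [LHS](_ : _ = \sum_A \sum_(B | A :|: B == C)
  (if #|C|%:Z == d' + d then ext_sign k A B * ext_coef x A * ext_coef y B else 0));
  last by case: ifP => // _; rewrite big1 // => A _; rewrite big1.
apply: eq_bigr => A _; apply: eq_bigr => B /eqP <-; rewrite ext_coef_comp.
have [->|sAB] := eqVneq (ext_sign k A B) 0; first by rewrite !mul0r if_same.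
have [->|yB] := eqVneq (ext_coef y B) 0; first by rewrite !mulr0 if_same.
rewrite ext_sign_card // PoszD (yd _ yB) (inj_eq (addIr d)).
by case: ifP => // _; rewrite mulr0 mul0r.
Qed.

Lemma ext_comp_mull d d' x y : ext_homog d x ->
  ext_comp (d + d') (x * y) = x * ext_comp d' y.
Proof.
move=> xd; apply: ext_eqP => C; rewrite ext_coef_comp !ext_coefM.
rewrite -[LHS]/(if _ then _ else 0) [LHS](_ : _ = \sum_A \sum_(B | A :|: B == C)
  (if #|C|%:Z == d + d' then ext_sign k A B * ext_coef x A * ext_coef y B else 0));
  last by case: ifP => // _; rewrite big1 // => A _; rewrite big1.
apply: eq_bigr => A _; apply: eq_bigr => B /eqP <-; rewrite ext_coef_comp.
have [->|sAB] := eqVneq (ext_sign k A B) 0; first by rewrite !mul0r if_same.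
have [->|xA] := eqVneq (ext_coef x A) 0; first by rewrite mulr0 !mul0r if_same.
rewrite ext_sign_card // PoszD (xd _ xA) (inj_eq (addrI d)).
by case: ifP => // _; rewrite mulr0.
Qed.

Lemma ext_comp_id d x : ext_homog d x -> ext_comp d x = x.
Proof.
move=> xd; apply: ext_eqP => A; rewrite ext_coef_comp.
by case: eqP => // dA; have [->|/xd] := eqVneq (ext_coef x A) 0.
Qed.

Lemma ext_homogM d d' x y : ext_homog d x -> ext_homog d' y -> ext_homog (d + d') (x * y).
Proof.
move=> xd yd; have <- : ext_comp (d + d') (x * y) = x * y.
  by rewrite (ext_comp_mulr _ _ yd) ext_comp_id.
exact: ext_homog_comp.
Qed.

Lemma ext_homogD d x y : ext_homog d x -> ext_homog d y -> ext_homog d (x + y).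
Proof.
move=> xd yd A; rewrite ext_coefD.
by have [->|/xd//] := eqVneq (ext_coef x A) 0; rewrite add0r => /yd.
Qed.

Lemma ext_homogZ d (a : k) x : ext_homog d x -> ext_homog d (a%:A * x).
Proof.
move=> xd A; rewrite mulr_algl ext_coefZ mulf_eq0 negb_or => /andP[_].
exact: xd.
Qed.

Lemma ext_homog0 d : ext_homog d (0 : E).
Proof. by move=> A; rewrite ext_coef0 eqxx. Qed.

Lemma ext_homog_egen i : ext_homog 1 (egen k c i).
Proof.
move=> A; rewrite /egen; case: insubP => [j _ _|_]; last by rewrite ext_coef0 eqxx.
rewrite /ext_coef ffunE; case: (eqVneq A [set j]%SET) => [->|_].
  by rewrite finset.cards1.
by rewrite eqxx.
Qed.

Definition mhom p r (dp : 'I_p -> int) (dr : 'I_r -> int) (A : 'M[E]_(p, r)) : Prop :=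
  forall s t, ext_homog (dp s - dr t) (A s t).

(** The degree-preserving part of a matrix. Ungraded lifts and comparison maps are made graded by
    passing to it, since it commutes with products by homogeneous matrices. *)
Definition mcomp p r (dp : 'I_p -> int) (dr : 'I_r -> int) (A : 'M[E]_(p, r)) :
  'M[E]_(p, r) := \matrix_(s, t) ext_comp (dp s - dr t) (A s t).

Lemma mhom_comp p r (dp : 'I_p -> int) (dr : 'I_r -> int) (A : 'M[E]_(p, r)) :
  mhom dp dr (mcomp dp dr A).
Proof. by move=> s t; rewrite mxE; apply: ext_homog_comp. Qed.

Lemma mcomp_mulr p r q (dp : 'I_p -> int) (dr : 'I_r -> int) (dq : 'I_q -> int)
    (A : 'M[E]_(p, r)) (B : 'M[E]_(r, q)) :
  mhom dr dq B -> mcomp dp dq (A *m B) = mcomp dp dr A *m B.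
Proof.
move=> Bh; apply/matrixP => s t; rewrite !mxE ext_comp_sum.
apply: eq_bigr => j _; rewrite mxE -(ext_comp_mulr _ _ (Bh j t)).
by rewrite addrA subrK.
Qed.

Lemma mcomp_mull p r q (dp : 'I_p -> int) (dr : 'I_r -> int) (dq : 'I_q -> int)
    (A : 'M[E]_(p, r)) (B : 'M[E]_(r, q)) :
  mhom dp dr A -> mcomp dp dq (A *m B) = A *m mcomp dr dq B.
Proof.
move=> Ah; apply/matrixP => s t; rewrite !mxE ext_comp_sum.
apply: eq_bigr => j _; rewrite mxE -(ext_comp_mull _ _ (Ah s j)).
by rewrite addrA subrK.
Qed.

Definition rhom r (dr : 'I_r -> int) (d : int) : set 'rV[E]_r :=
  mhom (fun _ : 'I_1 => d) dr.

Definition rcomp r (dr : 'I_r -> int) (d : int) : 'rV[E]_r -> 'rV[E]_r :=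
  mcomp (fun _ : 'I_1 => d) dr.

(** The index set may be enlarged because [eps_rcomp] needs a prescribed degree to occur in it. *)
Lemma rcomp_sum r (dr : 'I_r -> int) (x : 'rV[E]_r) :
  exists D : seq int, uniq D /\ forall D', uniq D' -> {subset D <= D'} ->
    x = \sum_(d <- D') rcomp dr d x.
Proof.
exists (undup [seq (a%:Z + dr s) | s <- enum 'I_r, a <- iota 0 c.+1]).
rewrite undup_uniq; split => // D' uD' DD'.
apply/rowP => s; rewrite summxE; apply: ext_eqP => A; rewrite ext_coef_sum.
under eq_bigr do rewrite mxE ext_coef_comp.
have inD : #|A|%:Z + dr s \in D'.
  apply: DD'; rewrite mem_undup; apply/allpairsPdep; exists s, #|A|.
  rewrite mem_enum mem_iota add0n ltnS; split => //.
  by have := max_card (mem A); rewrite card_ord.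
rewrite (bigD1_seq (#|A|%:Z + dr s)) //= addrK eqxx big1 ?addr0 // => d dA.
by rewrite ifN // eq_sym subr_eq.
Qed.

Lemma rhom0 r (dr : 'I_r -> int) d : rhom dr d 0.
Proof. by move=> i s; rewrite mxE; apply: ext_homog0. Qed.

Lemma rhomD r (dr : 'I_r -> int) d (x y : 'rV[E]_r) :
  rhom dr d x -> rhom dr d y -> rhom dr d (x + y).
Proof. by move=> xd yd i s; rewrite mxE; apply: ext_homogD. Qed.

Lemma rhomZ r (dr : 'I_r -> int) d (a : E) d' (x : 'rV[E]_r) :
  ext_homog d' a -> rhom dr d x -> rhom dr (d' + d) (a *: x).
Proof. by move=> ad xd i s; rewrite mxE -addrA; apply: ext_homogM. Qed.

Lemma rhomZk r (dr : 'I_r -> int) d (a : k) (x : 'rV[E]_r) :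
  rhom dr d x -> rhom dr d (a%:A *: x).
Proof. by move=> xd i s; rewrite mxE; apply: ext_homogZ. Qed.

Lemma rhom_delta r (dr : 'I_r -> int) s : rhom dr (dr s) (delta_mx 0 s).
Proof.
move=> i t A; rewrite ord1 !mxE eqxx /=; case: (eqVneq t s) => [->|ts].
  rewrite subrr /ext_coef ffunE.
  by case: (eqVneq A finset.set0) => [->|_]; rewrite ?finset.cards0 ?eqxx.
by rewrite /= ext_coef0 eqxx.
Qed.

Lemma mhom_row p r (dp : 'I_p -> int) (dr : 'I_r -> int) (A : 'M[E]_(p, r)) :
  (forall s, rhom dr (dp s) (row s A)) <-> mhom dp dr A.
Proof.
split=> Ah s t; last by move=> *; rewrite mxE; apply: Ah.
by have := Ah s 0 t; rewrite mxE.
Qed.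

End HomogeneousMatrices.

Lemma cartan_d_closed (A B : zmodType) (e : nat -> {additive A -> B})
    (N0 : set A) (N1 : set B) q phi al :
  N1 0 -> (forall x y, N1 x -> N1 y -> N1 (x + y)) ->
  (forall i x, N0 x -> N1 (e i x)) ->
  (forall be, size be = q -> N0 (phi be)) -> size al = q -> N1 (cartan_d e q phi al).
Proof.
move=> N10 N1D eN; elim: q phi al => [|q IH] phi [|j al] //= phiN [sal].
apply: N1D; last by apply/eN/phiN; rewrite /= sal.
by apply: IH => // be sbe; apply: phiN; rewrite /= sbe.
Qed.

(** * Graded pieces and their syzygies *)

Section GradedPieces.
Variables (k : fieldType) (c : nat).
Notation E := (ext k c).

Definition degZ r (dn : 'I_r -> nat) : 'I_r -> int := fun s => (dn s)%:Z.

Lemma ext_deg_homog n (x : E) : ext_deg n x <-> ext_homog n%:Z x.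
Proof. by split=> xn A /xn; [move-> | case]. Qed.

Lemma cartan_d_row r q (phi : seq nat -> 'rV[E]_r) al s :
  cartan_d (@egen_op k c 'rV[E]_r) q phi al 0 s =
  cartan_d (@egen_op k c E^o) q (fun be => phi be 0 s) al.
Proof. by elim: q phi al => [|q IH] phi [|j al] //=; rewrite !mxE // IH. Qed.

(** Each basis vector spans a copy of the exterior algebra shifted by [dn s]; as [dn s <= n], degree
    [n.+1] lies in strictly positive degree of every copy. *)
Lemma free_cartan_exact r (dn : 'I_r -> nat) n : (forall s, dn s <= n)%N ->
  cartan_exact (@egen_op k c 'rV[E]_r) (@egen_op k c 'rV[E]_r) c
    (rhom (degZ dn) n%:Z) (rhom (degZ dn) n.+1%:Z).
Proof.
move=> dn_n phi phiN [M phiM] cyc.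
have /choice [psi psiP] s : exists psi : seq nat -> E,
    [/\ forall al, size al = c -> ext_deg (n - dn s) (psi al), fin_supp psi &
      forall al, size al = c -> cartan_d (@egen_op k c E^o) c psi al = phi al 0 s].
  have [|||psi [psiN fs psiE]] :=
    @ext_cartan_exact k c (n - dn s) (fun al => phi al 0 s).
  - move=> al sal; apply/ext_deg_homog; have := phiN al sal 0 s.
    by rewrite /degZ -subSn // -subzn ?(leq_trans (dn_n s)).
  - by exists M => al /phiM ->; rewrite mxE.
  - by move=> al sal; rewrite -cartan_d_row cyc // mxE.
  - by exists psi.
have /choice [N NP] s : exists N : nat, forall al, has (leq N) al -> psi s al = 0.
  by have [_] := psiP s.
exists (fun al => \row_s psi s al); split.
- move=> al sal i s; rewrite mxE /degZ subzn //; apply/ext_deg_homog.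
  by have [psiN _ _] := psiP s; apply: psiN.
- exists (\max_s N s)%N => al /hasP[i ial Ni]; apply/rowP => s; rewrite !mxE.
  by apply: NP; apply/hasP; exists i => //=; apply: leq_trans (leq_bigmax s) Ni.
move=> al sal; apply/rowP => s; rewrite cartan_d_row.
have [_ _ <-//] := psiP s; apply: eq_cartan_d => // be _.
by rewrite mxE.
Qed.

Section Pieces.
Variable V : lmodType E.

Definition fin_span (U : set V) : Prop :=
  exists m (b : 'I_m -> V), (forall i, U (b i)) /\
    forall x, U x -> exists a : 'I_m -> k, x = \sum_i (a i)%:A *: b i.

(** k acts on V only through the scalars [a%:A], so dimensions are measured through [nu]: a family
    in U whose image has maximal rank spans U. *)
Lemma fin_span_embedded M (nu : V -> 'rV[k]_M) (U : set V) :
  (forall a x y, nu (a%:A *: x + y) = a *: nu x + nu y) -> injective nu ->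
  U 0 -> (forall (a : k) x y, U x -> U y -> U (a%:A *: x + y)) -> fin_span U.
Proof.
move=> nuL nu_inj U0 UL.
pose mx (s : seq V) : 'M[k]_(size s, M) := \matrix_(i < size s) nu (s`_i).
pose P n := `[< exists s : seq V, (forall x, x \in s -> U x) /\ \rank (mx s) = n >].
have P0 : exists n, P n by exists (\rank (mx [::])); apply/asboolP; exists [::].
have PM n : P n -> (n <= M)%N by move=> /asboolP[s [_ <-]]; apply: rank_leq_col.
case: (ex_maxnP P0 PM) => n /asboolP[s [sU sn]] maxn.
exists (size s), (fun i => s`_i); split=> [i|x Ux]; first exact/sU/mem_nth.
have : (nu x <= mx s)%MS.
  have rk : (\rank (mx (x :: s)) <= \rank (mx s))%N.
    rewrite sn; apply: maxn; apply/asboolP; exists (x :: s); split => // y.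
    by rewrite inE => /predU1P[->|/sU].
  have sub : (mx s <= mx (x :: s))%MS.
    apply/row_subP => i; rewrite rowK.
    have -> : nu s`_i = row (lift ord0 i) (mx (x :: s)) by rewrite rowK.
    exact: row_sub.
  have [_ /esym] := mxrank_leqif_sup sub.
  rewrite eqn_leq rk andbT mxrankS // => sup.
  apply: submx_trans sup; have <- : row ord0 (mx (x :: s)) = nu x by rewrite rowK.
  exact: row_sub.
move=> /submxP[a aE]; exists (a 0); apply: nu_inj.
have nu0 : nu 0 = 0.
  have := nuL 1 0 0; rewrite scaler0 addr0 scale1r => /eqP.
  by rewrite -subr_eq subrr eq_sym => /eqP.
rewrite aE mulmx_sum_row.
suff H (I : Type) (l : seq I) (b : I -> k) (v : I -> V) :
    nu (\sum_(i <- l) (b i)%:A *: v i) = \sum_(i <- l) b i *: nu (v i).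
  by rewrite H; apply: eq_bigr => i _; rewrite rowK.
elim: l => [|y l IH]; first by rewrite !big_nil.
by rewrite !big_cons nuL IH.
Qed.

(** The hypothesis that is carried from a module to its syzygies. As the exactness is at [n.+1], the
    condition [rho <= n] covers exactly the degrees above rho. *)
Record graded_pieces (rho : nat) (N : nat -> set V) : Prop := GradedPieces {
  pieces0 : forall n, N n 0;
  piecesD : forall n x y, N n x -> N n y -> N n (x + y);
  piecesZ : forall d n (a : E) x, ext_homog d%:Z a -> N n x -> N (d + n)%N (a *: x);
  pieces_span : forall n, fin_span (N n);
  pieces_exact : forall n, (rho <= n)%N ->
    cartan_exact (@egen_op k c V) (@egen_op k c V) c (N n) (N n.+1) }.

Section Step.
Variables (rho : nat) (N : nat -> set V).
Hypothesis NP : graded_pieces rho N.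

Lemma pieces_homog r (dn : 'I_r -> nat) (g : 'I_r -> V) n x :
  (forall s, N (dn s) (g s)) -> rhom (degZ dn) n%:Z x -> N n (lincomb g x).
Proof.
move=> gN xn; rewrite /lincomb; elim/big_ind: _ => [|y z|s _].
- exact: (pieces0 NP).
- exact: (piecesD NP).
have := xn 0 s; rewrite /degZ; case: (leqP (dn s) n) => sn.
  rewrite subzn // => /(piecesZ NP)/(_ (gN s)); by rewrite subnK.
move=> xs; rewrite [x 0 s](_ : _ = 0) ?scale0r; first exact: (pieces0 NP).
apply: ext_eqP => A; rewrite ext_coef0; apply/eqP; apply: contraT => /xs.
move/eqP; rewrite eq_sym subr_eq -PoszD eqz_nat => /eqP nE.
by move: sn; rewrite nE ltnNge leq_addl.
Qed.

(** Up to degree rho, spanning families over k serve as generators; above rho, exactness at exponent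
    0 gives [N n.+1] as the sum of the e_i [N n]. The generators need not be minimal: what counts is
    the bound on their degrees. *)
Lemma pieces_generators : exists r (dn : 'I_r -> nat) (g : 'I_r -> V),
  [/\ forall s, (dn s <= rho)%N, forall s, N (dn s) (g s) &
    forall n z, N n z -> exists x, rhom (degZ dn) n%:Z x /\ lincomb g x = z].
Proof.
have /choice [m mP] n := pieces_span NP n.
pose b n := sval (cid (mP n)); have bP n := svalP (cid (mP n)).
pose T : finType := {n : 'I_rho.+1 & 'I_(m n)}.
pose dn (s : 'I_#|T|) := nat_of_ord (tag (enum_val s)).
pose g (s : 'I_#|T|) := b _ (tagged (enum_val s)).
have gN s : N (dn s) (g s) by exact: (bP _).1.
exists #|T|, dn, g; split => //; first by move=> s; rewrite -ltnS ltn_ord.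
have low n z : (n <= rho)%N -> N n z ->
    exists x, rhom (degZ dn) n%:Z x /\ lincomb g x = z.
  rewrite -ltnS => nr /(bP n).2 [a ->].
  pose t (i : 'I_(m n)) : T := existT (fun n : 'I_rho.+1 => 'I_(m n)) (Ordinal nr) i.
  exists (\sum_i (a i)%:A *: delta_mx 0 (enum_rank (t i))); split.
    elim/big_ind: _ => [|x y|i _]; [exact: rhom0 | exact: rhomD |].
    have <- : degZ dn (enum_rank (t i)) = n by rewrite /degZ /dn enum_rankK.
    exact/rhomZk/rhom_delta.
  rewrite linear_sum; apply: eq_bigr => i _.
  by rewrite linearZ /= lincomb_delta /g enum_rankK.
elim=> [|n IH] z Nz; first exact: low.
case: (leqP n.+1 rho) => [nr|rn]; first exact: low.
have [y [yN ->]] := cartan_exact_gen (pieces_exact NP rn) (pieces0 NP _) Nz.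
have /choice [x xP] (i : 'I_c) := IH _ (yN i (ltn_ord i)).
exists (\sum_(i < c) egen k c i *: x i); split.
  elim/big_ind: _ => [|u v|i _]; [exact: rhom0 | exact: rhomD |].
  have := rhomZ (@ext_homog_egen k c i) (xP i).1.
  by rewrite -PoszD.
rewrite linear_sum; apply: eq_bigr => i _; rewrite linearZ /=.
by rewrite (xP i).2.
Qed.

End Step.
End Pieces.

Lemma rowE_fin_span r (U : set 'rV[E]_r) :
  U 0 -> (forall (a : k) x y, U x -> U y -> U (a%:A *: x + y)) -> fin_span U.
Proof.
move=> U0 UL; pose T : finType := ('I_r * {set 'I_c})%type.
pose nu (x : 'rV[E]_r) := \row_(i < #|T|) ext_coef (x 0 (enum_val i).1) (enum_val i).2.
apply: (@fin_span_embedded 'rV[E]_r #|T| nu U) => //.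
  move=> a x y; apply/rowP => i; rewrite !mxE ext_coefD mulr_algl.
  by rewrite ext_coefZ.
move=> x y /rowP xy; apply/rowP => s; apply: ext_eqP => A.
by have := xy (enum_rank (s, A)); rewrite !mxE enum_rankK.
Qed.

(** Exactness for the syzygies in degree n + 2 comes from exactness for the module in degree n + 1,
    and for the free cover in degree n + 2. *)
Lemma pieces_syzygy (V : lmodType E) rho (N : nat -> set V) r (dn : 'I_r -> nat)
    (g : 'I_r -> V) :
  graded_pieces rho N -> (forall s, (dn s <= rho)%N) -> (forall s, N (dn s) (g s)) ->
  (forall n z, N n z -> exists x, rhom (degZ dn) n%:Z x /\ lincomb g x = z) ->
  graded_pieces rho.+1
    (fun n => [set x | rhom (degZ dn) n%:Z x /\ lincomb g x = 0]%classic).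
Proof.
move=> NP dn_rho gN gen; split.
- by move=> n; split; [apply: rhom0 | rewrite linear0].
- move=> n x y [xn x0] [yn y0]; split; first exact: rhomD.
  by rewrite linearD /= x0 y0 addr0.
- move=> d n a x ad [xn x0]; split; first by rewrite PoszD; apply: rhomZ.
  by rewrite linearZ /= x0 scaler0.
- move=> n; apply: rowE_fin_span.
    by split; [apply: rhom0 | rewrite linear0].
  move=> a x y [xn x0] [yn y0]; split.
    by apply: rhomD => //; apply: rhomZk.
  by rewrite linearD linearZ /= x0 y0 addr0 scaler0.
case=> // n rn.
apply: (@cartan_exact_syzygy _ _ _ _ (@egen_op k c V) (lincomb g)
  (rhom (degZ dn) n%:Z) _ _ (N n) (N n.+1)).
- by move=> i j x _ _; apply: egen_anti.
- by move=> i x _; apply: egen_sqr.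
- by move=> i x _; rewrite /= linearZ.
- exact: rhom0.
- by move=> x; apply: (pieces_homog NP gN).
- by move=> z /gen[x [xn xE]]; exists x.
- move=> psi al psiN sal; apply: (@cartan_d_closed _ _ _ (rhom (degZ dn) n%:Z)) sal => //.
  + exact: rhom0.
  + by move=> x y; apply: rhomD.
  + by move=> i x xn; have := rhomZ (@ext_homog_egen k c i) xn; rewrite -PoszD.
- move=> x y xn yn; apply: rhomD => //.
  by have := @rhomZk k c _ _ _ (-1) _ yn; rewrite !scaleN1r.
- apply: free_cartan_exact => s; exact: leq_trans (dn_rho s) (leqW rn).
exact: pieces_exact NP _ rn.
Qed.

End GradedPieces.

(** * Graded free resolutions with bounded generator degrees *)

Section GradedResolution.
Variables (k : fieldType) (c : nat).
Notation E := (ext k c).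

(** A free module of the resolution together with the graded pieces of the syzygies that the next
    free module has to cover. Bundling them lets dependent choice run over stages. *)
Record stage := Stage {
  stage_rank : nat;
  stage_deg : 'I_stage_rank -> nat;
  stage_syz : nat -> set 'rV[E]_stage_rank }.

Definition covers (s s' : stage) (D : 'M[E]_(stage_rank s', stage_rank s)) : Prop :=
  [/\ forall t, stage_syz (stage_deg t) (row t D),
      forall n z, @stage_syz s n z ->
        exists x, rhom (degZ (@stage_deg s')) n%:Z x /\ x *m D = z &
      forall n x, @stage_syz s' n x <->
        rhom (degZ (@stage_deg s')) n%:Z x /\ x *m D = 0].

Definition good_stage (rho : nat) (s : stage) : Prop :=
  [/\ forall t, (@stage_deg s t <= rho)%N, graded_pieces rho.+1 (@stage_syz s) &
      forall n x, @stage_syz s n x -> rhom (degZ (@stage_deg s)) n%:Z x].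

Lemma good_stage_step rho s : good_stage rho s ->
  exists s', good_stage rho.+1 s' /\ exists D, @covers s s' D.
Proof.
case=> _ GP _.
have [r [dn [g [dn_rho gN gen]]]] := pieces_generators GP.
pose s' := @Stage r dn
  (fun n => [set x | rhom (degZ dn) n%:Z x /\ lincomb g x = 0]%classic).
exists s'; split.
  by split => //=; [exact: pieces_syzygy GP dn_rho gN gen | move=> n x []].
have mulE (x : 'rV[E]_r) : x *m (\matrix_t g t) = lincomb g x.
  by rewrite mulmx_sum_row; apply: eq_bigr => t _; rewrite rowK.
exists (\matrix_t g t); split => /=.
- by move=> t; rewrite rowK.
- by move=> n z /gen[x [xn xE]]; exists x; rewrite mulE.
- by move=> n x; rewrite mulE.
Qed.

Section Comp.
Variables (L : lmodType E) (gr : int -> set L).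
Hypothesis grP : grading gr.

Lemma gr_sum I (s : seq I) (F : I -> L) j :
  (forall i, gr j (F i)) -> gr j (\sum_(i <- s) F i).
Proof.
case: grP => gr0D _ _ _ Fj.
by elim/big_ind: _ => // [|x y]; case: (gr0D j) => // _; apply.
Qed.

Lemma gr_homog r (dr : 'I_r -> int) (eps : {linear 'rV[E]_r -> L}) d x :
  (forall s, gr (dr s) (eps (delta_mx 0 s))) -> rhom dr d x -> gr d (eps x).
Proof.
move=> epsd xd; rewrite lincombE; apply: gr_sum => s.
case: grP => _ grM _ _; rewrite -[d](subrK (dr s)); exact: grM.
Qed.

Lemma eps_rcomp r (dr : 'I_r -> int) (eps : {linear 'rV[E]_r -> L}) d x :
  (forall s, gr (dr s) (eps (delta_mx 0 s))) -> gr d (eps x) ->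
  eps (rcomp dr d x) = eps x.
Proof.
move=> epsd xd; have [D [uD DP]] := rcomp_sum dr x.
pose D' := undup (d :: D).
have uD' : uniq D' := undup_uniq _.
have xE : x = \sum_(i <- D') rcomp dr i x.
  by apply: DP => // i iD; rewrite mem_undup inE iD orbT.
have dD' : d \in D' by rewrite mem_undup mem_head.
(* The [y i] are homogeneous of degree i and sum to 0, so the directness of the grading kills
   [y d]. *)
pose y i := eps (rcomp dr i x) - (if i == d then eps x else 0).
have yN i : gr i (y i).
  case: grP => gr0D grM _ _; have [_ grD] := gr0D i; apply: grD.
    exact: gr_homog epsd (@mhom_comp _ _ _ _ _ _ _).
  rewrite -scaleN1r -{1}[i]add0r; apply: grM.
    move=> A; rewrite ext_coefN oppr_eq0 /ext_coef ffunE.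
    by case: (eqVneq A finset.set0) => [->|_]; rewrite ?finset.cards0 ?eqxx.
  by case: eqP => [->//|_]; have [] := gr0D i.
have ysum : \sum_(i <- D') y i = 0.
  rewrite big_split /= sumrN -linear_sum -xE.
  rewrite (bigD1_seq d) //= eqxx big1 ?addr0 ?subrr // => i.
  by case: eqP.
case: grP => _ _ _ /(_ D' y uD' yN ysum d dD').
by rewrite /y eqxx => /eqP; rewrite subr_eq0 => /eqP.
Qed.

Lemma graded_resolution_exists rho :
  (forall j z, j < 0 -> gr j z -> z = 0) ->
  graded_pieces rho (fun n => gr n%:Z) ->
  exists r (dn : forall i, 'I_(r i) -> nat) (D : forall i, 'M[E]_(r i.+1, r i))
      (eps : {linear 'rV[E]_(r 0%N) -> L}),
    graded_free_resolution gr (fun i => degZ (dn i)) D eps /\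
    forall i s, (dn i s <= rho + i)%N.
Proof.
move=> gr_neg GP.
have [r [dn [g [dn_rho gN gen]]]] := pieces_generators GP.
pose s0 := @Stage r dn
  (fun n => [set x | rhom (degZ dn) n%:Z x /\ lincomb g x = 0]%classic).
have s0P : good_stage (rho + 0) s0.
  rewrite addn0; split => //=; first exact: pieces_syzygy GP dn_rho gN gen.
  by move=> n x [].
case: (@dependent_choice_seq (fun=> stage) (fun i s => good_stage (rho + i) s)
  (fun i s s' => exists D, @covers s s' D) s0 s0P).
  by move=> i s; rewrite addnS; apply: good_stage_step.
move=> s [s00 sP sR].
pose D i := sval (cid (sR i)); have DP i : covers (D i) := svalP (cid (sR i)).
have {s00} [eps [epsd epsN epsK]] : exists eps : {linear 'rV[E]_(stage_rank (s 0%N)) -> L},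
    [/\ forall t, gr (@stage_deg (s 0%N) t)%:Z (eps (delta_mx 0 t)),
      forall n z, gr n%:Z z ->
        exists x, rhom (degZ (@stage_deg (s 0%N))) n%:Z x /\ eps x = z &
      forall n x, @stage_syz (s 0%N) n x <->
        rhom (degZ (@stage_deg (s 0%N))) n%:Z x /\ eps x = 0].
  rewrite s00; exists (lincomb g); split => //= t.
  by rewrite lincomb_delta; apply: gN.
have Dhom i : mhom (degZ (@stage_deg (s i.+1))) (degZ (@stage_deg (s i))) (D i).
  apply/mhom_row => t; case: (DP i) => rowD _ _.
  by case: (sP i) => _ _; apply.
(* It suffices to lift the homogeneous components of a cycle. *)
have split_comp i (B : set 'rV[E]_(stage_rank (s i))) x :
    B 0 -> (forall y z, B y -> B z -> B (y + z)) ->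
    (forall n : nat, B (rcomp (degZ (@stage_deg (s i))) n%:Z x)) -> B x.
  move=> B0 BD Bx; have [U [uU UP]] := rcomp_sum (degZ (@stage_deg (s i))) x.
  rewrite (UP U uU (fun _ => id)); elim/big_ind: _ => // -[n|n] _ //.
  suff -> : rcomp (degZ (@stage_deg (s i))) (Negz n) x = 0 by [].
  apply/rowP => t; apply: ext_eqP => A; rewrite !mxE ext_coef_comp ext_coef0.
  by rewrite ifN // /degZ eq_sym subr_eq -PoszD.
exists (fun i => stage_rank (s i)), (fun i => @stage_deg (s i)), D, eps.
split; last by move=> i t; case: (sP i).
have bdD i y z : boundaries D y -> boundaries D z -> boundaries D (n := i) (y + z).
  by move=> [y' ->] [z' ->]; exists (y' + z'); rewrite mulmxDl.
have bd0 i : boundaries D (n := i) 0 by exists 0; rewrite mul0mx.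
split => //; apply: acyclic_free_resolution.
- split=> i.
    apply/row_matrixP => t; rewrite row_mul row0.
    by case: (DP i.+1) => rowD _ _; case: (DP i) => _ _ K; case: ((K _ _).1 (rowD t)).
  move=> x xD; apply: (split_comp _ _ x (bd0 _) (@bdD _)) => n.
  case: (DP i.+1) => _ cov _; case: (DP i) => _ _ K.
  have /cov[y [_ <-]] : stage_syz (s := s i.+1) n
      (rcomp (degZ (@stage_deg (s i.+1))) n%:Z x).
    apply/K; split; first exact: mhom_comp.
    rewrite -(mcomp_mulr _ _ (Dhom i)) xD; apply/matrixP => u v; rewrite !mxE.
    by apply: ext_eqP => A; rewrite ext_coef_comp ext_coef0 if_same.
  by exists y.
- move=> z; case: grP => _ _ /(_ z)[S [y [yN ->]]] _.
  elim/big_ind: _ => [|_ _ [u <-] [v <-]|j _]; first by exists 0; rewrite linear0.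
    by exists (u + v); rewrite linearD.
  case: j (yN j) => [n /epsN[x [_ <-]]|n /gr_neg ->//]; first by exists x.
  by exists 0; rewrite linear0.
move=> x; split=> [x0|[y ->]]; last first.
  rewrite mulmx_sum_row linear_sum big1 // => t _; rewrite linearZ /=.
  by case: (DP 0%N) => rowD _ _; case: ((epsK _ _).1 (rowD t)) => _ ->; rewrite scaler0.
apply: (split_comp _ _ x (bd0 _) (@bdD _)) => n.
case: (DP 0%N) => _ cov _.
have /cov[y [_ <-]] : stage_syz (s := s 0%N) n (rcomp (degZ (@stage_deg (s 0%N))) n%:Z x).
  apply/epsK; split; first exact: mhom_comp.
  rewrite eps_rcomp // x0; case: grP => gr0D _ _ _; by have [] := gr0D n%:Z.
by exists y.
Qed.

End Comp.
End GradedResolution.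

(** * Regularity from a resolution with bounded degrees *)

Section Regularity.
Variables (k : fieldType) (c : nat).
Notation E := (ext k c).

Lemma ext_aug_is_zmod_morphism : zmod_morphism (@ext_aug k c).
Proof. by move=> x y; rewrite /ext_aug ext_coefD ext_coefN. Qed.

Lemma ext_aug_is_monoid_morphism : monoid_morphism (@ext_aug k c).
Proof.
split=> [|x y]; first by rewrite /ext_aug /ext_coef ffunE eqxx.
rewrite /ext_aug ext_coefM (bigD1 finset.set0) //= [X in _ + X]big1 ?addr0.
  rewrite (big_pred1 finset.set0) ?ext_sign0s ?mul1r // => B.
  by rewrite finset.set0U.
move=> A nA; rewrite big_pred0 // => B; rewrite finset.setU_eq0.
by rewrite (negbTE nA).
Qed.

HB.instance Definition _ := GRing.isZmodMorphism.Build E k (@ext_aug k c)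
  ext_aug_is_zmod_morphism.
HB.instance Definition _ := GRing.isMonoidMorphism.Build E k (@ext_aug k c)
  ext_aug_is_monoid_morphism.

Lemma ext_aug_homog d (x : E) : ext_homog d x -> ext_aug x != 0 -> d = 0.
Proof. by move=> xd /xd; rewrite finset.cards0 => <-. Qed.

Lemma ext_augA (a : k) : ext_aug (a%:A : E) = a.
Proof. by rewrite /ext_aug ext_coefZ /ext_coef ffunE eqxx mulr1. Qed.

Lemma ext_homog1E (x : E) :
  ext_homog 1 x -> x = \sum_i ext_coef x [set i]%SET *: ext_gen k i.
Proof.
move=> x1; apply: ext_eqP => A; rewrite ext_coef_sum.
under eq_bigr do rewrite ext_coefZ /ext_coef [X in _ * X]ffunE.
have [xA|/x1 [] /eqP/finset.cards1P[i ->]] := eqVneq (ext_coef x A) 0.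
  rewrite xA big1 // => i _; case: eqP => [<-|]; last by rewrite mulr0.
  by rewrite -/(ext_coef _ _) xA mul0r.
rewrite (bigD1 i) //= eqxx mulr1 big1 ?addr0 // => j ji.
by rewrite (inj_eq (@finset.set1_inj _)) eq_sym (negbTE ji) mulr0.
Qed.

Variables (L : lmodType E) (gr : int -> set L).
Hypothesis grP : grading gr.

Section Comparison.
Variables (r : nat -> nat) (deg : forall i, 'I_(r i) -> int).
Variables (D : forall i, 'M[E]_(r i.+1, r i)) (eps : {linear 'rV[E]_(r 0%N) -> L}).
Hypothesis resP : graded_free_resolution gr deg D eps.

Lemma graded_chain_map r' (deg' : forall i, 'I_(r' i) -> int)
    (D' : forall i, 'M[E]_(r' i.+1, r' i)) (eps' : {linear 'rV[E]_(r' 0%N) -> L}) :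
  graded_free_resolution gr deg' D' eps' ->
  exists a : forall n, 'M[E]_(r' n, r n),
    [/\ forall n, mhom (@deg' n) (@deg n) (a n),
      forall n, a n.+1 *m D n = D' n *m a n &
      forall x, eps (x *m a 0%N) = eps' x].
Proof.
case=> res' D'h eps'd; case: (resP) => res Dh epsd.
have [a [aD aE]] := resolution_map res res'.
exists (fun n => mcomp (@deg' n) (@deg n) (a n)); split.
- by move=> n; apply: mhom_comp.
- move=> n; rewrite -(mcomp_mulr _ _ (Dh n)) aD.
  exact: mcomp_mull (D'h n).
move=> x; rewrite (lincombE eps') mulmx_sum_row linear_sum.
apply: eq_bigr => s _; rewrite linearZ /=; congr (_ *: _).
rewrite -aE.
have -> : row s (mcomp (@deg' 0%N) (@deg 0%N) (a 0%N)) =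
    rcomp (@deg 0%N) (deg' 0%N s) (delta_mx 0 s *m a 0%N).
  by rewrite -rowE; apply/rowP => t; rewrite !mxE.
by apply: (eps_rcomp grP) => //; rewrite aE.
Qed.

End Comparison.

(** [TorE_neq0] allows any graded resolution. A class of degree j maps to zero in a resolution
    without generators of degree j, and the round trip is homotopic to the identity, so the class is
    a boundary. *)
Lemma Tor_degree r (dn : forall i, 'I_(r i) -> nat)
    (D : forall i, 'M[E]_(r i.+1, r i)) (eps : {linear 'rV[E]_(r 0%N) -> L}) i j :
  graded_free_resolution gr (fun i => degZ (dn i)) D eps -> TorE_neq0 gr i j ->
  exists s, (dn i s)%:Z = j.
Proof.
move=> resP [r' [deg' [D' [eps' [resP' [v [vj vcyc vbd]]]]]]].
apply: contrapT => noj; apply: vbd.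
have [a [ah aD aE]] := graded_chain_map resP resP'.
have [b [bh bD bE]] := graded_chain_map resP' resP.
have [res' _ _] := resP'.
have [t [t0 tS]] := resolution_homotopy res' bD bE aD aE.
pose K p q (A : 'M[E]_(p, q)) : 'M[k]_(p, q) := map_mx (@ext_aug k c) A.
have va : v *m K _ _ (a i) = 0.
  apply/rowP => s; rewrite !mxE big1 // => x _; rewrite mxE.
  have [->|/vj vx] := eqVneq (v 0 x) 0; first by rewrite mul0r.
  have [->|/(ext_aug_homog (ah i x s))] := eqVneq (ext_aug (a i x s)) 0.
    by rewrite mulr0.
  by move/eqP; rewrite subr_eq0 vx => /eqP jE; case: noj; exists s.
have vu : v = v *m K _ _ (1%:M - a i *m b i).
  by rewrite /K map_mxB map_mx1 map_mxM mulmxBr mulmxA va mul0mx subr0 mulmx1.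
exists (v *m K _ _ (t i)); rewrite {1}vu.
case: i v vj vcyc vu va {noj} => [|i] v vj vcyc vu va.
  by rewrite t0 /K map_mxM mulmxA.
rewrite tS /K map_mxD !map_mxM mulmxDr !mulmxA.
by rewrite [v *m map_mx _ (D' i)]vcyc mul0mx addr0.
Qed.

(** The class is the augmentation of a homogeneous lift of z. Were it a boundary, z would have a
    lift with zero augmentation, which expresses it by the e_i and elements of degree 0. *)
Lemma Tor0_degree1 r (dn : forall i, 'I_(r i) -> nat)
    (D : forall i, 'M[E]_(r i.+1, r i)) (eps : {linear 'rV[E]_(r 0%N) -> L}) z :
  graded_free_resolution gr (fun i => degZ (dn i)) D eps -> gr 1 z ->
  ~ (exists y : 'I_c -> L, (forall i, gr 0 (y i)) /\ z = \sum_i ext_gen k i *: y i) ->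
  TorE_neq0 gr 0 1.
Proof.
move=> resP z1 zN; exists r, (fun i => degZ (dn i)), D, eps; split => //=.
case: (resP) => [[epsS epsK _] Dh epsd].
have [x0 x0E] := epsS z.
pose x := rcomp (degZ (dn 0%N)) 1 x0.
have xE : eps x = z by rewrite (eps_rcomp grP) // x0E.
exists (map_mx (@ext_aug k c) x); split => //.
  move=> s; rewrite mxE => /(ext_aug_homog (@mhom_comp _ _ _ _ _ _ _ 0 s)) /eqP.
  by rewrite subr_eq0 eq_sym => /eqP.
move=> [w wE]; apply: zN.
pose W : 'rV[E]_(r 1%N) := map_mx (fun a : k => a%:A) w.
have WE : map_mx (@ext_aug k c) W = w by apply/rowP => s; rewrite !mxE ext_augA.
pose y := rcomp (degZ (dn 0%N)) 1 (x - W *m D 0%N).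
have yE : eps y = z.
  have e : eps (x - W *m D 0%N) = z.
    rewrite linearB /= xE [eps (W *m _)](_ : _ = 0) ?subr0 //.
    by apply/epsK; exists W.
  by rewrite (eps_rcomp grP) // e.
have ya s : ext_aug (y 0 s) = 0.
  rewrite mxE /ext_aug ext_coef_comp; case: ifP => // _.
  have : map_mx (@ext_aug k c) (x - W *m D 0%N) 0 s = 0.
    by rewrite map_mxB map_mxM WE wE subrr mxE.
  by rewrite mxE.
(* Only generators of degree 0 can carry a coefficient of [y]: at degree 1 the coefficient is a
   scalar with zero augmentation, and at higher degrees its own degree would be negative. *)
pose q (s : 'I_(r 0%N)) : E := if dn 0%N s == 0%N then y 0 s else 0.
have yh s : ext_homog (1 - (dn 0%N s)%:Z) (y 0 s) := @mhom_comp _ _ _ _ _ _ _ 0 s.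
have yq s : y 0 s = q s.
  rewrite /q; case: eqP => // dn0; apply: ext_eqP => A; rewrite ext_coef0.
  apply/eqP; apply: contraT => /[dup] yA /(yh s).
  case: (dn 0%N s) dn0 => [|[|n]] // _.
  rewrite subrr => -[] /eqP; rewrite finset.cards_eq0 => /eqP A0.
  by case/eqP: yA; rewrite A0; apply: ya.
have gr0D := let: And4 h _ _ _ := grP in h.
have grM := let: And4 _ h _ _ := grP in h.
exists (fun i => \sum_s (ext_coef (q s) [set i]%SET)%:A *: eps (delta_mx 0 s)); split.
  move=> i; apply: (gr_sum grP) => s; rewrite /q; case: eqP => dn0; last first.
    by rewrite ext_coef0 !scale0r; case: (gr0D 0).
  rewrite -[0]addr0; apply: grM; last by have := epsd s; rewrite /degZ dn0.
  move=> A; rewrite ext_coefZ mulf_eq0 negb_or => /andP[_].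
  rewrite /ext_coef ffunE.
  by case: (eqVneq A finset.set0) => [->|_]; rewrite ?finset.cards0 ?eqxx.
rewrite -yE lincombE /lincomb.
under [RHS]eq_bigr do rewrite scaler_sumr.
rewrite exchange_big /=; apply: eq_bigr => s _.
have q1 : ext_homog 1 (q s).
  rewrite /q; case: eqP => dn0; last exact: ext_homog0.
  by have := yh s; rewrite dn0 subr0.
rewrite yq {1}(ext_homog1E q1) scaler_suml; apply: eq_bigr => i _.
by rewrite !scalerA -scalerAr mulr1.
Qed.

(** The bound 1 is already attained at [Tor_0], by a minimal generator of degree 1. *)
Lemma regularity1 z :
  (forall j x, j < 0 -> gr j x -> x = 0) ->
  graded_pieces 1 (fun n => gr n%:Z) -> gr 1 z ->
  ~ (exists y : 'I_c -> L, (forall i, gr 0 (y i)) /\ z = \sum_i ext_gen k i *: y i) ->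
  is_regularity gr 1.
Proof.
move=> gr_neg GP z1 zN.
have [r [dn [D [eps [resP dnP]]]]] := graded_resolution_exists grP gr_neg GP.
have bound i j : TorE_neq0 gr i j -> j <= 1 + i%:Z.
  by move=> /(Tor_degree resP)[s <-]; rewrite -PoszD lez_nat.
split=> [i j /bound|]; first by rewrite lerBlDr.
exists 0%N, 1; rewrite subr0; split => //; split; first exact: Tor0_degree1 resP z1 zN.
by move=> j /bound; rewrite addr0.
Qed.

End Regularity.

(** * Cones and Koszul complexes over S *)

Section HomotopyComplexes.
Variables (S : comNzRingType) (k : fieldType) (kappa : {rmorphism S -> k}).
Variable f : nat -> S.

Section OneComplex.
Variables (r : nat -> nat) (D : forall n, 'M[S]_(r n.+1, r n)).
Variable (s : nat -> forall n, 'M[S]_(r n, r n.+1)).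

Definition minimal : Prop := forall n, map_mx kappa (D n) = 0.

Definition tor_op (n i : nat) : {additive 'rV[k]_(r n) -> 'rV[k]_(r n.+1)} :=
  mulmxr (map_mx kappa (s i n)).

(** The exactness is at [n.+1], so this is exactness in all degrees above rho. *)
Definition tor_reg (rho q : nat) : Prop :=
  forall n, (rho <= n)%N -> cartan_exact (tor_op n) (tor_op n.+1) q setT setT.

Record hcomplex (q : nat) : Prop := HComplex {
  hc_acyclic : acyclic D;
  hc_minimal : minimal;
  hc_homotopy : forall i, (i < q)%N -> homotopy_for D (f i) (s i) }.

Lemma homotopy_exists (a : S) :
  acyclic D -> (forall x : 'rV_(r 0%N), boundaries D (a *: x)) ->
  exists t : forall n, 'M[S]_(r n, r n.+1), homotopy_for D a t.
Proof.
move=> acD aD.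
have [||t [t0 tS]] := null_homotopy (u := fun n => a%:M) acD.1 acD.
- by move=> n; rewrite scalar_mxC.
- by apply: lift_mx => i; rewrite rowE mul_mx_scalar; apply: aD.
by exists t; split=> [|n]; [exact: esym t0 | exact: esym (tS n)].
Qed.

(** A chain map of degree 2 from a free complex to an acyclic one is null-homotopic, so by
    minimality it vanishes over k. It is applied to the squares and the anticommutators of
    homotopies, which commute with the differential because each f_i is central. *)
Lemma degree2_null q (u : forall n, 'M[S]_(r n, r n.+2)) :
  hcomplex q -> u 0%N *m D 1%N = 0 -> (forall n, u n.+1 *m D n.+2 = D n *m u n) ->
  forall n, map_mx kappa (u n) = 0.
Proof.
case=> acD minD _ u0 uD.
have ac1 := acyclic_shift acD; have ac2 := acyclic_shift ac1.
have [|t [t0 tS]] := null_homotopy (D' := fun n => D n.+2) acD.1 ac2 uD.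
  exact: (acyclic_lift (n := 1) acD).
case=> [|n]; first by rewrite t0 map_mxM minD mulmx0.
by rewrite tS map_mxD !map_mxM !minD mulmx0 mul0mx addr0.
Qed.

Lemma homotopyS a (t : forall n, 'M[S]_(r n, r n.+1)) n :
  homotopy_for D a t -> t n.+1 *m D n.+1 = a%:M - D n *m t n.
Proof. by case=> _ <-; rewrite addrK. Qed.

Lemma tor_op_sqr q n i x : hcomplex q -> (i < q)%N ->
  tor_op n.+1 i (tor_op n i x) = 0.
Proof.
move=> hc iq; have hs := hc_homotopy hc iq; rewrite /tor_op /= -mulmxA -map_mxM.
rewrite (degree2_null (u := fun n => s i n *m s i n.+1) hc) ?mulmx0 //.
  rewrite -mulmxA (homotopyS _ hs) mulmxBr mulmxA hs.1.
  by rewrite scalar_mxC subrr.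
move=> m; rewrite -mulmxA (homotopyS _ hs) mulmxBr !mulmxA (homotopyS _ hs).
by rewrite mulmxBl scalar_mxC opprB addrC subrK.
Qed.

Lemma tor_op_anti q n i j x : hcomplex q -> (i < q)%N -> (j < q)%N ->
  tor_op n.+1 i (tor_op n j x) = - tor_op n.+1 j (tor_op n i x).
Proof.
move=> hc iq jq; have hi := hc_homotopy hc iq; have hj := hc_homotopy hc jq.
apply/eqP; rewrite -addr_eq0 /tor_op /= -!mulmxA -mulmxDr -!map_mxM -map_mxD.
rewrite (degree2_null (u := fun n => s j n *m s i n.+1 + s i n *m s j n.+1) hc)
  ?mulmx0 //.
  rewrite mulmxDl -!mulmxA (homotopyS _ hi) (homotopyS _ hj) !mulmxBr !mulmxA.
  by rewrite hi.1 hj.1 !scalar_mxC addrC addrA subrK subrr.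
move=> m; rewrite mulmxDl -!mulmxA (homotopyS _ hi) (homotopyS _ hj) !mulmxBr.
rewrite !mulmxA (homotopyS _ hi) (homotopyS _ hj) !mulmxBl !scalar_mxC.
rewrite mulmxDr !mulmxA !opprB.
rewrite -addrA [X in _ + X]addrA subrK addrCA.
by rewrite [(f i)%:M *m _ + _]addrC subrK.
Qed.

Lemma tor_regS rho q : hcomplex q.+1 -> tor_reg rho q -> tor_reg rho q.+1.
Proof.
move=> hc reg n /reg; apply: cartan_exactS => [i j x|i x] *.
  exact: (@tor_op_anti q.+1).
exact: (@tor_op_sqr q.+1).
Qed.

End OneComplex.

Section DirectSum.
Variables (rX : nat -> nat) (DX : forall n, 'M[S]_(rX n.+1, rX n)).
Variables (rY : nat -> nat) (DY : forall n, 'M[S]_(rY n.+1, rY n)).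
Variables (sX : nat -> forall n, 'M[S]_(rX n, rX n.+1)).
Variables (sY : nat -> forall n, 'M[S]_(rY n, rY n.+1)).

Definition dsum_r n := (rX n + rY n)%N.
Definition dsum_D n : 'M[S]_(dsum_r n.+1, dsum_r n) := block_mx (DX n) 0 0 (DY n).
Definition dsum_s i n : 'M[S]_(dsum_r n, dsum_r n.+1) :=
  block_mx (sX i n) 0 0 (sY i n).

Lemma dsum_boundaries n (x : 'rV_(rX n)) (y : 'rV_(rY n)) :
  boundaries dsum_D (row_mx x y : 'rV_(dsum_r n)) <-> boundaries DX x /\ boundaries DY y.
Proof.
split=> [[z]|[[x' ->] [y' ->]]].
  rewrite -[z](@hsubmxK _ 1 (rX n.+1) (rY n.+1)) /dsum_D mul_row_block.
  rewrite !mulmx0 addr0 add0r => /eq_row_mx[-> ->].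
  by split; [exists (lsubmx z) | exists (rsubmx z)].
by exists (row_mx x' y'); rewrite /dsum_D mul_row_block !mulmx0 addr0 add0r.
Qed.

Lemma dsum_hcomplex q : hcomplex DX sX q -> hcomplex DY sY q ->
  hcomplex dsum_D dsum_s q.
Proof.
case=> [[ddX exX] minX hX] [[ddY exY] minY hY]; split.
- split=> n; first by rewrite mulmx_block !mulmx0 !mul0mx !addr0 ddX ddY add0r block_mx0.
  move=> x; rewrite -[x](@hsubmxK _ 1 (rX n.+1) (rY n.+1)) mul_row_block.
  rewrite !mulmx0 addr0 add0r -[0](@row_mx0 _ 1 (rX n) (rY n)).
  move=> /eq_row_mx[/exX x1 /exY x2]; apply/(@dsum_boundaries n.+1).
  by split.
- by move=> n; rewrite map_block_mx minX minY !map_mx0 block_mx0.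
move=> i iq; split=> [|n].
  rewrite mulmx_block !mulmx0 !mul0mx !addr0 add0r (hX i iq).1 (hY i iq).1.
  by rewrite -scalar_mx_block.
rewrite !mulmx_block !mulmx0 !mul0mx !addr0 !add0r add_block_mx !addr0.
by rewrite (hX i iq).2 (hY i iq).2 -scalar_mx_block.
Qed.

Lemma dsum_reg rho q : hcomplex DX sX q -> hcomplex DY sY q ->
  tor_reg sX rho q -> tor_reg sY rho q -> tor_reg dsum_s rho q.
Proof.
move=> hcX hcY regX regY n rn; have hc := dsum_hcomplex hcX hcY.
pose i_ n : {additive 'rV[k]_(rY n) -> 'rV[k]_(dsum_r n)} := mulmxr (row_mx 0 1%:M).
pose p_ n : {additive 'rV[k]_(dsum_r n) -> 'rV[k]_(rX n)} := mulmxr (col_mx 1%:M 0).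
apply: (@cartan_exact_extension _ _ _ _ _ _ _ _ _ q
  (tor_op sY n) (tor_op sY n.+1) _ _ (tor_op sX n) (tor_op sX n.+1)
  (i_ n) (i_ n.+1) (i_ n.+2) (mulmxr (col_mx 0 1%:M)) (p_ n) (p_ n.+1) (p_ n.+2)
  (mulmxr (row_mx 1%:M 0))).
- by move=> *; apply: tor_op_anti hc _ _.
- by move=> *; apply: tor_op_sqr hc _.
- move=> i x _; rewrite /= -!mulmxA; congr (x *m _).
  rewrite map_block_mx !map_mx0 mul_row_block mul_mx_row.
  by rewrite !mul0mx !mulmx0 !mul1mx !mulmx1 addr0 add0r.
- move=> i x _; rewrite /= -!mulmxA; congr (x *m _).
  rewrite map_block_mx !map_mx0 mul_row_block mul_mx_row.
  by rewrite !mul0mx !mulmx0 !mul1mx !mulmx1 addr0 add0r.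
- move=> i x _; rewrite /= -!mulmxA; congr (x *m _).
  rewrite map_block_mx !map_mx0 mul_block_col mul_col_mx.
  by rewrite !mul0mx !mulmx0 !mul1mx !mulmx1 !addr0.
- move=> i x _; rewrite /= -!mulmxA; congr (x *m _).
  rewrite map_block_mx !map_mx0 mul_block_col mul_col_mx.
  by rewrite !mul0mx !mulmx0 !mul1mx !mulmx1 !addr0.
- move=> x /=; rewrite -[x](@hsubmxK _ 1 (rX n.+1) (rY n.+1)) !mul_row_col.
  by rewrite !mulmx0 !mulmx1 addr0 add0r mul_mx_row mulmx0 mulmx1 => ->.
- move=> x y /=; rewrite !mul_mx_row !mulmx0 !mulmx1.
  by move=> /eq_row_mx[].
- by move=> x /=; rewrite mul_mx_row mulmx0 mulmx1 mul_row_col mulmx0 mulmx1 addr0.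
- exact: regY.
exact: regX.
Qed.

End DirectSum.
End HomotopyComplexes.

Section Cone.
Variables (S : comNzRingType) (k : fieldType) (kappa : {rmorphism S -> k}).
Variable f : nat -> S.
Variables (rX : nat -> nat) (DX : forall n, 'M[S]_(rX n.+1, rX n)).
Variables (rY : nat -> nat) (DY : forall n, 'M[S]_(rY n.+1, rY n)).
Variable psi : forall n, 'M[S]_(rX n, rY n).

Definition cone_r n := if n is n'.+1 then (rX n' + rY n'.+1)%N else rY 0%N.

Definition cone_D n : 'M[S]_(cone_r n.+1, cone_r n) :=
  match n return 'M[S]_(cone_r n.+1, cone_r n) with
  | 0 => col_mx (psi 0) (DY 0)
  | n'.+1 => block_mx (- DX n') (psi n'.+1) 0 (DY n'.+1)
  end.

Definition cone_s (sX : forall n, 'M[S]_(rX n, rX n.+1))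
    (sY : forall n, 'M[S]_(rY n, rY n.+1)) (t : forall n, 'M[S]_(rX n, rY n.+2)) n :
    'M[S]_(cone_r n, cone_r n.+1) :=
  match n return 'M[S]_(cone_r n, cone_r n.+1) with
  | 0 => row_mx 0 (sY 0)
  | n'.+1 => block_mx (- sX n') (t n') 0 (sY n'.+1)
  end.

Lemma cone_boundaries0 (x : 'rV_(rY 0)) :
  boundaries cone_D (n := 0) x <->
  exists y z, x = y *m psi 0%N + z /\ boundaries DY z.
Proof.
split=> [[w ->]|[y [_ [-> [z ->]]]]]; last by exists (row_mx y z); rewrite /= mul_row_col.
rewrite -[w](@hsubmxK _ 1 (rX 0) (rY 1)) /= mul_row_col.
by exists (lsubmx w), (rsubmx w *m DY 0%N); split => //; exists (rsubmx w).
Qed.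

Hypothesis acX : acyclic DX.
Hypothesis acY : acyclic DY.
Hypothesis psiD : forall n, psi n.+1 *m DY n = DX n *m psi n.
Hypothesis psi_inj :
  forall x : 'rV_(rX 0), boundaries DY (x *m psi 0%N) -> boundaries DX x.

Lemma cone_acyclic : acyclic cone_D.
Proof.
split=> [[|n]|[|n] x].
- by rewrite /= mul_block_col mul0mx add0r mulNmx psiD acY.1 addNr col_mx0.
- rewrite /= mulmx_block !mulmx0 !mul0mx !addr0 !add0r mulNmx mulmxN acX.1 acY.1.
  by rewrite !oppr0 mulNmx psiD addNr block_mx0.
- rewrite -[x](@hsubmxK _ 1 (rX 0) (rY 1)) /= mul_row_col.
  set x1 := lsubmx x; set x2 := rsubmx x => /eqP; rewrite addr_eq0 => /eqP xE.
  (* Degree 1 is where injectivity on [H_0] enters; in higher degrees acyclicity of X suffices. *)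
  have [y yE] : boundaries DX x1.
    by apply: psi_inj; exists (- x2); rewrite mulNmx.
  have [|z zE] := acY.2 0%N (x2 + y *m psi 1%N).
    by rewrite mulmxDl -mulmxA psiD mulmxA -yE xE addrC addNr.
  exists (row_mx (- y) z); rewrite mul_row_block mulmx0 addr0 mulmxN !mulNmx opprK.
  by rewrite -yE -zE addrC addrK.
rewrite -[x](@hsubmxK _ 1 (rX n.+1) (rY n.+2)) /= mul_row_block.
set x1 := lsubmx x; set x2 := rsubmx x.
rewrite mulmx0 addr0 -[0](@row_mx0 _ 1 (rX n) (rY n.+1)) => /eq_row_mx[].
rewrite mulmxN => /eqP; rewrite oppr_eq0 => /eqP/(acX.2 n)[y yE] xE.
have [|z zE] := acY.2 n.+1 (x2 + y *m psi n.+2).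
  by rewrite mulmxDl -mulmxA psiD mulmxA -yE addrC.
exists (row_mx (- y) z); rewrite mul_row_block mulmx0 addr0 mulmxN !mulNmx opprK.
by rewrite -yE -zE addrC addrK.
Qed.

Lemma cone_minimal : minimal kappa DX -> minimal kappa DY ->
  (forall n, map_mx kappa (psi n) = 0) -> minimal kappa cone_D.
Proof.
move=> mX mY mpsi [|n] /=; first by rewrite map_col_mx mpsi mY col_mx0.
by rewrite map_block_mx map_mxN mX mpsi mY map_mx0 oppr0 block_mx0.
Qed.

Lemma cone_homotopy a sX sY t : homotopy_for DX a sX -> homotopy_for DY a sY ->
  psi 0%N *m sY 0%N - sX 0%N *m psi 1%N = - (t 0%N *m DY 1%N) ->
  (forall n, psi n.+1 *m sY n.+1 - sX n.+1 *m psi n.+2 =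
     DX n *m t n - t n.+1 *m DY n.+2) ->
  homotopy_for cone_D a (cone_s sX sY t).
Proof.
move=> [hX0 hXS] [hY0 hYS] t0 tS; split.
  by rewrite /= mul_row_col mul0mx add0r.
case=> [|n] /=.
  rewrite mulmx_block mul_col_row !mulmx0 !mul0mx !addr0 !add0r add_block_mx.
  rewrite mulNmx mulmxN opprK hX0 addr0 hYS addr0 mulNmx.
  have -> : - (sX 0%N *m psi 1%N) + t 0%N *m DY 1%N + psi 0%N *m sY 0%N = 0.
    by rewrite addrC addrA t0 addNr.
  by rewrite -scalar_mx_block.
rewrite !mulmx_block !mulmx0 !mul0mx !addr0 !add0r add_block_mx.
rewrite !mulNmx !mulmxN !opprK hXS addr0 hYS.
have -> : - (sX n.+1 *m psi n.+2) + t n.+1 *m DY n.+2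
    + (- (DX n *m t n) + psi n.+1 *m sY n.+1) = 0.
  by rewrite addrC -!addrA addrC -!addrA addrA tS addrA subrK subrr.
by rewrite -scalar_mx_block.
Qed.

(** Both [psi sY] and [sX psi] are homotopies for a times psi. Their difference anticommutes with
    the differentials, so it is a chain map into the shifted complex with negated differential, and
    [t] contracts it. The same fact compares homotopies along a map of resolutions. *)
Lemma cone_homotopy_corner a sX sY : homotopy_for DX a sX -> homotopy_for DY a sY ->
  exists t : forall n, 'M[S]_(rX n, rY n.+2),
    psi 0%N *m sY 0%N - sX 0%N *m psi 1%N = - (t 0%N *m DY 1%N) /\
    forall n, psi n.+1 *m sY n.+1 - sX n.+1 *m psi n.+2 =
      DX n *m t n - t n.+1 *m DY n.+2.
Proof.
move=> hX hY.
pose u n := psi n *m sY n - sX n *m psi n.+1.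
have acD' := acyclicN (acyclic_shift acY).
have [||t [t0 tS]] := null_homotopy (u := u) acX.1 acD'.
- move=> n; rewrite /u mulmxN mulmxBl mulmxBr -!mulmxA psiD (homotopyS _ hY).
  rewrite !mulmxA (homotopyS _ hX) mulmxBr mulmxA psiD mulmxBl scalar_mxC.
  by rewrite !opprB addrC addrA subrK.
- have [|B BE] := acyclic_lift (n := 0) (A := u 0%N) acY.
    by rewrite mulmxBl -!mulmxA psiD hY.1 mulmxA hX.1 scalar_mxC subrr.
  by exists (- B); rewrite mulmxN mulNmx opprK.
exists t; split=> [|n]; first by rewrite -[RHS]mulmxN; exact: t0.
by rewrite -[LHS]/(u n.+1) tS mulmxN addrC.
Qed.

Variables (sX : nat -> forall n, 'M[S]_(rX n, rX n.+1)).
Variables (sY : nat -> forall n, 'M[S]_(rY n, rY n.+1)).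

Lemma cone_hcomplex q : hcomplex kappa f DX sX q -> hcomplex kappa f DY sY q ->
  (forall n, map_mx kappa (psi n) = 0) ->
  exists t, hcomplex kappa f cone_D (fun i => cone_s (sX i) (sY i) (t i)) q.
Proof.
move=> [_ mX hX] [_ mY hY] mpsi.
have /choice [t tP] i : exists t : forall n, 'M[S]_(rX n, rY n.+2), (i < q)%N ->
    homotopy_for cone_D (f i) (cone_s (sX i) (sY i) t).
  case: (ltnP i q) => iq; last by exists (fun n => 0).
  have [t [t0 tS]] := cone_homotopy_corner (hX i iq) (hY i iq).
  by exists t => _; apply: cone_homotopy (hX i iq) (hY i iq) t0 tS.
by exists t; split => //; [exact: cone_acyclic | exact: cone_minimal].
Qed.

(** X sits one degree higher in the cone, so its bound rho counts as [rho.+1]. *)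
Lemma cone_reg rho q t :
  hcomplex kappa f cone_D (fun i => cone_s (sX i) (sY i) (t i)) q ->
  tor_reg kappa sX rho q -> tor_reg kappa sY rho.+1 q ->
  tor_reg kappa (fun i => cone_s (sX i) (sY i) (t i)) rho.+1 q.
Proof.
move=> hc regX regY [//|n] rn.
pose s i := cone_s (sX i) (sY i) (t i).
pose i_ n : {additive 'rV[k]_(rY n.+1) -> 'rV[k]_(rX n + rY n.+1)} :=
  mulmxr (row_mx 0 1%:M).
(* The cone carries [- sX], so the projection to X commutes with the operators only after its sign
   alternates with the degree. *)
pose p_ n (a : k) : {additive 'rV[k]_(rX n + rY n.+1) -> 'rV[k]_(rX n)} :=
  mulmxr (col_mx a%:M 0).
apply: (@cartan_exact_extension _ _ _ _ _ _ _ _ _ q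
  (tor_op kappa sY n.+1) (tor_op kappa sY n.+2) (tor_op kappa s n.+1) (tor_op kappa s n.+2)
  (tor_op kappa sX n) (tor_op kappa sX n.+1)
  (i_ n) (i_ n.+1) (i_ n.+2) (mulmxr (col_mx 0 1%:M)) (p_ n (-1)) (p_ n.+1 1) (p_ n.+2 (-1))
  (mulmxr (row_mx (-1)%:M 0))).
- by move=> *; apply: tor_op_anti hc _ _.
- by move=> *; apply: tor_op_sqr hc _.
- move=> i x _; rewrite /= -!mulmxA; congr (x *m _); rewrite map_block_mx !map_mx0.
  rewrite mul_row_block mul_mx_row.
  by rewrite !mul0mx !mulmx0 !mul1mx !mulmx1 !add0r.
- move=> i x _; rewrite /= -!mulmxA; congr (x *m _); rewrite map_block_mx !map_mx0.
  rewrite mul_row_block mul_mx_row.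
  by rewrite !mul0mx !mulmx0 !mul1mx !mulmx1 !add0r.
- move=> i x _; rewrite /= -!mulmxA; congr (x *m _); rewrite map_block_mx !map_mx0.
  rewrite mul_block_col mul_col_mx map_mxN.
  by rewrite !mul0mx !mulmx0 !mulmx1 !addr0 mul_scalar_mx scaleN1r.
- move=> i x _; rewrite /= -!mulmxA; congr (x *m _); rewrite map_block_mx !map_mx0.
  rewrite mul_block_col mul_col_mx map_mxN.
  by rewrite !mul0mx !mulmx0 !mul1mx !addr0 mul_mx_scalar scaleN1r opprK.
- move=> x /=; rewrite -[x](@hsubmxK _ 1 (rX n.+1) (rY n.+2)) !mul_row_col.
  by rewrite !mulmx0 !mulmx1 addr0 add0r mul_mx_row mulmx0 mulmx1 => ->.
- move=> x y /=; rewrite !mul_mx_row !mulmx0 !mulmx1.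
  by move=> /eq_row_mx[].
- move=> x /=; rewrite mul_mx_row mulmx0 mul_row_col mulmx0 addr0.
  by rewrite !mul_mx_scalar !scaleN1r opprK.
- exact: regY.
exact: regX.
Qed.

End Cone.

(** A lift of a minimal matrix need not be minimal in higher degrees. Here each matrix unit lifts as
    well, and combining these lifts with the entries of A as coefficients puts a factor from the
    maximal ideal into every term. *)
Lemma minimal_chain_map (S : comNzRingType) (k : fieldType) (kappa : {rmorphism S -> k})
    rX (DX : forall n, 'M[S]_(rX n.+1, rX n)) rY (DY : forall n, 'M[S]_(rY n.+1, rY n))
    (A : 'M[S]_(rX 0%N, rY 0%N)) :
  acyclic DX -> acyclic DY ->
  (forall B : 'M[S]_(rX 0%N, rY 0%N), exists C, DX 0%N *m B = C *m DY 0%N) ->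
  map_mx kappa A = 0 ->
  exists psi : forall n, 'M[S]_(rX n, rY n),
    [/\ psi 0%N = A, forall n, psi n.+1 *m DY n = DX n *m psi n &
      forall n, map_mx kappa (psi n) = 0].
Proof.
move=> acX acY lift A0.
have /choice [a aP] (ij : 'I_(rX 0%N) * 'I_(rY 0%N)) :
    exists a : forall n, 'M[S]_(rX n, rY n),
    a 0%N = delta_mx ij.1 ij.2 /\ forall n, a n.+1 *m DY n = DX n *m a n.
  exact: chain_map_lift.
exists (fun n => \sum_i \sum_j A i j *: a (i, j) n); split.
- rewrite [RHS]matrix_sum_delta; apply: eq_bigr => i _; apply: eq_bigr => j _.
  by case: (aP (i, j)) => ->.
- move=> n; rewrite mulmx_suml mulmx_sumr; apply: eq_bigr => i _.
  rewrite mulmx_suml mulmx_sumr; apply: eq_bigr => j _.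
  by rewrite -scalemxAl -scalemxAr; case: (aP (i, j)) => _ ->.
move=> n; apply/matrixP => u v; rewrite !mxE summxE rmorph_sum big1 // => i _.
rewrite summxE rmorph_sum big1 // => j _; rewrite mxE rmorphM.
by move/matrixP: A0 => /(_ i j); rewrite !mxE => ->; rewrite mul0r.
Qed.

Definition gen_ideal (S : comNzRingType) (f : nat -> S) (q : nat) (x : S) : Prop :=
  exists a : nat -> S, x = \sum_(i < q) a i * f i.

Section GenIdeal.
Variables (S : comNzRingType) (f : nat -> S).

Lemma gen_idealS q x :
  gen_ideal f q.+1 x <-> exists a y, gen_ideal f q y /\ x = a * f q + y.
Proof.
split=> [[a ->]|[a [_ [[b ->] ->]]]].
  by exists (a q), (\sum_(i < q) a i * f i); split;
     [exists a | rewrite big_ord_recr /= addrC].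
exists (fun i => if i == q then a else b i); rewrite big_ord_recr /= eqxx addrC.
by congr (_ + _); apply: eq_bigr => i _; rewrite ltn_eqF.
Qed.

Lemma gen_idealD q x y : gen_ideal f q x -> gen_ideal f q y -> gen_ideal f q (x + y).
Proof.
move=> [a ->] [b ->]; exists (fun i => a i + b i); rewrite -big_split /=.
by apply: eq_bigr => i _; rewrite mulrDl.
Qed.

Lemma gen_idealM q a x : gen_ideal f q x -> gen_ideal f q (a * x).
Proof.
move=> [b ->]; exists (fun i => a * b i); rewrite mulr_sumr.
by apply: eq_bigr => i _; rewrite mulrA.
Qed.

Lemma gen_ideal0 q : gen_ideal f q 0.
Proof. by exists (fun=> 0); rewrite big1 // => i _; rewrite mul0r. Qed.

Lemma gen_ideal_sum q I (s : seq I) (F : I -> S) :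
  (forall i, gen_ideal f q (F i)) -> gen_ideal f q (\sum_(i <- s) F i).
Proof.
by move=> FI; elim/big_ind: _ => //; [exact: gen_ideal0 | move=> ? ?; exact: gen_idealD].
Qed.

End GenIdeal.

(** * Koszul complexes *)

Section Koszul.
Variables (S : comNzRingType) (k : fieldType) (kappa : {rmorphism S -> k}).
Variable f : nat -> S.

(** Built as iterated cones of multiplication by f_q. Over k the homotopies act as the generators of
    an exterior algebra on a free module with generators in degree 0, so the Cartan complex is exact
    in all positive degrees. *)
Lemma koszul_exists q b :
  (forall p x, (p < q)%N -> gen_ideal f p (f p * x) -> gen_ideal f p x) ->
  (forall i, (i < q)%N -> kappa (f i) = 0) ->
  exists (r : nat -> nat) (D : forall n, 'M[S]_(r n.+1, r n))
    (s : nat -> forall n, 'M[S]_(r n, r n.+1)),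
    [/\ r 0%N = b, hcomplex kappa f D s q, tor_reg kappa s 0 q &
      forall x : 'rV_(r 0%N), boundaries D x <-> forall j, gen_ideal f q (x 0 j)].
Proof.
elim: q => [|q IH] freg fk.
  exists (fun n => if n is 0 then b else 0%N), (fun n => 0), (fun i n => 0).
  split => //.
  - split => //; last by move=> n; rewrite map_mx0.
    split=> n; first exact: mul0mx.
    by move=> x _; exists 0; apply/rowP => -[].
  - move=> n _ phi _ _ _; exists (fun=> 0); split => //; first by exists 0%N.
    by move=> al _; apply/rowP => -[].
  move=> x; split=> [[y ->] j|xj]; first by rewrite mulmx0 mxE; apply: gen_ideal0.
  by exists 0; rewrite mulmx0; apply/rowP => j; have [a ->] := xj j; rewrite big_ord0 mxE.
have [//|r [D [s [rb hc reg bd]]]] := IH (fun p x pq => freg p x (ltnW pq)).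
  by move=> i /ltnW; apply: fk.
pose psi n : 'M[S]_(r n) := (f q)%:M.
have psiD n : psi n.+1 *m D n = D n *m psi n by rewrite scalar_mxC.
have psi_inj (x : 'rV_(r 0%N)) : boundaries D (x *m psi 0%N) -> boundaries D x.
  move=> /bd xf; apply/bd => j; apply: freg => //.
  by have := xf j; rewrite /psi mul_mx_scalar mxE.
have kpsi n : map_mx kappa (psi n) = 0 by rewrite map_scalar_mx fk // raddf0.
have acD := hc_acyclic hc.
have acC : acyclic (cone_D D D psi) by exact: cone_acyclic.
(* The homotopy for f_q identifies the lower copy of the complex with the upper one; over k it is
   multiplication by e_q. The earlier homotopies need no corner, as they commute with the scalar map
   [psi]. *)
pose new n : 'M[S]_(cone_r r r n, cone_r r r n.+1) :=
  match n return 'M[S]_(cone_r r r n, cone_r r r n.+1) with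
  | 0 => row_mx 1%:M 0 | n'.+1 => block_mx 0 0 1%:M 0 end.
pose old i := cone_s (s i) (s i) (fun n => 0).
pose s' i := if i == q then new else old i.
have s'E i : (i < q)%N -> s' i = old i by move=> iq; rewrite /s' ltn_eqF.
have s'q : s' q = new by rewrite /s' eqxx.
have hc' : hcomplex kappa f (cone_D D D psi) s' q.+1.
  split => //.
    exact: cone_minimal (hc_minimal hc) (hc_minimal hc) kpsi.
  move=> i; rewrite ltnS leq_eqVlt => /predU1P[->|iq].
    rewrite s'q; split; first by rewrite /= mul_row_col mul1mx mul0mx addr0.
    case=> [|n] /=.
      rewrite mulmx_block mul_col_row !mulmx0 !mul0mx !mulmx1 !mul1mx !addr0.
      by rewrite add_block_mx !add0r !addr0 addNr -scalar_mx_block.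
    rewrite !mulmx_block !mulmx0 !mul0mx !mulmx1 !mul1mx !addr0 !add0r.
    by rewrite add_block_mx !add0r !addr0 addNr -scalar_mx_block.
  rewrite s'E //; have hi := hc_homotopy hc iq.
  apply: cone_homotopy => // [|n].
    by rewrite /psi scalar_mxC subrr mul0mx oppr0.
  by rewrite /psi scalar_mxC subrr mulmx0 mul0mx subr0.
exists (cone_r r r), (cone_D D D psi), s'; split => //; last first.
  move=> x; rewrite cone_boundaries0; split=> [[y [z [-> /bd zI]]] j|xI].
    rewrite mxE /psi mul_mx_scalar mxE mulrC; apply/gen_idealS.
    by exists (y 0 j), (z 0 j).
  have /choice [a aP] j : exists a, gen_ideal f q (x 0 j - a * f q).
    by have /gen_idealS [a [y [yI ->]]] := xI j; exists a; rewrite addrAC subrr add0r.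
  exists (\row_j a j), (x - (\row_j a j) *m psi 0%N); split; first by rewrite addrC subrK.
  by apply/bd => j; rewrite /psi mul_mx_scalar !mxE mulrC.
pose J n : 'M[k]_(r n, cone_r r r n) :=
  match n return 'M[k]_(r n, cone_r r r n) with 0 => 1%:M | n'.+1 => row_mx 0 1%:M end.
(* Contraction against e_q, mapping the upper copy back to the lower one. *)
pose IO n : 'M[k]_(cone_r r r n.+1, cone_r r r n) :=
  match n return 'M[k]_(cone_r r r n.+1, cone_r r r n) with
  | 0 => col_mx 1%:M 0 | n'.+1 => block_mx 0 1%:M 0 0 end.
have IO2 n : IO n.+1 *m IO n = 0.
  case: n => [|n] /=; first by rewrite mul_block_col !mul0mx !mulmx0 !addr0 col_mx0.
  by rewrite mulmx_block !mulmx0 !mul0mx !addr0 block_mx0.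
have IOold n i : (i < q)%N ->
    IO n *m map_mx kappa (s' i n) = - (map_mx kappa (s' i n.+1) *m IO n.+1).
  move=> iq; rewrite s'E //; case: n => [|n] /=.
    rewrite map_row_mx map_block_mx !map_mx0 map_mxN mul_col_row mulmx_block.
    rewrite ?mul1mx ?mulmx1 ?mul0mx ?mulmx0 ?addr0 opp_block_mx.
    by rewrite opprK !oppr0.
  rewrite !map_block_mx !map_mx0 !map_mxN !mulmx_block.
  rewrite ?mul1mx ?mulmx1 ?mul0mx ?mulmx0 ?addr0 ?add0r opp_block_mx.
  by rewrite opprK !oppr0.
have IOnew n : map_mx kappa (s' q n.+1) *m IO n.+1 + IO n *m map_mx kappa (s' q n) = 1%:M.
  rewrite s'q; case: n => [|n] /=.
    rewrite map_row_mx map_block_mx !map_mx0 !map_mx1 mul_col_row mulmx_block.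
    rewrite ?mul1mx ?mul0mx ?mulmx0 ?addr0 add_block_mx ?addr0 ?add0r.
    by rewrite -scalar_mx_block.
  rewrite !map_block_mx !map_mx0 !map_mx1 !mulmx_block.
  rewrite ?mul1mx ?mul0mx ?mulmx0 ?addr0 ?add0r add_block_mx ?addr0 ?add0r.
  by rewrite -scalar_mx_block.
have Jold n i : (i < q)%N ->
    J n *m map_mx kappa (s' i n) = map_mx kappa (s i n) *m J n.+1.
  move=> iq; rewrite s'E //; case: n => [|n] /=.
    by rewrite mul1mx map_row_mx map_mx0 mul_mx_row mulmx0 mulmx1.
  rewrite map_block_mx !map_mx0 mul_row_block mul_mx_row.
  by rewrite ?mul0mx ?mulmx0 ?mulmx1 mul1mx ?add0r.
move=> n _.
apply: (@cartan_exact_contract _ _ _ _ _ q (mulmxr (IO n)) (mulmxr (IO n.+1))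
  setT _ [set x | x *m IO n = 0]%classic).
- by move=> *; apply: tor_op_anti hc' _ _.
- by move=> *; apply: tor_op_sqr hc' _.
- by move=> i x iq _; rewrite /= -!mulmxA IOold // mulmxN.
- by move=> x _; rewrite /= -!mulmxA -mulmxDr IOnew mulmx1.
- by move=> x _; rewrite /= -!mulmxA IO2 !mulmx0.
- by [].
- by [].
(* The kernel of the contraction is the lower copy, embedded by [J], to which the induction
   hypothesis applies. *)
apply: (@cartan_exact_embed _ _ _ _ _ _ q (tor_op kappa s n) (tor_op kappa s n.+1)
  _ _ (mulmxr (J n)) (mulmxr (J n.+1)) (mulmxr (J n.+2)) (mulmxr (col_mx 0 1%:M))).
- exact: raddf0.
- by move=> i x iq; rewrite /= -!mulmxA Jold.
- by move=> i x iq; rewrite /= -!mulmxA -[row_mx 0 1%:M]/(J n.+1) Jold.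
- move=> x; rewrite /= -[x](@hsubmxK _ 1 (r n) (r n.+1)) !mul_row_col !mulmx0 add0r.
  rewrite mulmx1 mul_mx_row mulmx0 mulmx1 => x0.
  suff -> : lsubmx x = 0 by [].
  case: n x x0 => [|n] x /=; first by rewrite mul_row_col mulmx0 mulmx1 addr0.
  rewrite mul_row_block !mulmx0 mulmx1 !addr0.
  by move=> /(congr1 (@rsubmx _ 1 (r n) (r n.+1))); rewrite row_mxKr linear0.
- move=> x /=; rewrite mul_mx_row mulmx0 mulmx1.
  by move=> /(congr1 (@rsubmx _ 1 (r n.+1) (r n.+2))); rewrite row_mxKr linear0.
- by [].
exact: reg.
Qed.

End Koszul.

(** * Modules over a local ring *)

Section LocalRing.
Variables (S : comNzRingType) (m : set S) (k : fieldType) (kappa : {rmorphism S -> k}).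
Hypothesis locS : local_ring m.
Hypothesis resS : residue_map m kappa.

(** The given ideal extends to a maximal one by Zorn's lemma, and that one is [m] because the ring
    is local. *)
Lemma proper_ideal_residue0 (J : set S) x : ideal J -> ~ J 1 -> J x -> kappa x = 0.
Proof.
move=> idJ J1 Jx; apply/resS.2.
pose P (A : set S) := A = set0 \/
  [/\ ideal A, ~ A 1 & forall y, J y -> A y].
have [|A [PA Amax]] := @Zorn_bigcup S P.
  move=> F FP Ftot.
  have [[A0 [FA0 A00]]|allempty] :=
      pselect (exists A, F A /\ A <> set0); last first.
    left; apply/seteqP; split => // y [A FA Ay].
    by apply: allempty; exists A; split => // A0; rewrite A0 in Ay.
  right; have ne A y : F A -> A y -> [/\ ideal A, ~ A 1 & forall y, J y -> A y].
    by move=> FA Ay; case: (FP A FA) => // A0'; rewrite A0' in Ay.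
  have [y0 A0y0] : exists y, A0 y.
    by apply: contrapT => h; apply: A00; apply/seteqP; split => // y Ay; apply: h; exists y.
  have [[A0_0 _] _ JA0] := ne _ _ FA0 A0y0.
  split.
  - split; first by exists A0.
    move=> a y z [A FA Ay] [B FB Bz].
    have [AB|BA] := Ftot A B FA FB.
      exists B => //; have [[_ BL] _ _] := ne B z FB Bz.
      by apply: BL => //; apply: AB.
    exists A => //; have [[_ AL] _ _] := ne A y FA Ay.
    by apply: AL => //; apply: BA.
  - by case=> A FA A1; have [_ + _] := ne A 1 FA A1; apply.
  by move=> y /JA0; exists A0.
have [idA A1 JA] : [/\ ideal A, ~ A 1 & forall y, J y -> A y].
  case: PA => // A0; have [] := Amax J; last by right.
  rewrite A0; split => // h; have := h 0; apply; exact: idJ.1.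
suff <- : A = m by exact: JA.
apply: locS.2; split => // B idB B1 AB; apply/esym/seteqP; split=> [y /AB //|y By].
apply: contrapT => nAy; apply: (Amax B); first by split => // /(_ y By).
by right; split => // z /JA /AB.
Qed.

Lemma residue_unit x : kappa x != 0 -> exists y, x * y = 1.
Proof.
move=> kx; apply: contrapT => nx; move/eqP: kx; apply.
apply: (@proper_ideal_residue0 (fun z => exists y, z = x * y));
  last by exists 1; rewrite mulr1.
  split; first by exists 0; rewrite mulr0.
  by move=> a _ _ [y ->] [z ->]; exists (a * y + z); rewrite mulrDr mulrCA.
by move=> [y y1]; apply: nx; exists y.
Qed.

Lemma residue_inverse n (A : 'M[S]_n) :
  \det (map_mx kappa A) != 0 -> exists B, A *m B = 1%:M /\ B *m A = 1%:M.
Proof.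
rewrite det_map_mx => /residue_unit[y yE]; exists (y *: \adj A).
by rewrite -scalemxAr mul_mx_adj -scalemxAl mul_adj_mx scale_scalar_mx mulrC yE.
Qed.

Lemma complete_rows n p (Q : 'M[k]_(n, p)) : row_free Q ->
  exists n' (U : 'M[k]_(n', p)), p = (n + n')%N /\ row_free (col_mx Q U).
Proof.
move=> Qfree; exists (\rank (Q^C)%MS), (row_base (Q^C)%MS).
have rkQ : \rank Q = n by apply/eqP.
have rkC : \rank (Q^C)%MS = (p - n)%N by rewrite mxrank_compl rkQ.
have np : (n <= p)%N by rewrite -rkQ rank_leq_col.
split; first by rewrite rkC subnKC.
rewrite /row_free -addsmxE (adds_eqmx (eqmx_refl Q) (eq_row_base _)).
by rewrite (eqP (addsmx_compl_full Q)) rkC subnKC.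
Qed.

End LocalRing.

Section Submodules.
Variables (S : comNzRingType) (A : lmodType S).
Implicit Types (P Q : set A).

Lemma submoduleD P x y : submodule P -> P x -> P y -> P (x + y).
Proof. by move=> [_ PL] Px Py; rewrite -[x]scale1r; apply: PL. Qed.

Lemma submoduleZ P a x : submodule P -> P x -> P (a *: x).
Proof. by move=> [P0 PL] Px; rewrite -[a *: x]addr0; apply: PL. Qed.

Lemma submoduleN P x : submodule P -> P x -> P (- x).
Proof. by move=> sP Px; rewrite -scaleN1r; apply: submoduleZ. Qed.

Lemma submoduleB P x y : submodule P -> P x -> P y -> P (x - y).
Proof. by move=> sP Px Py; apply: submoduleD => //; apply: submoduleN. Qed.

Lemma submodule_sum P I (s : seq I) (F : I -> A) :
  submodule P -> (forall i, P (F i)) -> P (\sum_(i <- s) F i).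
Proof.
move=> sP PF; elim/big_ind: _ => //; first by case: sP.
by move=> x y; apply: submoduleD.
Qed.

Lemma submodule_lincomb P n (b : 'I_n -> A) a :
  submodule P -> (forall i, P (b i)) -> P (lincomb b a).
Proof. by move=> sP Pb; apply: submodule_sum => // i; apply: submoduleZ. Qed.

Lemma fg_free_basis P : fg_free P -> exists n (b : 'I_n -> A),
  [/\ forall i, P (b i), forall x, P x -> exists a, x = lincomb b a &
    submodule P -> injective (lincomb b)].
Proof.
move=> [n [b [Pb bP]]]; exists n, b; split => //.
  by move=> x /bP[a [-> _]]; exists a.
move=> sP a a' e.
have [a0 [_ uniq]] := bP _ (submodule_lincomb a sP Pb).
by rewrite -(uniq a erefl); apply: uniq; rewrite e.
Qed.

Lemma lincomb_mulmx n p (b : 'I_p -> A) (M : 'M[S]_(n, p)) a :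
  lincomb b (a *m M) = lincomb (fun i => lincomb b (row i M)) a.
Proof. by rewrite mulmx_sum_row linear_sum; apply: eq_bigr => i _; rewrite linearZ. Qed.

Lemma summand_projection P Q : submodule P -> direct_summand P Q ->
  exists2 C, submodule C & (forall x, P x -> C x -> x = 0) /\
    forall x, Q x <-> exists y z, [/\ P y, C z & x = y + z].
Proof.
move=> sP [C [sC [-> PC]]]; exists C => //; split => // x.
split=> [[y [z [Py [Cz ->]]]]|[y [z [Py Cz ->]]]]; first by exists y, z.
by exists y, z.
Qed.

(** Projecting the vectors along a complement of P keeps the coefficients in J. *)
Lemma smul_set_summand (J : set S) P Q x :
  submodule P -> direct_summand P Q -> P x -> smul_set J Q x -> smul_set J P x.
Proof.
move=> sP /(summand_projection sP)[C sC [PC Qdec]] Px [n [a [v [av xE]]]].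
have /choice [y yP] i : exists y, P y /\ C (v i - y).
  by have /Qdec[y [z [Py Cz ->]]] := (av i).2; exists y; rewrite addrAC subrr add0r.
exists n, a, y; split=> [i|]; first by split; [case: (av i) | case: (yP i)].
apply/eqP; rewrite -subr_eq0; apply/eqP/PC.
  apply: submoduleB => //; apply: submodule_sum => // i; apply: submoduleZ => //.
  by case: (yP i).
rewrite xE -sumrB; apply: submodule_sum => // i; rewrite -scalerBr.
by apply: submoduleZ => //; case: (yP i).
Qed.

End Submodules.

(** The quotient of Q by P is free. The splitting gives the matrix M of the inclusion a right
    inverse, so its rows stay independent over k. They are completed to a basis there, and any lift
    of the new rows makes the stacked matrix invertible, its determinant being a unit. *)
Lemma summand_basis (S : comNzRingType) (m : set S) (k : fieldType)
    (kappa : {rmorphism S -> k}) (A : lmodType S) (P Q : set A) :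
  local_ring m -> residue_map m kappa ->
  submodule P -> submodule Q -> fg_free P -> fg_free Q -> direct_summand P Q ->
  exists n (b : 'I_n -> A),
    [/\ forall i, Q (b i),
      forall x, Q x -> exists a y, P y /\ x = y + lincomb b a &
      forall a, P (lincomb b a) -> a = 0].
Proof.
move=> locS resS sP sQ /fg_free_basis[p [e [Pe eP /(_ sP) e_inj]]].
move=> /fg_free_basis[q [g [Qg gP /(_ sQ) g_inj]]].
move=> /(summand_projection sP)[C sC [PC Qdec]].
have PQ x : P x -> Q x.
  by move=> Px; apply/Qdec; exists x, 0; split; rewrite ?addr0 //; case: sC.
have /choice [cM cMP] i : exists a, e i = lincomb g a by apply/gP/PQ.
pose M := \matrix_i cM i.
have ME i : e i = lincomb g (row i M) by rewrite rowK.
have /choice [y yP] j : exists y, P y /\ C (g j - y).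
  by have /Qdec[y [z [Py Cz ->]]] := Qg j; exists y; rewrite addrAC subrr add0r.
have /choice [cN cNP] j : exists a, y j = lincomb e a by apply: eP; case: (yP j).
pose N := \matrix_j cN j.
have MN : M *m N = 1%:M.
  apply/row_matrixP => i; rewrite row_mul row1; apply: e_inj.
  rewrite lincomb_delta; apply/eqP; rewrite -subr_eq0; apply/eqP/PC.
    by apply: submoduleB => //; apply: submodule_lincomb.
  rewrite lincomb_mulmx -opprB; apply: submoduleN => //.
  rewrite [e i]ME /(lincomb g) {1}/lincomb -sumrB; apply: submodule_sum => // j.
  rewrite -scalerBr; apply: submoduleZ => //.
  by rewrite rowK -cNP; case: (yP j).
have free : row_free (map_mx kappa M).
  by apply/row_freeP; exists (map_mx kappa N); rewrite -map_mxM MN map_mx1.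
have [n [Uk [qE UkP]]] := complete_rows free.
subst q.
have /choice [u uP] (ij : 'I_n * 'I_(p + n)) : exists x, kappa x = Uk ij.1 ij.2.
  exact: resS.1.
pose U := \matrix_(i < n, j < p + n) u (i, j).
have UE : map_mx kappa U = Uk by apply/matrixP => i j; rewrite !mxE uP.
have [|B [_ BT]] := @residue_inverse S m k kappa locS resS _ (col_mx M U).
  by rewrite map_col_mx UE -unitfE -unitmxE -row_free_unit.
exists n, (fun i => lincomb g (row i U)); split.
- by move=> i; apply: submodule_lincomb.
- move=> x /gP[a ->]; exists (rsubmx (a *m B)), (lincomb g (lsubmx (a *m B) *m M)).
  split; first by rewrite lincomb_mulmx; apply: submodule_lincomb => // i; rewrite -ME.
  rewrite -lincomb_mulmx -linearD /= -mul_row_col hsubmxK.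
  by rewrite -mulmxA BT mulmx1.
move=> a; rewrite -lincomb_mulmx => /eP[z zE].
have : row_mx (- z) a *m col_mx M U = 0.
  apply: g_inj; rewrite linear0 mul_row_col mulNmx linearD linearN /= zE.
  apply/eqP; rewrite addrC subr_eq0; apply/eqP.
  rewrite lincomb_mulmx; congr (lincomb _ z); apply/funext => i; exact: ME.
move=> /(congr1 (mulmx^~ B)); rewrite mul0mx -mulmxA.
have -> : col_mx M U *m B = 1%:M by apply: mulmx1C.
rewrite mulmx1 => /(congr1 (@rsubmx _ 1 p n)).
by rewrite row_mxKr linear0.
Qed.

Section Sequences.
Variables (S : comNzRingType) (c : nat) (f : 'I_c -> S).

(* Junk value 0 past the end of the sequence. *)
Definition fseq (i : nat) : S := if insub i is Some j then f j else 0.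

Lemma fseqE (i : 'I_c) : fseq i = f i.
Proof. by rewrite /fseq valK. Qed.

Lemma ideal_belowE p x : (p <= c)%N -> ideal_below f p x <-> gen_ideal fseq p x.
Proof.
move=> pc; split=> [[a ->]|[a ->]].
  pose a' (i : nat) := if insub i is Some j then a (j : 'I_c) else 0.
  exists a'; rewrite (big_ord_widen _ (fun i => a' i * fseq i) pc) [RHS]big_mkcond.
  apply: eq_bigr => i _; rewrite /a' fseqE valK.
  by case: ifP => _ //; rewrite scaler0.
exists (fun i : 'I_c => a i); rewrite (big_ord_widen _ (fun i => a i * fseq i) pc).
rewrite big_mkcond; apply: eq_bigr => i _; rewrite fseqE.
by case: ifP => _ //; rewrite scaler0.
Qed.

Lemma gen_ideal_gen q i : (i < q)%N -> gen_ideal fseq q (fseq i).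
Proof.
move=> iq; exists (fun j => (j == i)%:R).
rewrite (bigD1 (Ordinal iq)) //= eqxx mul1r big1 ?addr0 // => j ji.
by rewrite (_ : (j == i :> nat) = false) ?mul0r //; apply/negbTE.
Qed.

Lemma gen_ideal_le q q' x : (q <= q')%N -> gen_ideal fseq q x -> gen_ideal fseq q' x.
Proof.
move=> qq' [a ->]; apply: gen_ideal_sum => i; apply/gen_idealM/gen_ideal_gen.
exact: leq_trans (ltn_ord i) qq'.
Qed.

End Sequences.

Section SmulSet.
Variables (S : comNzRingType) (A : lmodType S) (J : set S).
Implicit Types (N : set A).

Lemma smul_set0 N : smul_set J N 0.
Proof. by exists 0%N, (fun=> 0), (fun=> 0); split; [case | rewrite big_ord0]. Qed.

Lemma smul_setD N x y : smul_set J N x -> smul_set J N y -> smul_set J N (x + y).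
Proof.
move=> [p [a [v [av ->]]]] [q [a' [v' [av' ->]]]].
exists (p + q)%N, (fun i => match fintype.split i with inl j => a j | inr j => a' j end),
  (fun i => match fintype.split i with inl j => v j | inr j => v' j end); split.
  by move=> i; case: fintype.split.
rewrite big_split_ord /=; congr (_ + _); apply: eq_bigr => i _.
  by rewrite (unsplitK (inl i)).
by rewrite (unsplitK (inr i)).
Qed.

Lemma smul_setZ N a x : submodule N -> smul_set J N x -> smul_set J N (a *: x).
Proof.
move=> sN [p [a' [v [av ->]]]]; exists p, a', (fun i => a *: v i); split.
  by move=> i; case: (av i) => ? ?; split => //; apply: submoduleZ.
by rewrite scaler_sumr; apply: eq_bigr => i _; rewrite !scalerA mulrC.
Qed.

Lemma smul_set_submodule N : submodule N -> submodule (smul_set J N).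
Proof.
move=> sN; split=> [|a x y xN yN]; first exact: smul_set0.
by apply: smul_setD => //; apply: smul_setZ.
Qed.

Lemma smul_set_gen N a x : J a -> N x -> smul_set J N (a *: x).
Proof. by move=> Ja Nx; exists 1%N, (fun=> a), (fun=> x); rewrite big_ord1. Qed.

Lemma smul_set_sub N N' (J' : set S) x : (forall a, J a -> J' a) ->
  (forall y, N y -> N' y) -> smul_set J N x -> smul_set J' N' x.
Proof.
move=> JJ' NN' [p [a [v [av ->]]]]; exists p, a, v; split => // i.
by case: (av i) => /JJ' ? /NN'.
Qed.

Lemma smul_set_in N x : submodule N -> smul_set J N x -> N x.
Proof.
move=> sN [p [a [v [av ->]]]]; apply: submodule_sum => // i.
by apply: submoduleZ => //; case: (av i).
Qed.

Lemma smul_set_lincomb N n (b : 'I_n -> A) (a : 'rV_n) :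
  submodule N -> (forall i, N (b i)) ->
  (forall j, J (a 0 j)) -> smul_set J N (lincomb b a).
Proof.
move=> sN Nb aJ; apply: submodule_sum; first exact: smul_set_submodule.
by move=> i; apply: smul_set_gen.
Qed.

(** Here b is a basis of Q modulo P. It serves both for the quotients of a filtration and, with P
    zero, for bases of free modules. *)
Lemma smul_set_coord P Q n (b : 'I_n -> A) (a : 'rV_n) : ideal J -> submodule P ->
  (forall x, Q x -> exists a y, P y /\ x = y + lincomb b a) ->
  (forall a, P (lincomb b a) -> a = 0) ->
  (exists x y, [/\ smul_set J Q x, P y & lincomb b a = x + y]) ->
  forall j, J (a 0 j).
Proof.
move=> idJ sP Qb b_inj [_ [y [[p [u [v [uv ->]]]] Py aE]]].
have /choice [w wP] i : exists w, P (v i - lincomb b w).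
  by have [w [z [Pz ->]]] := Qb _ (uv i).2; exists w; rewrite addrK.
have -> : a = \sum_i u i *: w i.
  have lc : lincomb b (\sum_i u i *: w i) = \sum_i u i *: lincomb b (w i).
    by rewrite linear_sum; apply: eq_bigr => i _; rewrite linearZ.
  apply/eqP; rewrite -subr_eq0; apply/eqP/b_inj; rewrite linearB /= aE lc.
  rewrite addrAC -sumrB; apply: submoduleD => //; apply: submodule_sum => // i.
  by rewrite -scalerBr; apply: submoduleZ.
move=> j; rewrite summxE; apply: (@submodule_sum _ S^o J) => // i.
by rewrite mxE mulrC; apply: (@submoduleZ _ S^o J) => //; case: (uv i).
Qed.

End SmulSet.

Definition catb (A : Type) n1 n2 (b1 : 'I_n1 -> A) (b2 : 'I_n2 -> A) (i : 'I_(n1 + n2)) :=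
  match fintype.split i with inl j => b1 j | inr j => b2 j end.

Lemma lincomb_cat (K : nzRingType) (V : lmodType K) n1 n2 (b1 : 'I_n1 -> V)
    (b2 : 'I_n2 -> V) x y :
  lincomb (catb b1 b2) (row_mx x y) = lincomb b1 x + lincomb b2 y.
Proof.
rewrite /lincomb big_split_ord /=; congr (_ + _); apply: eq_bigr => i _.
  by rewrite row_mxEl /catb (unsplitK (inl i)).
by rewrite row_mxEr /catb (unsplitK (inr i)).
Qed.

Lemma lincomb_const_mulmx (S : comNzRingType) (A B : lmodType S) n p (b : 'I_p -> A)
    (e : 'I_n -> B) (g : {linear B -> A}) (M : 'M[S]_(n, p)) x :
  (forall i, lincomb b (row i M) = g (e i)) -> lincomb b (x *m M) = g (lincomb e x).
Proof.
move=> Mg; rewrite lincomb_mulmx linear_sum; apply: eq_bigr => i _.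
by rewrite linearZ /= Mg.
Qed.

(** * The resolution of a higher matrix factorization module *)

Section Filtration.
Variables (S : comNzRingType) (m : set S) (k : fieldType) (kappa : {rmorphism S -> k}).
Variables (c : nat) (f : 'I_c -> S).
Hypothesis locS : local_ring m.
Hypothesis resS : residue_map m kappa.
Hypothesis fm : forall i, m (f i).
Hypothesis freg : regular_sequence f.

Notation fn := (fseq f).
Notation I_ p := (ideal_below f p).

Lemma kappa_f i : kappa (f i) = 0.
Proof. exact/resS.2. Qed.

Lemma fn_regular p x : (p < c)%N -> gen_ideal fn p (fn p * x) -> gen_ideal fn p x.
Proof.
move=> pc; rewrite -!(ideal_belowE f _ (ltnW pc)).
by rewrite -[p]/(nat_of_ord (Ordinal pc)) fseqE; apply: freg.1.
Qed.

Lemma ideal_below_ideal p : ideal (I_ p).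
Proof.
split; first by exists (fun=> 0); rewrite big1 // => i _; rewrite scale0r.
move=> a x y [u ->] [v ->]; exists (fun i => a * u i + v i).
rewrite scaler_sumr -big_split; apply: eq_bigr => i _.
by rewrite scalerDl scalerA.
Qed.

Variables (A0 A1 : lmodType S) (Fil0 : nat -> set A0) (Fil1 : nat -> set A1).
Variables (d : {linear A1 -> A0}) (h : 'I_c -> A0 -> A1).
Hypothesis ff0 : free_filtration c Fil0.
Hypothesis ff1 : free_filtration c Fil1.
Hypothesis hL : forall (q : 'I_c) (a : S) x y, Fil0 q.+1 x -> Fil0 q.+1 y ->
  h q (a *: x + y) = a *: h q x + h q y.
Hypothesis dFil : forall p y, (p <= c)%N -> Fil1 p y -> Fil0 p (d y).
Hypothesis hFil : forall p q : 'I_c, (q <= p)%N -> forall x,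
  Fil0 q.+1 x -> Fil1 p.+1 (h q x).
Hypothesis dh : forall (p : 'I_c) x, Fil0 p.+1 x ->
  smul_set (I_ p) (Fil0 p.+1) (d (h p x) - f p *: x).
Hypothesis hd : forall (p : 'I_c) y, Fil1 p.+1 y ->
  sum_set (smul_set (I_ p) (Fil1 p.+1)) (Fil1 p) (h p (d y) - f p *: y).
Hypothesis dmin : forall y, smul_set m setT (d y).

Lemma fil_sub (A : lmodType S) (Fil : nat -> set A) p :
  free_filtration c Fil -> (p <= c)%N -> submodule (Fil p).
Proof. by case=> + _ _ _ _ pc; apply. Qed.

Lemma fil_free (A : lmodType S) (Fil : nat -> set A) p :
  free_filtration c Fil -> (p <= c)%N -> fg_free (Fil p).
Proof.
case=> _ _ _ frc fr; rewrite leq_eqVlt => /predU1P[->//|pc].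
by case: (fr p pc).
Qed.

Lemma fil_le (A : lmodType S) (Fil : nat -> set A) p x :
  free_filtration c Fil -> (p < c)%N -> Fil p x -> Fil p.+1 x.
Proof.
move=> ff pc Px; have [C sC [_ Qdec]] :
  exists2 C, submodule C & (forall x, Fil p x -> C x -> x = 0) /\
    forall x, Fil p.+1 x <-> exists y z, [/\ Fil p y, C z & x = y + z].
  apply: summand_projection; first exact: fil_sub ff (ltnW pc).
  by case: ff => _ _ _ _ /(_ p pc)[].
by apply/Qdec; exists x, 0; split; rewrite ?addr0 //; case: sC.
Qed.

Lemma fil_basis (A : lmodType S) (Fil : nat -> set A) p :
  free_filtration c Fil -> (p < c)%N ->
  exists n (b : 'I_n -> A),
    [/\ forall i, Fil p.+1 (b i),
      forall x, Fil p.+1 x -> exists a y, Fil p y /\ x = y + lincomb b a &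
      forall a, Fil p (lincomb b a) -> a = 0].
Proof.
move=> ff pc; apply: (summand_basis locS resS).
- exact: fil_sub ff (ltnW pc).
- exact: fil_sub ff pc.
- exact: fil_free ff (ltnW pc).
- exact: fil_free ff pc.
by case: ff => _ _ _ _ /(_ p pc)[].
Qed.

(** Minimality of d is stated in the whole module, while stage p needs the vectors to lie in
    [Fil p]. The proof goes down from c, one direct summand at a time. *)
Lemma fil_smul (A : lmodType S) (Fil : nat -> set A) p x :
  free_filtration c Fil -> (p <= c)%N -> Fil p x -> smul_set m setT x ->
  smul_set m (Fil p) x.
Proof.
move=> ff pc; rewrite -(subKn pc); elim: (c - p)%N (leq_subr p c) => [|n IH] nc.
  by rewrite subn0; case: ff => _ _ -> _ _.
move=> Px xm; have e : (c - n = (c - n.+1).+1)%N by rewrite -subSn.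
have lt : (c - n.+1 < c)%N by rewrite -e leq_subr.
apply: (smul_set_summand (Q := Fil (c - n)%N)) => //.
- exact: fil_sub ff (ltnW lt).
- by rewrite e; case: ff => _ _ _ _ /(_ _ lt)[].
by apply: IH (ltnW nc) _ xm; rewrite e; apply: fil_le.
Qed.

(* The relations presenting M(p) as a quotient of A_0(p). *)
Definition relations p : set A0 :=
  sum_set (fun z => exists2 y, Fil1 p y & z = d y) (smul_set (I_ p) (Fil0 p)).

Lemma relations_submodule p : (p <= c)%N -> submodule (relations p).
Proof.
move=> pc; have s0 := fil_sub ff0 pc; have s1 := fil_sub ff1 pc.
have ss := smul_set_submodule (I_ p) s0.
split=> [|a _ _ [_ [z [[y Py ->] [zI ->]]]] [_ [z' [[y' Py' ->] [z'I ->]]]]].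
  exists 0, 0; split; first by exists 0; rewrite ?linear0 //; case: s1.
  by rewrite addr0; split => //; apply: smul_set0.
exists (d (a *: y + y')), (a *: z + z'); split.
  by exists (a *: y + y') => //; apply: s1.2.
by split; [apply: ss.2 | rewrite linearP scalerDr addrACA].
Qed.

(** M(p) is not formed as a quotient: a basis b of A_0(p) ties the complex to it by matching
    boundaries with relations. *)
Definition resolved p : Prop :=
  exists (r : nat -> nat) (D : forall n, 'M[S]_(r n.+1, r n))
    (s : nat -> forall n, 'M[S]_(r n, r n.+1)) (b : 'I_(r 0%N) -> A0),
    (hcomplex kappa fn D s p /\ tor_reg kappa s 1 p) /\
    [/\ forall i, Fil0 p (b i), forall x, Fil0 p x -> exists a, x = lincomb b a,
      injective (lincomb b) &
      forall a, boundaries D a <-> relations p (lincomb b a)].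

Lemma resolved0 : resolved 0.
Proof.
exists (fun=> 0%N), (fun n => 0), (fun i n => 0), (fun=> 0); split.
  split.
    split => //; last by move=> n; rewrite map_mx0.
    split=> n; first exact: mul0mx.
    by move=> x _; exists 0; apply/rowP => -[].
  move=> n _ phi _ _ _; exists (fun=> 0); split => //; first by exists 0%N.
  by move=> al _; apply/rowP => -[].
split.
- by case.
- by case: ff0 => _ -> _ _ _ x ->; exists 0; rewrite linear0.
- by move=> x y _; apply/rowP => -[].
move=> a; split=> _.
  rewrite (_ : a = 0) ?linear0; last by apply/rowP => -[].
  by case: (relations_submodule (leq0n c)).
by exists 0; apply/rowP => -[].
Qed.

(** By condition (a), f_p x is [d (h p x)] up to coefficients in the preceding f_i. The image of d
    thus absorbs the multiples of f_p, and the cokernel of the map on R_p-modules is already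
    M(p+1). *)
Lemma relations_split p x : (p < c)%N -> relations p.+1 x ->
  exists y z, [/\ Fil1 p.+1 y, smul_set (I_ p) (Fil0 p.+1) z & x = d y + z].
Proof.
move=> pc [_ [_ [[y Py ->] [[n [a [v [av ->]]]] ->]]]].
have s0 := fil_sub ff0 pc; have s1 := fil_sub ff1 pc.
have ss := smul_set_submodule (I_ p) s0.
pose P := Ordinal pc.
have /choice [u uP] i : exists u : A1 * A0, [/\ Fil1 p.+1 u.1,
    smul_set (I_ p) (Fil0 p.+1) u.2 & a i *: v i = d u.1 + u.2].
  have [/(ideal_belowE f _ pc)/gen_idealS[e [g [gI ->]]] vF] := av i.
  have fP : fn p = f P by rewrite -[p]/(nat_of_ord P) fseqE.
  exists (e *: h P (v i), g *: v i - e *: (d (h P (v i)) - f P *: v i)); split => /=.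
  - by apply: submoduleZ => //; exact: (@hFil P P (leqnn P)).
  - apply: (submoduleB ss); last by apply: (submoduleZ _ ss); exact: (@dh P).
    by apply: smul_set_gen => //; apply/(ideal_belowE f _ (ltnW pc)).
  rewrite linearZ /= scalerBr opprB scalerA fP scalerDl.
  by rewrite [RHS]addrC -addrA subrK addrC.
exists (y + \sum_i (u i).1), (\sum_i (u i).2); split.
- apply: submoduleD => //; apply: submodule_sum => // i; by case: (uP i).
- apply: submodule_sum => // i; by case: (uP i).
rewrite linearD linear_sum -addrA -big_split /=; congr (_ + _).
by apply: eq_bigr => i _; case: (uP i).
Qed.

Lemma h_smul p (pc : (p < c)%N) x : smul_set (I_ p) (Fil0 p.+1) x ->
  smul_set (I_ p) (Fil1 p.+1) (h (Ordinal pc) x).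
Proof.
move=> [n [a [v [av ->]]]]; pose P := Ordinal pc.
have s0 := fil_sub ff0 pc; have s1 := fil_sub ff1 pc.
have hD y z : Fil0 p.+1 y -> Fil0 p.+1 z -> h P (y + z) = h P y + h P z.
  by move=> Py Pz; have := @hL P 1 y z Py Pz; rewrite !scale1r.
have h0 : h P 0 = 0.
  have := hD 0 0 s0.1 s0.1; rewrite addr0 => /eqP.
  by rewrite -subr_eq0 opprD addrA subrr add0r oppr_eq0 => /eqP.
have hZ e y : Fil0 p.+1 y -> h P (e *: y) = e *: h P y.
  by move=> Py; have := @hL P e y 0 Py s0.1; rewrite h0 !addr0.
suff: Fil0 p.+1 (\sum_i a i *: v i) /\
    smul_set (I_ p) (Fil1 p.+1) (h P (\sum_i a i *: v i)) by case.
elim/big_ind: _ => [|y z [Py hy] [Pz hz]|i _].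
- by rewrite h0; split; [case: s0 | exact: smul_set0].
- by rewrite hD //; split; [apply: submoduleD | apply: smul_setD].
have [aI Pv] := av i; rewrite hZ //; split; first exact: submoduleZ.
by apply: smul_set_gen => //; exact: (@hFil P P (leqnn P)).
Qed.

Lemma resolved_step p : (p < c)%N -> resolved p -> resolved p.+1.
Proof.
move=> pc [r [D [s [b [[hc reg] [bF bS b_inj bd]]]]]].
have s0 := fil_sub ff0 pc; have s1 := fil_sub ff1 pc.
have s0' := fil_sub ff0 (ltnW pc); have s1' := fil_sub ff1 (ltnW pc).
have idI := ideal_below_ideal p.
have kos n := @koszul_exists S k kappa fn p n
  (fun q x qp => @fn_regular q x (ltn_trans qp pc)) _.
have kf i : (i < p)%N -> kappa (fn i) = 0.
  by move=> _; rewrite /fseq; case: insubP => [j _ _|_]; rewrite ?kappa_f ?rmorph0.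
have [n0 [b0 [b0F b0S b0_inj]]] := fil_basis ff0 pc.
have [n1 [b1 [b1F b1S b1_inj]]] := fil_basis ff1 pc.
have [r0 [D0 [t0 [e0 hc0 reg0 bd0]]]] := kos kf n0.
have [r1 [D1 [t1 [e1 hc1 reg1 bd1]]]] := kos kf n1.
subst n0 n1 => {kos}.
(* Y resolves the direct sum of M(p) and R_p ⊗ B_0, with [bY] as its basis in degree 0; [D1]
   resolves R_p ⊗ B_1. *)
pose rY := dsum_r r r0; pose DY : forall n, 'M_(rY n.+1, rY n) := dsum_D D D0.
pose sY : nat -> forall n, 'M_(rY n, rY n.+1) := dsum_s s t0.
have hcY : hcomplex kappa fn DY sY p := dsum_hcomplex hc hc0.
have regY : tor_reg kappa sY 1 p.
  by apply: (dsum_reg hc hc0 reg) => n n1; apply: reg0.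
pose bY : 'I_(rY 0%N) -> A0 := catb b b0.
have bYE x y : lincomb bY (row_mx x y) = lincomb b x + lincomb b0 y by exact: lincomb_cat.
have bYF i : Fil0 p.+1 (bY i).
  by rewrite /bY /catb; case: fintype.split => j; [apply: fil_le | apply: b0F].
have bYS x : Fil0 p.+1 x -> exists a, x = lincomb bY a.
  by move=> /b0S[a [y [/bS[a' ->] ->]]]; exists (row_mx a' a); rewrite bYE.
have bY_inj : injective (lincomb bY).
  apply: raddf_inj => a a0; have /eqP := bYE (lsubmx a) (rsubmx a).
  rewrite hsubmxK a0 eq_sym addrC addr_eq0 => /eqP e.
  have a2 : rsubmx a = 0.
    apply: b0_inj; rewrite e; apply: submoduleN => //; exact: submodule_lincomb.
  have a1 : lsubmx a = 0.
    apply: b_inj; rewrite linear0; apply/eqP; rewrite -oppr_eq0 -e a2.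
    by rewrite linear0.
  by rewrite -[a](@hsubmxK _ 1 (r 0%N) (r0 0%N)) a1 a2 row_mx0.
have bdY_ideal (a : 'rV_(rY 0%N)) : (forall j, I_ p (a 0 j)) -> boundaries DY a.
  rewrite -[a](@hsubmxK _ 1 (r 0%N) (r0 0%N)) => aI; apply/dsum_boundaries; split.
    apply/bd; exists 0, (lincomb b (lsubmx a)); rewrite add0r; split.
      by exists 0; rewrite ?linear0 //; case: s1'.
    split => //; apply: smul_set_lincomb => // j.
    by have := aI (lshift _ j); rewrite row_mxEl.
  apply/bd0 => j; apply/(ideal_belowE f _ (ltnW pc)).
  by have := aI (rshift _ j); rewrite row_mxEr.
have /choice [cpsi cpsiP] i : exists a, d (b1 i) = lincomb bY a.
  by apply/bYS/dFil.
pose psi0 : 'M_(r1 0%N, rY 0%N) := \matrix_i cpsi i.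
have psi0E x : lincomb bY (x *m psi0) = d (lincomb b1 x).
  by apply: lincomb_const_mulmx => i; rewrite rowK.
have psi0_min : map_mx kappa psi0 = 0.
  apply/matrixP => i j; rewrite !mxE.
  have : smul_set m (Fil0 p.+1) (d (b1 i)) by apply: fil_smul => //; apply: dFil.
  rewrite cpsiP => -[n [a [v [av]]]].
  have /choice [w wP] l : exists w, v l = lincomb bY w by apply: bYS; case: (av l).
  have -> : \sum_l a l *: v l = lincomb bY (\sum_l a l *: w l).
    by rewrite linear_sum; apply: eq_bigr => l _; rewrite linearZ /= wP.
  move=> /bY_inj ->; rewrite summxE rmorph_sum big1 // => l _.
  by rewrite mxE rmorphM (_ : kappa (a l) = 0) ?mul0r //; apply/resS.2; case: (av l).
(* The rows of [D1 0] have entries in the ideal that annihilates the module resolved by Y, so every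
   matrix in degree 0 extends to a chain map. *)
have psi_lift (B : 'M_(r1 0%N, rY 0%N)) : exists C, D1 0%N *m B = C *m DY 0%N.
  apply: lift_mx => i; apply: bdY_ideal => j; rewrite row_mul mxE.
  apply: (@submodule_sum _ S^o (I_ p)) => // l; rewrite mulrC.
  apply: (@submoduleZ _ S^o (I_ p)) => //; apply/(ideal_belowE f _ (ltnW pc)).
  suff /bd1/(_ l) : boundaries D1 (row i (D1 0%N)) by [].
  by exists (delta_mx 0 i); rewrite rowE.
have [psi [psi00 psiD kpsi]] :=
  minimal_chain_map (hc_acyclic hc1) (hc_acyclic hcY) psi_lift psi0_min.
have bdYE a : boundaries DY a -> exists w z, [/\ Fil1 p w,
    smul_set (I_ p) (Fil0 p.+1) z & lincomb bY a = d w + z].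
  have -> : a = row_mx (lsubmx a) (rsubmx a) by rewrite hsubmxK.
  move=> /dsum_boundaries[/bd[_ [z [[w Pw ->] [zI lE]]]] /bd0 rI].
  exists w, (z + lincomb b0 (rsubmx a)); split => //.
    apply: smul_setD.
      by apply: smul_set_sub zI => // y; apply: fil_le.
    by apply: smul_set_lincomb => // j; apply/(ideal_belowE f _ (ltnW pc)).
  by rewrite bYE lE addrA.
have psi_inj x : boundaries DY (x *m psi 0%N) -> boundaries D1 x.
  rewrite psi00 => /bdYE[w [z [Pw zI]]]; rewrite psi0E => dE.
  apply/bd1 => j; apply: fn_regular => //; apply/(ideal_belowE f _ (ltnW pc)).
  pose P := Ordinal pc; have fP : fn p = f P by rewrite -[p]/(nat_of_ord P) fseqE.
  suff /(_ j) : forall j, I_ p ((f P *: x) 0 j) by rewrite mxE fP.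
  apply: (smul_set_coord idI s1' b1S b1_inj).
  (* Since [d y] has coefficients in the ideal of the preceding f_i, so has [h P (d y)]; condition
     (b) then puts f_p times the coordinates of x into that ideal. *)
  pose y := lincomb b1 x - w.
  have Py : Fil1 p.+1 y.
    by apply: submoduleB => //; [apply: submodule_lincomb | apply: fil_le].
  have dy : d y = z by rewrite linearB /= dE addrAC subrr add0r.
  have [e [g [eI [Pg hE]]]] := @hd P y Py.
  exists (h P (d y) - e), (f P *: w - g); split.
  - apply: (submoduleB (smul_set_submodule _ s1)) => //.
    by apply: h_smul; rewrite dy.
  - by apply: submoduleB => //; apply: submoduleZ.
  have -> : h P (d y) = e + g + f P *: y by rewrite -hE subrK.
  rewrite linearZ /= -{1}[lincomb b1 x](subrK w) scalerDr -/y.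
  by rewrite -[e + g + _]addrA [e + _]addrC addrK [RHS]addrC [RHS]addrA subrK addrC.
pose rC := cone_r r1 rY; pose DC : forall n, 'M_(rC n.+1, rC n) := cone_D D1 DY psi.
have [t hcC] := cone_hcomplex (hc_acyclic hc1) (hc_acyclic hcY) psiD psi_inj hc1 hcY kpsi.
(* This is the origin of the bound 1: the Koszul part for B_1 has bound 0 and enters the cone one
   degree up. *)
have regC := cone_reg hcC reg1 regY.
have bdC (a : 'rV_(rC 0%N)) : boundaries DC a <-> relations p.+1 (lincomb bY a).
  rewrite cone_boundaries0 psi00; split=> [[y [z [-> /bdYE[w [u [Pw uI uE]]]]]]|].
    exists (d (lincomb b1 y + w)), u; split.
      exists (lincomb b1 y + w) => //; apply: submoduleD; last exact: fil_le.
        by [].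
      exact: submodule_lincomb.
    split; last by rewrite linearD /= uE psi0E linearD addrA.
    apply: smul_set_sub uI => // e; rewrite !ideal_belowE ?(ltnW pc) //.
    exact: gen_ideal_le.
  move=> /(relations_split pc)[y [z [Py zI aE]]].
  have [x [w [Pw yE]]] := b1S y Py.
  have [u uE] : exists u, d w = lincomb b u by apply/bS/dFil; rewrite ?(ltnW pc).
  have [g gE] : exists g, z = lincomb bY g by apply/bYS/(smul_set_in s0 zI).
  exists x, (row_mx u 0 + g); split.
    apply: bY_inj; rewrite aE yE !linearD /= psi0E bYE linear0 addr0 -uE gE.
    by rewrite addrCA addrA.
  have [u' uE'] : boundaries D u.
    apply/bd; exists (d w), 0; split; first by exists w.
    by rewrite addr0 uE; split => //; apply: smul_set0.
  have [g' gE'] : boundaries DY g.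
    apply: bdY_ideal; apply: (@smul_set_coord _ _ _ [set 0]%classic (Fil0 p.+1) _ bY).
    - exact: idI.
    - by split=> // e v v' -> ->; rewrite scaler0 addr0.
    - by move=> v /bYS[v' ->]; exists v', 0; rewrite add0r.
    - by move=> v v0; apply: bY_inj; rewrite linear0.
    by exists z, 0; rewrite addr0.
  have [v vE] : boundaries DY (row_mx u 0).
    by apply/dsum_boundaries; split; [exists u' | exists 0; rewrite mul0mx].
  by exists (v + g'); rewrite mulmxDl -vE -gE'.
have acC := hc_acyclic hcC.
have [|tp tpP] := @homotopy_exists S rC DC (fn p) acC.
  move=> a; apply/bdC; exists 0, (lincomb bY (fn p *: a)); rewrite add0r; split.
    by exists 0; rewrite ?linear0 //; case: s1.
  split => //; rewrite linearZ; apply: smul_set_gen; last exact: submodule_lincomb.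
  by apply/ideal_belowE => //; apply: gen_ideal_gen.
(* The cone supplies the homotopies for the preceding f_i. The one for f_p is any that exists on the
   cone; the bound obtained from the others does not see it. *)
pose sC i := if i == p then tp else cone_s (t1 i) (sY i) (t i).
have sCE i : (i < p)%N -> sC i = cone_s (t1 i) (sY i) (t i).
  by move=> ip; rewrite /sC ltn_eqF.
have hcC' : hcomplex kappa fn DC sC p.+1.
  split=> [||i]; [exact: acC | exact: hc_minimal hcC |].
  rewrite ltnS leq_eqVlt => /predU1P[->|ip]; first by rewrite /sC eqxx.
  by rewrite sCE //; exact: (hc_homotopy hcC ip).
exists rC, DC, sC, bY; split; last by split.
split => //; apply: tor_regS hcC' _ => n n1.
apply: (@cartan_exact_embed _ _ _ _ _ _ p
  (tor_op kappa (fun i => cone_s (t1 i) (sY i) (t i)) n)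
  (tor_op kappa (fun i => cone_s (t1 i) (sY i) (t i)) n.+1)
  _ _ idfun idfun idfun idfun) => //.
- by move=> i x ip; rewrite /= sCE.
- by move=> i x ip; rewrite /= sCE.
exact: regC.
Qed.

Lemma resolved_all p : (p <= c)%N -> resolved p.
Proof.
elim: p => [|p IH] pc; first exact: resolved0.
exact: resolved_step (IH (ltnW pc)).
Qed.

End Filtration.

(** * Generators of Tor in degree 1 *)

Section LowerBound.
Variables (S : comNzRingType) (m : set S) (k : fieldType) (kappa : {rmorphism S -> k}).
Variables (c : nat) (f : 'I_c -> S).
Hypothesis locS : local_ring m.
Hypothesis resS : residue_map m kappa.
Hypothesis fm : forall i, m (f i).
Hypothesis freg : regular_sequence f.
Notation I_ p := (ideal_below f p).
Variables (A0 A1 : lmodType S) (d : {linear A1 -> A0}).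
Notation IA0 := (smul_set (I_ c) (setT : set A0)).

Lemma setT_submodule (A : lmodType S) : submodule (setT : set A).
Proof. by []. Qed.

(** Nakayama's lemma for the image of A_1 in A_0 / I A_0, in matrix form: modulo I A_0 the d e_i are
    combinations of themselves by a matrix N with entries in the maximal ideal, and 1 - N is
    invertible. *)
Lemma image_nakayama :
  fg_free (setT : set A1) ->
  (forall y, exists y', smul_set m setT y' /\ IA0 (d y - d y')) -> forall y, IA0 (d y).
Proof.
move=> [n [e [_ eP]]] nak.
have sQ := smul_set_submodule (I_ c) (setT_submodule A0).
have eS x : exists a, x = lincomb e a by have [a [-> _]] := eP x I; exists a.
have /choice [w wP] i : exists w : 'rV[S]_n, (forall j, kappa (w 0 j) = 0) /\
    IA0 (d (e i) - d (lincomb e w)).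
  have [_ [[p [a [v [av ->]]]] dI]] := nak (e i).
  have /choice [u uP] l : exists u, v l = lincomb e u by exact: eS.
  exists (\sum_l a l *: u l); split.
    move=> j; rewrite summxE rmorph_sum big1 // => l _; rewrite mxE rmorphM.
    by have /resS.2 -> := (av l).1; rewrite mul0r.
  have -> : lincomb e (\sum_l a l *: u l) = \sum_l a l *: v l.
    by rewrite linear_sum; apply: eq_bigr => l _; rewrite linearZ /= uP.
  exact: dI.
pose N : 'M[S]_n := \matrix_i w i.
have N0 : map_mx kappa (1%:M - N) = 1%:M.
  rewrite map_mxB map_mx1 (_ : map_mx kappa N = 0) ?subr0 //.
  by apply/matrixP => i j; rewrite !mxE; case: (wP i).
have [|B [_ BN]] := @residue_inverse S m k kappa locS resS _ (1%:M - N).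
  by rewrite N0 det1 oner_neq0.
move=> y; have [a ->] := eS y.
have -> : a = a *m B - a *m B *m N.
  transitivity (a *m B *m (1%:M - N)); last by rewrite mulmxBr mulmx1.
  by rewrite -mulmxA BN mulmx1.
rewrite !linearB /= (lincomb_mulmx e N); set a' := a *m B.
have dl (b : 'I_n -> A1) x : d (lincomb b x) = \sum_i x 0 i *: d (b i).
  by rewrite linear_sum; apply: eq_bigr => i _; rewrite linearZ.
rewrite !dl -sumrB; apply: submodule_sum => // i.
rewrite -scalerBr; apply: submoduleZ => //; rewrite rowK.
by case: (wP i).
Qed.

Variables (Fil0 : nat -> set A0) (h : 'I_c -> A0 -> A1) (P : 'I_c).
Hypothesis Pc : P.+1 = c.
Hypothesis dh : forall x, smul_set (I_ P) setT (d (h P x) - f P *: x).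
Hypothesis hmin : forall x, smul_set m setT (h P x).

(* Otherwise [f_c A_0] would lie in [(f_1, .., f_(c-1)) A_0 + m I A_0]. *)
Lemma image_not_in_ideal :
  fg_free (setT : set A0) -> (exists x : A0, x <> 0) -> exists y, ~ IA0 (d y).
Proof.
move=> A0free [x0 x0N]; apply: contrapT => all.
have {}all y : IA0 (d y) by apply: contrapT => ny; apply: all; exists y.
have [n [e [_ eS /(_ (setT_submodule A0)) e_inj]]] := fg_free_basis A0free.
have [j _] : exists j : 'I_n, True.
  case: n e eS e_inj => [|n] e eS _; last by exists ord0.
  have [a aE] := eS x0 I; case: x0N; rewrite aE (_ : a = 0) ?linear0 //.
  by apply/rowP => -[].
have coord J x : ideal J -> smul_set J setT x ->
    exists a, x = lincomb e a /\ forall j, J (a 0 j).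
  move=> idJ xJ; have [a aE] := eS x I; exists a; split => //.
  apply: (@smul_set_coord _ _ _ [set 0]%classic setT _ e) => //.
  - by split=> // b v v' -> ->; rewrite scaler0 addr0.
  - by move=> v _; have [v' ->] := eS v I; exists v', 0; rewrite add0r.
  - by move=> v v0; apply: e_inj; rewrite linear0.
  by exists x, 0; rewrite addr0.
have [p [a [v [av hE]]]] := hmin (e j).
have /choice [w wP] l := coord _ _ (ideal_below_ideal f c) (all (v l)).
have [z [zE zI]] := coord _ _ (ideal_below_ideal f P) (dh (e j)).
have P_c : (P <= c)%N by rewrite ltnW.
have /choice [g gP] l : exists g : S * S, gen_ideal (fseq f) P g.2 /\
    w l 0 j = g.1 * f P + g.2.
  have ic x : gen_ideal (fseq f) c x -> gen_ideal (fseq f) P.+1 x by rewrite Pc.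
  have /ic := (ideal_belowE f _ (leqnn c)).1 ((wP l).2 j).
  by move=> /gen_idealS[b [y [yI ->]]]; exists (b, y); rewrite fseqE.
(* Coordinate j of the congruence between [d (h P (e j))] and [f P *: e j]. The [a l] come from
   minimality of h, so the factor of [f P] is 1 minus an element of the maximal ideal, a unit. *)
have key : f P * (1 - \sum_l a l * (g l).1) = \sum_l a l * (g l).2 - z 0 j.
  have dE : d (h P (e j)) = lincomb e (\sum_l a l *: w l).
    rewrite hE !linear_sum; apply: eq_bigr => l _; rewrite !linearZ /=.
    by case: (wP l) => <-.
  have : f P *: delta_mx 0 j = \sum_l a l *: w l - z.
    apply: e_inj; rewrite linearZ linearB /= lincomb_delta -dE -zE.
    by rewrite opprB addrC subrK.
  move=> /matrixP/(_ 0 j); rewrite !mxE !eqxx mulr1 summxE mulrBr mulr1 => fE.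
  rewrite {1}fE mulr_sumr addrAC -sumrB; congr (_ - _); apply: eq_bigr => l _.
  by rewrite mxE (gP l).2 mulrDr [f P * _]mulrC mulrA
    [_ + a l * (g l).2]addrC addrK.
have k1 : kappa (1 - \sum_l a l * (g l).1) != 0.
  rewrite rmorphB rmorph1 rmorph_sum big1 ?subr0 ?oner_neq0 // => l _.
  by rewrite rmorphM; have /resS.2 -> := (av l).1; rewrite mul0r.
have [y yE] := residue_unit locS resS k1.
have fPI : I_ P (f P * 1).
  rewrite -yE mulrA key mulrC; apply: (@submoduleZ _ S^o (I_ P)).
    exact: ideal_below_ideal.
  apply: (@submoduleB _ S^o (I_ P)); [exact: ideal_below_ideal | | exact: zI].
  apply: (@submodule_sum _ S^o (I_ P)); first exact: ideal_below_ideal.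
  move=> l; apply: (@submoduleZ _ S^o (I_ P)); first exact: ideal_below_ideal.
  by apply/ideal_belowE => //; case: (gP l).
apply: freg.2; have := freg.1 P 1 fPI.
move=> /(ideal_belowE f _ P_c) h1; apply/ideal_belowE => //.
exact: gen_ideal_le P_c h1.
Qed.

End LowerBound.

(** * The theorem *)

Section TorComparison.
Variables (S : comNzRingType) (k : fieldType) (kappa : {rmorphism S -> k}).
Variables (c : nat) (f : 'I_c -> S) (M : lmodType S).
Variables (L : lmodType (ext k c)) (gr : int -> set L).
Variables (g : nat -> nat) (G : forall n, 'M[S]_(g n.+1, g n)).
Variables (s : nat -> forall n, 'M[S]_(g n, g n.+1)).
Variable epsG : {linear 'rV[S]_(g 0%N) -> M}.

(** [th] is the comparison map from G to the given resolution followed by [p]. On the minimal side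
    the differentials vanish over k, so every row is a cycle and none but 0 is a boundary; this
    makes [th] injective. *)
Lemma tor_comparison : is_TorS kappa f M gr -> free_resolution G epsG ->
  hcomplex kappa (fseq f) G s c ->
  exists th : forall n, 'rV[k]_(g n) -> L,
    [/\ forall n a x y, th n (a *: x + y) = a%:A *: th n x + th n y,
      forall n, injective (th n), forall n z, gr n%:Z z <-> exists x, th n x = z &
      forall (i : 'I_c) n x, th n.+1 (tor_op kappa s n i x) = ext_gen k i *: th n x].
Proof.
case=> _ [r [D [eps [sig [p [resF hF [pL p0] [grN _] pE]]]]]] resG [acG minG hG].
have [a [aD aE]] := resolution_map resG resF.
have [b [bD bE]] := resolution_map resF resG.
have acF := free_resolution_acyclic resF.
pose K u v (A : 'M[S]_(u, v)) : 'M[k]_(u, v) := map_mx kappa A.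
have cyc n x : cycles (fun n => K _ _ (D n)) (x *m K _ _ (b n)).
  case: n x => [//|n] x /=; rewrite -mulmxA -map_mxM bD map_mxM minG mul0mx.
  by rewrite mulmx0.
have ba n : K _ _ (b n) *m K _ _ (a n) = 1%:M.
  have [t [t0 tS]] := resolution_homotopy resG aD aE bD bE.
  have : K _ _ (1%:M - b n *m a n) = 0.
    case: n => [|n]; first by rewrite t0 /K map_mxM minG mulmx0.
    by rewrite tS /K map_mxD !map_mxM !minG mulmx0 mul0mx addr0.
  rewrite /K map_mxB map_mx1 map_mxM => /eqP; rewrite subr_eq0 => /eqP ->.
  by [].
have bdcyc n x : boundaries (fun n => K _ _ (D n)) x ->
    cycles (fun n => K _ _ (D n)) (n := n) x.
  case: n x => [//|n] x [w ->] /=.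
  by rewrite -mulmxA -map_mxM acF.1 map_mx0 mulmx0.
exists (fun n x => p n (x *m K _ _ (b n))); split.
- by move=> n e x y; rewrite mulmxDl -scalemxAl pL.
- move=> n x y e.
  have : boundaries (fun n => K _ _ (D n)) ((x - y) *m K _ _ (b n)).
    apply/p0; first exact: cyc.
    rewrite -scaleN1r addrC mulmxDl -scalemxAl pL // e scaleN1r.
    by rewrite scaleN1r addNr.
  move=> [w wE]; apply/eqP; rewrite -subr_eq0 -[x - y]mulmx1 -(ba n) mulmxA wE.
  by rewrite -mulmxA -map_mxM -aD map_mxM minG mulmx0 mulmx0.
- move=> n z; rewrite grN; split=> [[x [xc <-]]|[x <-]]; last first.
    by exists (x *m K _ _ (b n)).
  exists (x *m K _ _ (a n)); rewrite -mulmxA -map_mxM.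
  have bd : boundaries (fun n => K _ _ (D n)) (x *m K _ _ (1%:M - a n *m b n)).
    have [t [t0 tS]] := resolution_homotopy resF bD bE aD aE.
    exists (x *m K _ _ (t n)); case: n x xc => [|n] x xc.
      by rewrite t0 /K map_mxM mulmxA.
    by rewrite tS /K map_mxD !map_mxM mulmxDr !mulmxA xc mul0mx addr0.
  have xE : x = 1 *: (x *m K _ _ (1%:M - a n *m b n)) + x *m K _ _ (a n *m b n).
    by rewrite scale1r -mulmxDr -map_mxD subrK map_mx1 mulmx1.
  have y0 : p n (x *m K _ _ (1%:M - a n *m b n)) = 0 by apply/p0 => //; apply: bdcyc.
  rewrite [in RHS]xE pL; [by rewrite y0 scaler0 add0r | exact: bdcyc |].
  by rewrite /K map_mxM mulmxA; apply: cyc.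
move=> i n x; rewrite -pE //.
have hGi := hG i (ltn_ord i); rewrite fseqE in hGi.
(* The comparison map intertwines the two homotopies for f_i up to [t]. Over k the term with the
   differential of G vanishes and the other is a boundary, which [p] kills. *)
have [t [t0 tS]] := cone_homotopy_corner acG acF bD hGi (hF i).
pose q := x *m K _ _ (b n) *m K _ _ (sig i n).
have qE : tor_op kappa s n i x *m K _ _ (b n.+1)
    = q + x *m K _ _ (t n) *m K _ _ (D n.+1).
  rewrite /q /tor_op /= -!mulmxA -!map_mxM -mulmxDr -map_mxD.
  case: n x q => [|n] x q.
    by move/eqP: t0; rewrite subr_eq addrC => /eqP ->; rewrite subrK.
  move: (tS n) => /eqP; rewrite subr_eq => /eqP ->.
  by rewrite addrAC subrK map_mxD [in RHS]map_mxM minG mul0mx add0r map_mxM.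
rewrite qE -[q]scale1r.
have qcyc : cycles (fun n => K _ _ (D n)) q.
  rewrite -[q](addrK (x *m K _ _ (t n) *m K _ _ (D n.+1))) -qE /=.
  rewrite mulmxBl -[X in X - _]mulmxA -map_mxM bD map_mxM minG mul0mx mulmx0.
  by rewrite -[X in _ - X]mulmxA -map_mxM acF.1 map_mx0 mulmx0 subr0.
have bd : boundaries (fun n => K _ _ (D n)) (x *m K _ _ (t n) *m K _ _ (D n.+1)).
  by exists (x *m K _ _ (t n)).
have bdc := bdcyc n.+1 _ bd.
by rewrite pL // ((p0 _ _ bdc).2 bd) addr0 !scale1r.
Qed.

End TorComparison.

Lemma tor_graded_pieces (S : comNzRingType) (k : fieldType) (kappa : {rmorphism S -> k})
    c (L : lmodType (ext k c)) (gr : int -> set L) (g : nat -> nat)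
    (s : nat -> forall n, 'M[S]_(g n, g n.+1))
    (th : forall n, 'rV[k]_(g n) -> L) rho :
  grading gr -> tor_reg kappa s rho c ->
  (forall n a x y, th n (a *: x + y) = a%:A *: th n x + th n y) ->
  (forall n, injective (th n)) -> (forall n z, gr n%:Z z <-> exists x, th n x = z) ->
  (forall (i : 'I_c) n x, th n.+1 (tor_op kappa s n i x) = ext_gen k i *: th n x) ->
  graded_pieces rho (fun n => gr n%:Z).
Proof.
move=> [gr0D grM _ _] reg thL th_inj thS thE.
have th0 n : th n 0 = 0.
  have := thL n 1 0 0; rewrite scale1r scale1r scale1r addr0 => /eqP.
  by rewrite -subr_eq0 opprD addrA subrr add0r oppr_eq0 => /eqP.
have thB n : zmod_morphism (th n).
  by move=> x y; rewrite -scaleN1r addrC thL !scaleN1r addrC.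
pose thA n : {additive 'rV[k]_(g n) -> L} :=
  HB.pack (th n) (GRing.isZmodMorphism.Build _ _ (th n) (thB n)).
split.
- by move=> n; case: (gr0D n%:Z).
- by move=> n x y; case: (gr0D n%:Z) => _; apply.
- by move=> d n a x ad xn; rewrite PoszD; apply: grM.
- move=> n; exists (g n), (fun i => th n (delta_mx 0 i)); split.
    by move=> i; apply/thS; exists (delta_mx 0 i).
  move=> z /thS[x <-]; exists (x 0); rewrite {1}[x]row_sum_delta.
  rewrite -[th n]/(thA n : _ -> _) raddf_sum; apply: eq_bigr => i _ /=.
  by rewrite -[x 0 i *: _]addr0 thL th0 addr0.
move=> n /reg ex.
(* An inverse of [th] on the graded piece. Its value at 0 is fixed to 0, outside the piece it is
   arbitrary. *)
have /choice [r1 r1P] z : exists x, (gr n.+1%:Z z -> th n.+1 x = z) /\ (z = 0 -> x = 0).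
  have [->|z0] := pselect (z = 0); first by exists 0; rewrite th0.
  have [/thS[x xE]|nz] := pselect (gr n.+1%:Z z); first by exists x.
  by exists 0.
apply: (@cartan_exact_embed _ _ _ _ _ _ c (tor_op kappa s n) (tor_op kappa s n.+1)
  _ _ (thA n) (thA n.+1) (thA n.+2) r1) => //=.
- by case: (r1P 0) => _; apply.
- by move=> i x ic; have := thE (Ordinal ic) n x; rewrite -egenE => ->.
- by move=> i x ic; have := thE (Ordinal ic) n.+1 x; rewrite -egenE => ->.
- by move=> x xn; case: (r1P x) => + _; apply.
- by move=> x; rewrite -(th0 n.+2) => /th_inj.
- by move=> x; apply/thS; exists x.
Qed.

Lemma hmf_resolved (S : comNzRingType) (m : set S) (k : fieldType)
    (kappa : {rmorphism S -> k}) c (f : 'I_c -> S) (H : hmf f) :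
  local_ring m -> residue_map m kappa -> (forall i, m (f i)) -> regular_sequence f ->
  hmf_minimal m H ->
  resolved kappa f (hmf_Fil0 H) (hmf_Fil1 H) (hmf_d H) c.
Proof.
case: H => A0 A1 Fil0 Fil1 d h ff0 ff1 hL dF hF dh hd /= locS resS fm freg [dmin _].
by apply: (resolved_all locS resS fm freg ff0 ff1 hL dF hF dh hd dmin).
Qed.

(** If the operators mapped degree 0 onto degree 1, every d y would agree modulo I A_0 with the
    image of an element of m A_1, which is the hypothesis of [image_nakayama]. *)
Lemma tor_generators_degree1 (S : comNzRingType) (m : set S) (k : fieldType)
    (kappa : {rmorphism S -> k}) c (f : 'I_c -> S) (H : hmf f)
    g (G : forall n, 'M[S]_(g n.+1, g n)) s (b : 'I_(g 0%N) -> hmf_A0 H) :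
  local_ring m -> residue_map m kappa -> (0 < c)%N -> (forall i, m (f i)) ->
  regular_sequence f -> hmf_minimal m H -> (exists x : hmf_A0 H, x <> 0) ->
  (forall i, (i < c)%N -> homotopy_for G (fseq f i) (s i)) ->
  (forall x, exists a, x = lincomb b a) ->
  (forall a, boundaries G a <->
     relations f (hmf_Fil0 H) (hmf_Fil1 H) (hmf_d H) c (lincomb b a)) ->
  exists v : 'rV[k]_(g 1%N), ~ exists w : 'I_c -> 'rV[k]_(g 0%N),
    v = \sum_(i < c) tor_op kappa s 0 i (w i).
Proof.
case: H b => A0 A1 Fil0 Fil1 d h ff0 ff1 hL dF hF dh hd b /=.
move=> locS resS c0 fm freg [/= _ hmin] A0ne hG bS bd.
have Fil0c : Fil0 c = setT by case: (ff0).
have Fil1c : Fil1 c = setT by case: (ff1).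
have A0free : fg_free (setT : set A0) by rewrite -Fil0c; case: (ff0).
have A1free : fg_free (setT : set A1) by rewrite -Fil1c; case: (ff1).
have Pc' : (c.-1 < c)%N by rewrite prednK.
pose P := Ordinal Pc'; have Pc : P.+1 = c by rewrite /= prednK.
have FilP x : Fil0 P.+1 x by rewrite Pc Fil0c.
have dhP x : smul_set (ideal_below f P) setT (d (h P x) - f P *: x).
  by apply: smul_set_sub (dh P x (FilP x)).
have [y yN] := image_not_in_ideal locS resS freg Pc dhP
  (fun x => hmin P x (FilP x)) A0free A0ne.
apply: contrapT => all; apply: yN; apply: (image_nakayama locS resS A1free) => {}y.
have IA0 := smul_set_submodule (ideal_below f c) (setT_submodule A0).
have [a0 a0E] := bS (d y).
have [x xE] : boundaries G a0.
  apply/bd; exists (d y), 0; split; first by exists y => //; rewrite Fil1c.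
  by rewrite addr0 a0E; split => //; apply: smul_set0.
have [w wE] : exists w : 'I_c -> 'rV[k]_(g 0%N),
    map_mx kappa x = \sum_(i < c) tor_op kappa s 0 i (w i).
  by apply: contrapT => nw; apply: all; exists (map_mx kappa x).
have /choice [W WE] i : exists W : 'rV[S]_(g 0%N), map_mx kappa W = w i.
  have /choice [u uE] j : exists u, kappa u = w i 0 j by exact: resS.1.
  by exists (\row_j u j); apply/rowP => j; rewrite !mxE uE.
(* Subtracting the homotopy terms makes the coefficients vanish over k, while in degree 0 it changes
   the boundary only by multiples of the f_i. *)
pose x' := x - \sum_(i < c) W i *m s i 0%N.
have x'0 j : m (x' 0 j).
  apply/resS.2; have : map_mx kappa x' = 0.
    rewrite map_mxB wE; apply/eqP; rewrite subr_eq0; apply/eqP.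
    rewrite raddf_sum; apply: eq_bigr => i _.
    by rewrite /= map_mxM WE.
  by move=> /rowP/(_ j); rewrite !mxE.
have x'G : x' *m G 0%N = a0 - \sum_(i < c) f i *: W i.
  rewrite mulmxBl -xE mulmx_suml; congr (_ - _); apply: eq_bigr => i _.
  by rewrite -mulmxA (hG i (ltn_ord i)).1 fseqE mul_mx_scalar.
have /choice [u uP] j : exists u : A1 * A0, smul_set (ideal_below f c) setT u.2 /\
    lincomb b (row j (G 0%N)) = d u.1 + u.2.
  have : boundaries G (row j (G 0%N)) by exists (delta_mx 0 j); rewrite rowE.
  by move=> /bd[_ [z [[y' _ ->] [zI ->]]]]; exists (y', z); split => //=; rewrite -Fil0c.
exists (\sum_j x' 0 j *: (u j).1); split.
  by exists (g 1%N), (fun j => x' 0 j), (fun j => (u j).1).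
have -> : d y = lincomb b (x' *m G 0%N) + \sum_(i < c) f i *: lincomb b (W i).
  rewrite x'G linearB /= -a0E.
  have -> : lincomb b (\sum_(i < c) f i *: W i) = \sum_(i < c) f i *: lincomb b (W i).
    by rewrite linear_sum; apply: eq_bigr => i _; rewrite linearZ.
  by rewrite subrK.
have -> : d (\sum_j x' 0 j *: (u j).1) = \sum_j x' 0 j *: d (u j).1.
  by rewrite linear_sum; apply: eq_bigr => j _; rewrite linearZ.
rewrite lincomb_mulmx addrAC -sumrB.
apply: submoduleD => //; apply: submodule_sum => // i.
  rewrite -scalerBr; apply: submoduleZ => //.
  by case: (uP i) => uI ->; rewrite addrAC subrr add0r.
apply: smul_set_gen => //; apply/ideal_belowE => //; rewrite -fseqE.
exact: gen_ideal_gen.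
Qed.

Theorem theorem5p3 (S : comNzRingType) (m : set S) (k : fieldType)
  (kappa : {rmorphism S -> k}) (c : nat) (f : 'I_c -> S)
  (H : hmf f) (M : lmodType S) (pi : {linear hmf_A0 H -> M})
  (L : lmodType (ext k c)) (gr : int -> set L) :
  regular_local_ring m ->
  residue_map m kappa ->
  (0 < c)%N ->
  (forall i, m (f i)) ->
  regular_sequence f ->
  hmf_minimal m H ->
  hmf_module pi ->
  (exists x : M, x <> 0) ->
  is_TorS kappa f M gr ->
  is_regularity gr 1.
Proof.
move=> [_ locS _] resS c0 fm freg Hmin [pi_surj pi_ker] [z0 z0N] tor.
have [g [G [s [b [[hc reg] [_ bS _ bd]]]]]] := hmf_resolved locS resS fm freg Hmin.
have [ff0 ff1] : free_filtration c (hmf_Fil0 H) /\ free_filtration c (hmf_Fil1 H).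
  by case: (H).
have Fil0c : hmf_Fil0 H c = setT by case: ff0.
have Fil1c : hmf_Fil1 H c = setT by case: ff1.
have {}bS x : exists a, x = lincomb b a by apply: bS; rewrite Fil0c.
pose epsG : {linear 'rV[S]_(g 0%N) -> M} := pi \o lincomb b.
(* The filtrations end in the whole modules, so the relations at stage c are those presenting M. *)
have resG : free_resolution G epsG.
  apply: acyclic_free_resolution (hc_acyclic hc) _ _.
    by move=> z; have [x <-] := pi_surj z; have [a ->] := bS x; exists a.
  move=> a; rewrite bd /= pi_ker /relations Fil0c Fil1c.
  split=> [[_ [z [[y ->] [zI ->]]]]|[_ [z [[y _ ->] [zI ->]]]]].
    by exists (hmf_d H y), z; split => //; exists y.
  by exists (hmf_d H y), z; split => //; exists y.
have [th [thL th_inj thS thE]] := tor_comparison tor resG hc.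
have grP : grading gr by case: tor.
have gr_neg j z : j < 0 -> gr j z -> z = 0.
  by case: tor => _ [? [? [? [? [? [_ _ _ [_ h] _]]]]]]; apply: h.
have GP := tor_graded_pieces grP reg thL th_inj thS thE.
have [|v vN] := tor_generators_degree1 locS resS c0 fm freg Hmin _ (hc_homotopy hc) bS bd.
  have [x xE] := pi_surj z0; exists x => x0; apply: z0N.
  by rewrite -xE x0 linear0.
apply: (regularity1 grP (z := th 1%N v) gr_neg GP).
  by apply/(thS 1%N); exists v.
move=> [y [y0 yE]]; apply: vN.
have /choice [w wE] i := (thS 0%N (y i)).1 (y0 i).
exists w; apply: th_inj; rewrite yE.
have th0 n : th n 0 = 0.
  have := thL n 1 0 0; rewrite !scale1r addr0 => /eqP.
  by rewrite -subr_eq0 opprD addrA subrr add0r oppr_eq0 => /eqP.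
have thD n u u' : th n (u + u') = th n u + th n u'.
  by have := thL n 1 u u'; rewrite !scale1r.
rewrite (big_morph _ (thD 1%N) (th0 1%N)).
by apply: eq_bigr => i _; rewrite -wE thE.
Qed.
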